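(* Let $\mu$ be a positive Borel measure on $[0,1)$, let $1\le p\le q<\infty$, $\beta>0$ and $\alpha_1,\alpha_2>-1$ satisfy $\frac{\alpha_1+2}{p}-\frac{\alpha_2+2}{q}+\beta>0$. Then $\mathcal C_{\mu,\beta}$ maps $A^p_{\alpha_1}$ into $A^q_{\alpha_2}$ if and only if $\mu$ is an $s$-Carleson measure, where $$s=\beta+\frac{\alpha_1+2}{p}-\frac{\alpha_2+2}{q}.$$
   Context: $\mathbb D$ is the open unit disc of $\mathbb C$ and $\mathcal H(\mathbb D)$ the space of analytic functions on $\mathbb D$. Positive Borel measures on $[0,1)$ are understood to be finite. For $\beta>0$ and $f\in\mathcal H(\mathbb D)$, $\mathcal C_{\mu,\beta}(f)(z)=\int_0^1 \frac{f(tz)}{(1-tz)^\beta}\,d\mu(t)$, $z\in\mathbb D$; this belongs to $\mathcal H(\mathbb D)$. For $0<p<\infty$ and $\alpha>-1$, the weighted Bergman space $A^p_\alpha$ consists of all $f\in\mathcal H(\mathbb D)$ with $\int_{\mathbb D}|f(z)|^p(1-|z|^2)^\alpha\,dA(z)<\infty$, where $dA$ is normalized Lebesgue measure on $\mathbb D$. For $s>0$, $\mu$ on $[0,1)$ is $s$-Carleson if there is $C>0$ with $\mu([r,1))\le C(1-r)^s$ for all $0<r<1$. *)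

(* Defs.v *)
From HB Require Import structures.
From mathcomp Require Import all_boot all_order all_algebra.
From mathcomp Require Import complex.
From mathcomp Require Import all_classical all_reals all_analysis.

Set Implicit Arguments.
Unset Strict Implicit.
Unset Printing Implicit Defensive.

Import Order.TTheory GRing.Theory Num.Theory.
Import numFieldNormedType.Exports.
Import ComplexField.Normc.

Local Open Scope classical_set_scope.
Local Open Scope complex_scope.
Local Open Scope ring_scope.

(* [normc] is the modulus with values in [R]; the norm [`|z|] of [R[i]] is
   [(normc z)%:C]. *)

Definition udisc (R : realType) : set R[i] := [set z | normc z < 1].

(* Functions on the disc are total functions of which only the values on
   [udisc] matter.  The topology on [R[i]] is that of [R[i]^o]. *)
Definition analytic_on_disc (R : realType) (f : R[i] -> R[i]) : Prop :=
  forall z0 : R[i], udisc z0 ->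
    exists r : R, 0 < r /\
    exists a : nat -> R[i], forall z, udisc z -> normc (z - z0) < r ->
      series (fun n => (a n * (z - z0) ^+ n : R[i]^o)) @ \oo --> (f z : R[i]^o).

Definition cexp (R : realType) (w : R[i]) : R[i] :=
  (expR (complex.Re w))%:C * (cos (complex.Im w) +i* sin (complex.Im w)).

(* Principal argument in ]-pi, pi], for w != 0. *)
Definition carg (R : realType) (w : R[i]) : R :=
  let t := acos (complex.Re w / normc w) in
  if 0 <= complex.Im w then t else - t.

Definition clog (R : realType) (w : R[i]) : R[i] := ln (normc w) +i* carg w.

(* Principal branch of w^b. *)
Definition cpowR (R : realType) (w : R[i]) (b : R) : R[i] :=
  cexp (b%:C * clog w).

Definition cintegral (R : realType)
    (mu : {measure set (measurableTypeR R) -> \bar R})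
    (D : set R) (g : R -> R[i]) : R[i] :=
  (\int[mu]_(t in D) complex.Re (g t)) +i* (\int[mu]_(t in D) complex.Im (g t)).

Definition cesaro_op (R : realType)
    (mu : {measure set (measurableTypeR R) -> \bar R}) (beta : R)
    (f : R[i] -> R[i]) : R[i] -> R[i] :=
  fun z => cintegral mu `[0, 1[
    (fun t => f (t%:C * z) / cpowR (1 - t%:C * z) beta).

(* Lebesgue measure on the plane, normalized so that the unit disc has
   measure 1. *)
Definition area (R : realType) :
    {measure set (measurableTypeR R * measurableTypeR R) -> \bar R} :=
  mscale (NngNum (divr_ge0 ler01 (pi_ge0 R)))
    (@lebesgue_measure R \x @lebesgue_measure R)%E.

Definition bergman (R : realType) (p alpha : R) : set (R[i] -> R[i]) :=
  [set f | analytic_on_disc f /\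
    (\int[@area R]_(w in [set w | udisc (w.1 +i* w.2)])
       (normc (f (w.1 +i* w.2)) `^ p
        * (1 - normc (w.1 +i* w.2) ^+ 2) `^ alpha)%:E < +oo)%E].

Definition carleson (R : realType)
    (mu : {measure set (measurableTypeR R) -> \bar R}) (s : R) : Prop :=
  exists C : R, 0 < C /\
    forall r : R, 0 < r < 1 -> (mu [set` `[r, 1[%R] <= (C * (1 - r) `^ s)%:E)%E.

(* Main.v *)
(* Write d(z) = 1 - |z|.  Cauchy's formula, averaged over squares, bounds |f(z)|^p
   by the mean of |f|^p over a square of size d(z) about z; hence the growth bound
   |f(z)| <= C d(z)^(-(alpha + 2) / p) for f in A^p_alpha, which embeds A^p_alpha
   in A^q_alpha' with (alpha' + 2) / q = (alpha + 2) / p and reduces sufficiency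
   to p = q.  There, Jensen's inequality with the weight (1 - t|z|)^(-a) bounds
   |C f(z)|^p by the integral of |f(tz)|^p (1 - t|z|)^b against mu.  Replacing
   |f(tz)|^p by a mean around uz, for all u with 1 - u comparable to 1 - t, and
   using the Carleson condition, mu is replaced by (1 - u)^(s - 1) du; Tonelli, the
   dilation z -> uz and a beta integral then leave the integral of |f|^p d^alpha1.

   Conversely, if mu is not s-Carleson there are a_k in [1/2, 1) such that
   mu [a_k, 1) > 4^k (1 - a_k)^s.  The sum f of the normalized kernels
   2^(-k-1) (1 - a_k)^tau (1 - a_k z)^(-M), where M - tau = (alpha1 + 2) / p, is in
   A^p_alpha1, but C f(a_k) >= c 2^k (1 - a_k)^(-(alpha2 + 2) / q) contradicts the
   growth bound in A^q_alpha2. *)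

Require Import Defs.
From HB Require Import structures.
From mathcomp Require Import all_boot all_order all_algebra.
From mathcomp Require Import complex.
From mathcomp Require Import all_classical all_reals all_analysis.
From mathcomp Require Import measurable_realfun.
From mathcomp Require Import ring lra.
Import Order.TTheory GRing.Theory Num.Theory.
Import numFieldNormedType.Exports.
Import ComplexField.Normc.
Local Open Scope classical_set_scope.
Local Open Scope complex_scope.
Local Open Scope ring_scope.

Set Implicit Arguments.
Unset Strict Implicit.
Unset Printing Implicit Defensive.

(** The hypothesis of necessity gives no norm inequality, so kernels cannot be tested one at a time
    with a common constant: a single function has to contain them all. The growth [4^k] pays for the
    weight [2^(-k-1)] of the k-th kernel and still leaves [2^k]; since every kernel is positive on
    [[0, 1)], the other terms cannot cancel the k-th one. The sum is written as an integral against
    a measure with atoms at the [a_k], so that analyticity and Jensen's inequality are proved once,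
    for it and for [C f].

    Integration over the plane goes through Tonelli in Cartesian coordinates. This is why squares
    replace discs, why dilation is a scaling of both coordinates, and why the radial integral is
    taken in the dilation parameter: once [u z] has been renamed [z], the beta integral runs over
    [|z| < u < 1].

    Constants are not sharp. In particular a complex integral is bounded by twice the integral of
    the modulus, through its real and imaginary parts, and powers of comparable quantities are
    exchanged at the cost of a factor that covers both signs of the exponent. *)

Section Modulus.
Context {R : realType}.
Implicit Types (x y z w : R[i]) (r s : R).

Lemma normc_ge0 z : 0 <= normc z.
Proof. by case: z => a b; exact: sqrtr_ge0. Qed.

Lemma normc_sqr z : normc z ^+ 2 = complex.Re z ^+ 2 + complex.Im z ^+ 2.
Proof. by case: z => a b /=; rewrite sqr_sqrtr// addr_ge0// sqr_ge0. Qed.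

Lemma ler_normcD x y : normc (x + y) <= normc x + normc y.
Proof. exact: (@le_normcD R x y). Qed.

Lemma normcN' x : normc (- x) = normc x.
Proof. exact: (@normcN R x). Qed.

Lemma normc_distC x y : normc (x - y) = normc (y - x).
Proof. by rewrite -normcN' opprB. Qed.

Lemma normcX z n : normc (z ^+ n) = normc z ^+ n.
Proof. by elim: n => [|n IH]; rewrite ?expr0 ?normc1// !exprS normcM IH. Qed.

Lemma normc_eq0 z : (normc z == 0) = (z == 0).
Proof. by apply/eqP/eqP => [/eq0_normc//|->]; exact: normc0. Qed.

Lemma normc_gt0 z : (0 < normc z) = (z != 0).
Proof. by rewrite lt_neqAle normc_ge0 andbT eq_sym normc_eq0. Qed.

Lemma normc_real r : normc r%:C = `|r|.
Proof. by rewrite /= expr0n/= addr0 sqrtr_sqr. Qed.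

Lemma normc_i : normc ('i : R[i]) = 1.
Proof. by rewrite /= expr0n/= add0r expr1n sqrtr1. Qed.

Lemma ler_Re_normc z : `|complex.Re z| <= normc z.
Proof.
rewrite -(@ler_pXn2r _ 2) ?nnegrE ?normc_ge0// normc_sqr -normrX ger0_norm ?sqr_ge0//.
by rewrite lerDl sqr_ge0.
Qed.

Lemma ler_Im_normc z : `|complex.Im z| <= normc z.
Proof.
rewrite -(@ler_pXn2r _ 2) ?nnegrE ?normc_ge0// normc_sqr -normrX ger0_norm ?sqr_ge0//.
by rewrite lerDr sqr_ge0.
Qed.

Lemma normc_le_ReIm z : normc z <= `|complex.Re z| + `|complex.Im z|.
Proof.
case: z => a b /=; rewrite -(@ler_pXn2r _ 2) ?nnegrE ?sqrtr_ge0 ?addr_ge0//.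
rewrite sqr_sqrtr ?addr_ge0 ?sqr_ge0// sqrrD -(real_normK (num_real a)) -(real_normK (num_real b)).
by have := mulr_ge0 (normr_ge0 a) (normr_ge0 b); lra.
Qed.

Lemma ler_normcB x y : normc (x - y) <= normc x + normc y.
Proof. by rewrite (le_trans (ler_normcD _ _))// normcN'. Qed.

Lemma lerB_normc x y : normc x - normc y <= normc (x - y).
Proof. by rewrite lerBlDr -{1}(subrK y x) ler_normcD. Qed.

Lemma ler_dist_normc x y : `|normc x - normc y| <= normc (x - y).
Proof. by rewrite ler_norml lerNl opprB {1}normc_distC !lerB_normc. Qed.

Lemma ler_normc_trans z x y : normc (x - y) <= normc (x - z) + normc (z - y).
Proof. by rewrite -[x in leLHS](subrK z) -addrA ler_normcD. Qed.

Lemma ReD' x y : complex.Re (x + y) = complex.Re x + complex.Re y.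
Proof. by case: x; case: y. Qed.
Lemma ImD' x y : complex.Im (x + y) = complex.Im x + complex.Im y.
Proof. by case: x; case: y. Qed.
Lemma ReB' x y : complex.Re (x - y) = complex.Re x - complex.Re y.
Proof. by case: x; case: y. Qed.
Lemma ImB' x y : complex.Im (x - y) = complex.Im x - complex.Im y.
Proof. by case: x; case: y. Qed.
Lemma ReM' x y : complex.Re (x * y) =
  complex.Re x * complex.Re y - complex.Im x * complex.Im y.
Proof. by case: x; case: y. Qed.
Lemma ImM' x y : complex.Im (x * y) =
  complex.Re x * complex.Im y + complex.Im x * complex.Re y.
Proof. by case: x => a b; case: y => c d /=; rewrite addrC mulrC; congr +%R; rewrite mulrC. Qed.

Lemma ReMr r z : complex.Re (r%:C * z) = r * complex.Re z.
Proof. by case: z => a b /=; rewrite mul0r subr0. Qed.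
Lemma ImMr r z : complex.Im (r%:C * z) = r * complex.Im z.
Proof. by case: z => a b /=; rewrite mul0r addr0. Qed.

Lemma normcMr r z : normc (r%:C * z) = `|r| * normc z.
Proof. by rewrite normcM normc_real. Qed.

End Modulus.

Section Topology.
Context {R : realType}.

Lemma cvgC_normcP (u : nat -> R[i]) (l : R[i]) :
  ((u : nat -> R[i]^o) @ \oo --> (l : R[i]^o)) <->
  (forall e : R, 0 < e -> exists N : nat, forall n, (N <= n)%N ->
      normc (u n - l) < e).
Proof.
split => [/cvgrPdist_lt ul e e0|H].
  have e0' : (0 : R[i]) < e%:C by rewrite ltcR.
  have [N _ HN] := ul _ e0'; exists N => n Nn.
  have := HN n Nn; rewrite /= normc_distC.
  by rewrite ltcR.
(* A positive element of [R[i]] has zero imaginary part, so the given bound is a real number. *)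
apply/cvgrPdist_lt => -[a b]; rewrite ltcE/= => /andP[/eqP-> a0].
have [N HN] := H _ a0; exists N => // n Nn.
by have := HN n Nn; rewrite normc_distC -ltcR.
Qed.

End Topology.

(** * Complex differentiation *)

Section ComplexDerivative.
Context {R : realType}.
Implicit Types (f g : R[i] -> R[i]) (z w : R[i]).

Definition ccont f z0 := forall e : R, 0 < e ->
  exists2 d : R, 0 < d & forall z, normc (z - z0) < d -> normc (f z - f z0) < e.

(* A locally uniform second-order error makes the derivative continuous for
   free and keeps every differentiation under an integral sign elementary. *)
Definition cderiv f f' z0 := exists d C : R, [/\ 0 < d, 0 <= C &
  forall z w, normc (z - z0) < d -> normc (w - z0) < d ->
    normc (f w - f z - f' z * (w - z)) <= C * normc (w - z) ^+ 2].

Lemma ccont_cst (c : R[i]) z0 : ccont (fun=> c) z0.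
Proof. by move=> e e0; exists 1 => // z _; rewrite subrr normc0. Qed.

Lemma ccont_id z0 : ccont id z0.
Proof. by move=> e e0; exists e. Qed.

Lemma ccontD f g z0 : ccont f z0 -> ccont g z0 -> ccont (fun z => f z + g z) z0.
Proof.
move=> cf cg e e0; have e2 : 0 < e / 2 by lra.
have [d d0 H] := cf _ e2; have [d' d'0 H'] := cg _ e2.
exists (Num.min d d'); first by rewrite lt_min d0.
move=> z; rewrite lt_min => /andP[/H h /H' h'].
rewrite opprD addrACA (le_lt_trans (ler_normcD _ _))//; lra.
Qed.

Lemma ccontN f z0 : ccont f z0 -> ccont (fun z => - f z) z0.
Proof.
by move=> cf e /cf[d d0 H]; exists d => // z /H; rewrite -opprD normcN'.
Qed.

Lemma ccontM f g z0 : ccont f z0 -> ccont g z0 -> ccont (fun z => f z * g z) z0.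
Proof.
move=> cf cg e e0.
pose M := normc (f z0) + normc (g z0) + 1.
have f0 := normc_ge0 (f z0); have g0 := normc_ge0 (g z0).
have M1 : 1 <= M by rewrite /M; lra.
have M0 : 0 < M by lra.
pose e' := Num.min 1 (e / (2 * M)).
have e'0 : 0 < e' by rewrite lt_min ltr01 divr_gt0//; lra.
have e'1 : e' <= 1 by rewrite ge_min lexx.
have e'M : e' * (2 * M) <= e.
  by rewrite -ler_pdivlMr ?ge_min ?lexx ?orbT//; lra.
have [d d0 H] := cf _ e'0; have [d' d'0 H'] := cg _ e'0.
exists (Num.min d d'); first by rewrite lt_min d0.
move=> z; rewrite lt_min => /andP[/H h /H' h'].
have -> : f z * g z - f z0 * g z0 = (f z - f z0) * g z + f z0 * (g z - g z0) by ring.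
rewrite (le_lt_trans (ler_normcD _ _))// !normcM.
have hg : normc (g z) <= normc (g z0) + 1.
  by have := lerB_normc (g z) (g z0); lra.
apply: (@le_lt_trans _ _ (normc (f z - f z0) * M + M * normc (g z - g z0))).
  apply: lerD.
    by apply: ler_wpM2l; [exact: normc_ge0|rewrite /M; lra].
  by apply: ler_wpM2r; [exact: normc_ge0|rewrite /M; lra].
apply: lt_le_trans e'M; nra.
Qed.

Lemma ccontV f z0 : f z0 != 0 -> ccont f z0 -> ccont (fun z => (f z)^-1) z0.
Proof.
move=> fz0 cf e e0.
have m0 : 0 < normc (f z0) by rewrite normc_gt0.
set m := normc (f z0) in m0.
pose e' := Num.min (m / 2) (e * (m * m) / 4).
have e'0 : 0 < e' by rewrite lt_min !divr_gt0// !mulr_gt0.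
have e'1 : e' <= m / 2 by rewrite ge_min lexx.
have e'2 : e' <= e * (m * m) / 4 by rewrite ge_min lexx orbT.
have [d d0 H] := cf _ e'0; exists d => // z /H h.
have hz : m / 2 < normc (f z).
  by have := lerB_normc (f z0) (f z); rewrite normc_distC -/m; lra.
have fz : f z != 0 by rewrite -normc_gt0; lra.
have -> : (f z)^-1 - (f z0)^-1 = (f z0 - f z) / (f z * f z0) by field; rewrite ?fz ?fz0.
rewrite normcM normcV normcM -/m ltr_pdivrMr; last by rewrite mulr_gt0//; lra.
rewrite normc_distC (lt_le_trans h)// (le_trans e'2)//.
have -> : e * (m * m) / 4 = e * (m / 4 * m) by field.
by rewrite ler_pM2l// ler_pM2r//; lra.
Qed.

Lemma ccont_comp f g z0 : ccont g z0 -> ccont f (g z0) -> ccont (f \o g) z0.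
Proof.
move=> cg cf e /cf[d d0 H]; have [d' d'0 H'] := cg _ d0.
by exists d' => // z /H'/H.
Qed.

Lemma ccont_eq_near f g z0 (r : R) : 0 < r ->
  (forall z, normc (z - z0) < r -> f z = g z) -> ccont f z0 -> ccont g z0.
Proof.
move=> r0 fg cf e /cf[d d0 H].
exists (Num.min d r); first by rewrite lt_min d0.
move=> z; rewrite lt_min => /andP[/H h zr].
by rewrite -!fg// subrr normc0.
Qed.

(** The estimate is symmetric in its two points: adding it for [(z0, z)] and [(z, z0)] cancels [f]
    and leaves [(f' z - f' z0) * (z - z0)], of modulus at most [2 * C * normc (z - z0) ^+ 2]. *)
Lemma cderiv_ccont_deriv f f' z0 : cderiv f f' z0 -> ccont f' z0.
Proof.
move=> [d [C [d0 C0 H]]] e e0.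
pose d' := Num.min d (e / (2 * C + 1)).
have d'0 : 0 < d' by rewrite lt_min d0 divr_gt0//; lra.
exists d' => // z; rewrite lt_min => /andP[zd ze].
have [->|zz0] := eqVneq z z0; first by rewrite subrr normc0.
have h0 : normc (z0 - z0) < d by rewrite subrr normc0.
have H1 := H _ _ zd h0; have H2 := H _ _ h0 zd.
have n0 : 0 < normc (z - z0) by rewrite normc_gt0 subr_eq0.
have : normc ((f' z - f' z0) * (z - z0)) <= 2 * C * normc (z - z0) ^+ 2.
  have -> : (f' z - f' z0) * (z - z0) =
    (f z0 - f z - f' z * (z0 - z)) + (f z - f z0 - f' z0 * (z - z0)) by ring.
  rewrite (le_trans (ler_normcD _ _))// (le_trans (lerD H1 H2))//.
  by rewrite (normc_distC z0) -mulrDl; lra.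
rewrite normcM expr2 mulrA ler_pM2r// => /le_lt_trans; apply.
move: ze; rewrite ltr_pdivlMr; [|lra]; nra.
Qed.

Lemma cderiv_ccont f f' z0 : cderiv f f' z0 -> ccont f z0.
Proof.
move=> [d [C [d0 C0 H]]] e e0.
pose M := normc (f' z0) + C + 1.
have f0 := normc_ge0 (f' z0).
pose d' := Num.min (Num.min d 1) (e / M).
have d'0 : 0 < d' by rewrite !lt_min d0 ltr01 divr_gt0// /M; lra.
exists d' => // z; rewrite !lt_min => /andP[/andP[zd z1] ze].
have h0 : normc (z0 - z0) < d by rewrite subrr normc0.
have H2 := H _ _ h0 zd.
have -> : f z - f z0 = (f z - f z0 - f' z0 * (z - z0)) + f' z0 * (z - z0) by ring.
rewrite (le_lt_trans (ler_normcD _ _))// normcM.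
move: ze; rewrite ltr_pdivlMr; last by rewrite /M; lra.
move=> ze; apply: le_lt_trans ze; rewrite /M.
have n0 := normc_ge0 (z - z0).
apply: (@le_trans _ _ (C * normc (z - z0) + normc (f' z0) * normc (z - z0))); last nra.
rewrite lerD2r (le_trans H2)// expr2 mulrA ler_piMr ?mulr_ge0//; lra.
Qed.

Lemma cderiv_cst (c : R[i]) z0 : cderiv (fun=> c) (fun=> 0) z0.
Proof.
exists 1, 0; split => // z w _ _.
by rewrite subrr mul0r subr0 normc0 mul0r.
Qed.

Lemma cderiv_id z0 : cderiv id (fun=> 1) z0.
Proof.
by exists 1, 0; split => // z w _ _; rewrite mul1r subrr normc0 mul0r.
Qed.

Lemma ccont_bounded f z0 : ccont f z0 ->
  exists d M : R, [/\ 0 < d, 0 <= M & forall z, normc (z - z0) < d -> normc (f z) <= M].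
Proof.
move=> /(_ _ ltr01)[d d0 H]; exists d, (normc (f z0) + 1); split => //.
  by rewrite addr_ge0// normc_ge0.
by move=> z /H; have := lerB_normc (f z) (f z0); lra.
Qed.

Lemma cderiv_lipschitz f f' z0 : cderiv f f' z0 ->
  exists d L : R, [/\ 0 < d, 0 <= L & forall z w,
    normc (z - z0) < d -> normc (w - z0) < d -> normc (f w - f z) <= L * normc (w - z)].
Proof.
move=> df; have [d1 [M [d10 M0 HM]]] := ccont_bounded (cderiv_ccont_deriv df).
move: df => [d [C [d0 C0 H]]].
exists (Num.min (Num.min d d1) 1), (C * 2 + M); split.
- by rewrite !lt_min d0 d10 ltr01.
- lra.
- move=> z w; rewrite !lt_min => /andP[/andP[zd zd1] z1] /andP[/andP[wd wd1] w1].
  have -> : f w - f z = (f w - f z - f' z * (w - z)) + f' z * (w - z) by ring.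
  rewrite (le_trans (ler_normcD _ _))// mulrDl; apply: lerD.
    rewrite (le_trans (H _ _ zd wd))// expr2 mulrA ler_wpM2r ?normc_ge0// ler_wpM2l//.
    rewrite (le_trans (ler_normc_trans z0 _ _))// (normc_distC z0); lra.
  by rewrite normcM ler_wpM2r ?normc_ge0// HM.
Qed.

Lemma cderivM f g f' g' z0 : cderiv f f' z0 -> cderiv g g' z0 ->
  cderiv (fun z => f z * g z) (fun z => f' z * g z + f z * g' z) z0.
Proof.
move=> df dg.
have [d1 [F [d10 F0 HF]]] := ccont_bounded (cderiv_ccont df).
have [d2 [G [d20 G0 HG]]] := ccont_bounded (cderiv_ccont dg).
have [d3 [F' [d30 F'0 HF']]] := ccont_bounded (cderiv_ccont_deriv df).
have [d4 [L [d40 L0 HL]]] := cderiv_lipschitz dg.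
move: df dg => [d5 [C [d50 C0 H]]] [d6 [C' [d60 C'0 H']]].
exists (Num.min (Num.min (Num.min d1 d2) (Num.min d3 d4)) (Num.min d5 d6)), (C * G + F' * L + F * C').
split; first by rewrite !lt_min d10 d20 d30 d40 d50 d60.
  by rewrite !addr_ge0// mulr_ge0.
move=> z w; rewrite !lt_min.
move=> /andP[/andP[/andP[z1 z2] /andP[z3 z4]] /andP[z5 z6]].
move=> /andP[/andP[/andP[w1 w2] /andP[w3 w4]] /andP[w5 w6]].
have -> : f w * g w - f z * g z - (f' z * g z + f z * g' z) * (w - z) =
  (f w - f z - f' z * (w - z)) * g w + f' z * (w - z) * (g w - g z)
  + f z * (g w - g z - g' z * (w - z)) by ring.
rewrite (le_trans (ler_normcD _ _))// [leRHS]mulrDl; apply: lerD; last first.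
  by rewrite normcM -mulrA ler_pM ?normc_ge0 ?HF ?H'.
rewrite (le_trans (ler_normcD _ _))// [leRHS]mulrDl; apply: lerD.
  by rewrite normcM [leRHS]mulrAC ler_pM ?normc_ge0 ?HG ?H.
rewrite !normcM expr2.
rewrite [leRHS](_ : _ = (F' * normc (w - z)) * (L * normc (w - z))); last ring.
by rewrite ler_pM ?mulr_ge0 ?normc_ge0 ?HL// ler_wpM2r ?normc_ge0 ?HF'.
Qed.

Lemma cderiv_comp_affine f f' (a b : R[i]) z0 : cderiv f f' (a + b * z0) ->
  cderiv (fun z => f (a + b * z)) (fun z => b * f' (a + b * z)) z0.
Proof.
move=> [d [C [d0 C0 H]]]; have b0 := normc_ge0 b.
exists (d / (normc b + 1)), (C * normc b ^+ 2); split.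
- by rewrite divr_gt0//; lra.
- by rewrite mulr_ge0// sqr_ge0.
move=> z w; rewrite !ltr_pdivlMr; try lra.
move=> zd wd.
have E (u v : R[i]) : (a + b * u) - (a + b * v) = b * (u - v) by ring.
have nz u : normc (u - z0) * (normc b + 1) < d -> normc (a + b * u - (a + b * z0)) < d.
  by rewrite E normcM; have := normc_ge0 (u - z0); nra.
have := H _ _ (nz _ zd) (nz _ wd); rewrite E normcM exprMn !mulrA.
by rewrite (mulrC (f' _)).
Qed.

Lemma cderiv_inv z0 : z0 != 0 -> cderiv (fun z => z^-1) (fun z => - z^-1 ^+ 2) z0.
Proof.
move=> z00; have m0 : 0 < normc z0 by rewrite normc_gt0.
set m := normc z0 in m0.
exists (m / 2), (8 / m ^+ 3); split; first lra.
  by rewrite divr_ge0// ?exprn_ge0//; lra.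
have hz z : normc (z - z0) < m / 2 -> m / 2 < normc z.
  by have := lerB_normc z0 z; rewrite normc_distC -/m; lra.
move=> z w /hz hz1 /hz hw1.
have zn : z != 0 by rewrite -normc_gt0; lra.
have wn : w != 0 by rewrite -normc_gt0; lra.
rewrite [X in normc X](_ : _ = (w - z) ^+ 2 / (z ^+ 2 * w)); last by field; rewrite zn wn.
rewrite normcM normcX mulrC ler_wpM2r ?sqr_ge0//.
rewrite normcV normcM normcX.
rewrite [leRHS](_ : _ = ((m / 2) ^+ 2 * (m / 2))^-1); last by field; lra.
rewrite lef_pV2 ?posrE ?mulr_gt0 ?exprn_gt0//; try lra.
have h2 : 0 <= m / 2 by lra.
apply: ler_pM => //; [exact: sqr_ge0| |exact: ltW].
by rewrite ler_sqr ?nnegrE ?normc_ge0// ltW.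
Qed.

End ComplexDerivative.

(** * Power series and their term-by-term derivatives *)

Section PowerSeries.
Context {R : realType}.
Implicit Types (f g : R[i] -> R[i]) (z w : R[i]).

Lemma cseries_geometric_cvg (c : nat -> R[i]) (B : R) :
  (forall n, normc (c n) <= B / 2 ^+ n) ->
  exists l : R[i], (series c : nat -> R[i]^o) @ \oo --> (l : R[i]^o).
Proof.
move=> cB.
have real_cvg (u : nat -> R) : (forall n, `|u n| <= B / 2 ^+ n) ->
    exists l : R, series u @ \oo --> l.
  move=> uB; suff : cvgn (series u) by move=> /cvg_ex[l ul]; exists l.
  apply: normed_cvg; apply: (@series_le_cvg _ _ (geometric B 2^-1)) => //.
  - by move=> n /=.
  - move=> n; rewrite /= mulr_ge0 ?exprn_ge0 ?invr_ge0//.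
    by have := le_trans (normr_ge0 _) (uB 0%N); rewrite expr0 divr1.
  - by move=> n; rewrite /= exprVn uB.
  - by apply: is_cvg_geometric_series; rewrite ger0_norm ?invr_ge0// invf_lt1 ?ltr1n.
have [a ha] := real_cvg (fun n => complex.Re (c n)) (fun n => le_trans (ler_Re_normc _) (cB n)).
have [b hb] := real_cvg (fun n => complex.Im (c n)) (fun n => le_trans (ler_Im_normc _) (cB n)).
exists (a +i* b); apply/cvgC_normcP => e e0.
have e2 : 0 < e / 2 by lra.
move/cvgrPdist_lt : ha => /(_ _ e2)[N _ HN].
move/cvgrPdist_lt : hb => /(_ _ e2)[M _ HM].
exists (maxn N M) => n; rewrite geq_max => /andP[Nn Mn].
have := HN n Nn; have := HM n Mn => /=; rewrite !(distrC _ (series _ _)) => h1 h2.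
rewrite (le_lt_trans (normc_le_ReIm _))// ReB' ImB' /=.
have sumE (s : nat -> R[i]) m : complex.Re (series s m) = series (fun k => complex.Re (s k)) m /\
    complex.Im (series s m) = series (fun k => complex.Im (s k)) m.
  elim: m => [|m [IH1 IH2]]; first by rewrite /series/= !big_nil.
  by rewrite /series/= in IH1 IH2 *; rewrite !big_nat_recr//= ReD' ImD' IH1 IH2.
by rewrite (sumE c n).1 (sumE c n).2; lra.
Qed.

Lemma normc_nat n : normc (n%:R : R[i]) = n%:R.
Proof. by rewrite -(rmorph_nat (real_complex R)) normc_real ger0_norm. Qed.

(** The remainder for [n.+1] is [w] times the remainder for [n] plus
    [n * z ^ (n - 1) * (w - z) ^ 2], and [n ^ 2 + n <= (n + 1) ^ 2]. The natural bound has
    [s ^ (n - 2)]; moving [s ^+ 2] to the left keeps small [n] and [s = 0] inside the same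
    statement. *)
Lemma expr_second_order z w (s : R) n : normc z <= s -> normc w <= s -> 
  normc (w ^+ n - z ^+ n - n%:R * z ^+ n.-1 * (w - z)) * s ^+ 2 <=
  (n ^ 2)%:R * s ^+ n * normc (w - z) ^+ 2.
Proof.
move=> zs ws; have s0 : 0 <= s := le_trans (normc_ge0 _) zs.
elim: n => [|n IH].
  by rewrite !expr0 mul0r subrr mul0r subr0 normc0 mul0r mulr_ge0 ?sqr_ge0// expr0 mulr1.
have -> : w ^+ n.+1 - z ^+ n.+1 - n.+1%:R * z ^+ n.+1.-1 * (w - z) =
  w * (w ^+ n - z ^+ n - n%:R * z ^+ n.-1 * (w - z)) +
  n%:R * z ^+ n.-1 * (w - z) ^+ 2.
  case: n {IH} => [|n]; first by rewrite !expr1 !expr0 /=; ring.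
  by rewrite /= !exprS -[n.+2]addn1 natrD; ring.
have h2 : normc (n%:R * z ^+ n.-1 * (w - z) ^+ 2) * s ^+ 2 <= n%:R * s ^+ n.+1 * normc (w - z) ^+ 2.
  case: n {IH} => [|n]; first by rewrite !mul0r normc0 mul0r.
  rewrite !normcM !normcX normc_nat [n.+1.-1]/= [s ^+ n.+2]exprS [s ^+ n.+1]exprS.
  rewrite [leLHS](_ : _ = (n.+1%:R * (s * (s * normc (w - z) ^+ 2))) * normc z ^+ n); last first.
    by rewrite expr2; ring.
  rewrite [leRHS](_ : _ = (n.+1%:R * (s * (s * normc (w - z) ^+ 2))) * s ^+ n); last by ring.
  apply: ler_wpM2l; first by rewrite !mulr_ge0 ?exprn_ge0 ?normc_ge0.
  by rewrite lerXn2r ?nnegrE ?normc_ge0.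
rewrite (le_trans (ler_wpM2r (sqr_ge0 _) (ler_normcD _ _)))// mulrDl.
apply: (@le_trans _ _ ((n ^ 2)%:R * s ^+ n.+1 * normc (w - z) ^+ 2 + n%:R * s ^+ n.+1 * normc (w - z) ^+ 2)).
  rewrite lerD//.
  rewrite normcM -[leLHS]mulrA.
  rewrite [leRHS](_ : _ = s * ((n ^ 2)%:R * s ^+ n * normc (w - z) ^+ 2)); last first.
    by rewrite [s ^+ n.+1]exprS; ring.
  by apply: ler_pM; rewrite // ?mulr_ge0 ?normc_ge0 ?exprn_ge0.
rewrite -!mulrDl -natrD ler_wpM2r ?sqr_ge0// ler_wpM2r ?exprn_ge0// ler_nat.
rewrite -[in leqRHS]addn1 sqrnD muln1 mul2n -addnn -addnA leq_add2l.
exact: leq_trans (leq_addr _ _) (leq_addl _ _).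
Qed.

Lemma normc_sum_le (c : nat -> R[i]) (b : nat -> R) n :
  (forall k, normc (c k) <= b k) ->
  normc (\sum_(0 <= k < n) c k) <= \sum_(0 <= k < n) b k.
Proof.
move=> cb; elim: n => [|n IH]; first by rewrite !big_nil normc0.
by rewrite !big_nat_recr//= (le_trans (ler_normcD _ _))// lerD.
Qed.

Lemma sum_geometric_half_le n : \sum_(0 <= k < n) (2 ^+ k)^-1 <= 2 :> R.
Proof.
suff -> : \sum_(0 <= k < n) (2 ^+ k)^-1 = 2 - 2 / 2 ^+ n :> R.
  by rewrite gerBl divr_ge0// exprn_ge0.
elim: n => [|n IH]; first by rewrite big_nil expr0 divr1 subrr.
rewrite big_nat_recr//= IH exprS; have : 2 ^+ n != 0 :> R by rewrite expf_neq0.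
by move=> h; field.
Qed.

Lemma natr_leX2 n : n%:R <= 2 ^+ n :> R.
Proof. by rewrite -natrX ler_nat ltnW// ltn_expl. Qed.

Definition ccvg (u : nat -> R[i]) (l : R[i]) := forall e : R, 0 < e ->
  exists N : nat, forall n, (N <= n)%N -> normc (u n - l) < e.

Lemma ccvgB (u v : nat -> R[i]) (l m : R[i]) : ccvg u l -> ccvg v m ->
  ccvg (fun n => u n - v n) (l - m).
Proof.
move=> ul vm e e0; have e2 : 0 < e / 2 by lra.
have [N HN] := ul _ e2; have [M HM] := vm _ e2.
exists (maxn N M) => n; rewrite geq_max => /andP[/HN h1 /HM h2].
rewrite [X in normc X](_ : _ = (u n - l) - (v n - m)); last by ring.
by rewrite (le_lt_trans (ler_normcB _ _))//; lra.
Qed.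

Lemma ccvgMr (u : nat -> R[i]) (l c : R[i]) : ccvg u l -> ccvg (fun n => u n * c) (l * c).
Proof.
move=> ul e e0; have c0 := normc_ge0 c.
have e2 : 0 < e / (normc c + 1) by rewrite divr_gt0//; lra.
have [N HN] := ul _ e2; exists N => n /HN.
rewrite ltr_pdivlMr; last lra.
by rewrite -mulrBl normcM; have := normc_ge0 (u n - l); nra.
Qed.

Lemma normc_limit_le (u : nat -> R[i]) (l : R[i]) (B : R) : ccvg u l ->
  (forall n, normc (u n) <= B) -> normc l <= B.
Proof.
move=> ul uB; apply/ler_addgt0Pr => e e0.
have [N /(_ N (leqnn _)) h] := ul e e0.
have := lerB_normc l (u N); rewrite normc_distC; have := uB N; lra.
Qed.

(** Convergence at one point of modulus [p] bounds [normc (a n) * p ^+ n]. On a much smaller disc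
    this decay dominates the factors [n ^ 2] of [expr_second_order], so the second-order errors of
    the monomials can be summed; the derivative is the formally differentiated series. *)
Lemma power_series_cderiv f z0 (r : R) (a : nat -> R[i]) : 0 < r ->
  (forall z, normc (z - z0) < r ->
    series (fun n => (a n * (z - z0) ^+ n : R[i]^o)) @ \oo --> (f z : R[i]^o)) ->
  exists f', cderiv f f' z0.
Proof.
move=> r0 fE; pose p := r / 2; have p0 : 0 < p by rewrite /p; lra.
have [K K0 aK] : exists2 K : R, 0 <= K & forall n, normc (a n) * p ^+ n <= K.
  have pr : normc (z0 + p%:C - z0) < r by rewrite addrC addKr normc_real gtr0_norm// /p; lra.
  have /cvgC_normcP/(_ _ ltr01)[N HN] := fE _ pr.
  pose t n := a n * (z0 + p%:C - z0) ^+ n.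
  have tE n : normc (a n) * p ^+ n = normc (t n).
    by rewrite normcM normcX addrC addKr normc_real gtr0_norm.
  (* From [N] on a term is the difference of two partial sums, each within 1 of the limit; an
     earlier term is bounded by the finite sum. *)
  exists (2 + \sum_(0 <= k < N) normc (t k)).
    by rewrite addr_ge0// sumr_ge0// => k _; exact: normc_ge0.
  move=> n; rewrite tE; have [Nn|nN] := leqP N n; last first.
    rewrite big_mkord (bigD1 (Ordinal nN))//= addrCA lerDl addr_ge0// sumr_ge0// => k _.
    exact: normc_ge0.
  have := HN n Nn; have := HN n.+1 (leqW Nn); rewrite /series/= big_nat_recr//=.
  rewrite -/(t n) => h1 h2.
  have s0 : 0 <= \sum_(0 <= k < N) normc (t k) by rewrite sumr_ge0// => k _; exact: normc_ge0.
  move: h1 h2; set S := \sum_(_ <= _ < _) _ => h1 h2.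
  have := ler_normcB (S + t n - f z0) (S - f z0).
  have := ler_normcB (S + t n - f (z0 + p%:C)) (S - f (z0 + p%:C)).
  by rewrite (_ : S + t n - _ - _ = t n); [lra|ring].
(* Of the decay [8 ^ n = 4 ^ n * 2 ^ n], the factor [4 ^ n] absorbs [n ^ 2] and [2 ^ n] remains for
   a geometric sum. *)
pose s := p / 8; have s0 : 0 < s by rewrite /s; lra.
have as_ n : normc (a n) * s ^+ n <= K / 8 ^+ n.
  by rewrite /s expr_div_n mulrA ler_wpM2r// invr_ge0 exprn_ge0.
have Dcvg w : exists l, normc w <= s ->
    series (fun n => (n%:R * a n * w ^+ n.-1 : R[i]^o)) @ \oo --> (l : R[i]^o).
  have [ws|] := boolP (normc w <= s); last by exists 0.
  have [|l hl] := @cseries_geometric_cvg (fun n => n%:R * a n * w ^+ n.-1) (K / s); last by exists l.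
  case=> [|n]; first by rewrite !mul0r normc0 expr0 divr1 divr_ge0// ltW.
  rewrite /= !normcM normc_nat normcX.
  apply: (@le_trans _ _ (n.+1%:R * (normc (a n.+1) * s ^+ n))).
    rewrite -mulrA; apply: ler_wpM2l => //; apply: ler_wpM2l; first exact: normc_ge0.
    by rewrite lerXn2r ?nnegrE ?normc_ge0// ltW.
  have -> : normc (a n.+1) * s ^+ n = normc (a n.+1) * s ^+ n.+1 / s.
    by rewrite exprS; field; lra.
  apply: (@le_trans _ _ (2 ^+ n.+1 * (K / 8 ^+ n.+1 / s))).
    apply: ler_pM => //.
    - by rewrite divr_ge0 ?mulr_ge0 ?normc_ge0 ?exprn_ge0 ?ltW.
    - exact: natr_leX2.
    - by rewrite ler_wpM2r ?as_// invr_ge0 ltW.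
  have -> : (8 : R) = 2 * 4 by ring.
  rewrite exprMn.
  have -> : 2 ^+ n.+1 * (K / (2 ^+ n.+1 * 4 ^+ n.+1) / s) = K / s / 4 ^+ n.+1.
    by field; rewrite ?expf_neq0//; lra.
  apply: ler_wpM2l; first by rewrite divr_ge0 ?(ltW s0).
  rewrite lef_pV2 ?posrE ?exprn_gt0//.
  by rewrite lerXn2r ?nnegrE//; lra.
pose D w := sval (cid (Dcvg w)).
have DE w : normc w <= s ->
    series (fun n => (n%:R * a n * w ^+ n.-1 : R[i]^o)) @ \oo --> (D w : R[i]^o).
  exact: (svalP (cid (Dcvg w))).
exists (fun z => D (z - z0)), s, (2 * K / s ^+ 2); split => //.
  by rewrite divr_ge0 ?sqr_ge0// mulr_ge0.
move=> z w zs ws.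
have sr : s < r by rewrite /s /p; lra.
have cw := fE _ (lt_trans ws sr); have cz := fE _ (lt_trans zs sr).
have cD := DE _ (ltW zs).
move/cvgC_normcP : cw => cw; move/cvgC_normcP : cz => cz; move/cvgC_normcP : cD => cD.
have clim := ccvgB (ccvgB cw cz) (@ccvgMr _ _ (w - z) cD).
apply: (normc_limit_le clim) => n.
rewrite /series /= -!sumrB mulr_suml -sumrB.
apply: le_trans (_ : \sum_(0 <= k < n) (K / s ^+ 2 * normc (w - z) ^+ 2) * (2 ^+ k)^-1 <= _).
  apply: normc_sum_le => k.
  have -> : a k * (w - z0) ^+ k - a k * (z - z0) ^+ k - k%:R * a k * (z - z0) ^+ k.-1 * (w - z)
   = a k * ((w - z0) ^+ k - (z - z0) ^+ k - k%:R * (z - z0) ^+ k.-1 * ((w - z0) - (z - z0))) by ring.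
  rewrite normcM.
  have := expr_second_order k (ltW zs) (ltW ws).
  have -> : w - z0 - (z - z0) = w - z by ring.
  rewrite -ler_pdivlMr ?exprn_gt0// => h.
  rewrite (le_trans (ler_wpM2l (normc_ge0 _) h))//.
  have -> : normc (a k) * ((k ^ 2)%:R * s ^+ k * normc (w - z) ^+ 2 / s ^+ 2) =
     (normc (a k) * s ^+ k * (k ^ 2)%:R) * (normc (w - z) ^+ 2 / s ^+ 2) by ring.
  have -> : K / s ^+ 2 * normc (w - z) ^+ 2 / 2 ^+ k = K / 2 ^+ k * (normc (w - z) ^+ 2 / s ^+ 2) by ring.
  rewrite ler_wpM2r ?divr_ge0 ?sqr_ge0//.
  have -> : K / 2 ^+ k = K / 8 ^+ k * 4 ^+ k.
    have -> : (8 : R) = 2 * 4 by ring.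
    by rewrite exprMn; field; rewrite !expf_neq0.
  apply: ler_pM => //; first by rewrite mulr_ge0 ?normc_ge0 ?exprn_ge0 ?ltW.
  have -> : (4 : R) = 2 ^+ 2 by ring.
  by rewrite -exprM mulnC exprM natrX lerXn2r ?nnegrE ?exprn_ge0 ?natr_leX2.
rewrite -mulr_sumr.
rewrite [leRHS](_ : _ = K / s ^+ 2 * normc (w - z) ^+ 2 * 2); last by ring.
apply: ler_wpM2l (sum_geometric_half_le _).
by apply: mulr_ge0; [apply: divr_ge0 => //|]; exact: sqr_ge0.
Qed.

(** Comparing the two estimates along a small real increment [h] gives
    [normc (f1 z - f2 z) <= (C1 + C2) * h]. Both estimates hold around [z0], hence so does the
    equality, which is what allows local derivatives to be glued. *)
Lemma cderiv_unique f f1 f2 z0 : cderiv f f1 z0 -> cderiv f f2 z0 ->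
  exists2 d : R, 0 < d & forall z, normc (z - z0) < d -> f1 z = f2 z.
Proof.
move=> [d1 [C1 [d10 C10 H1]]] [d2 [C2 [d20 C20 H2]]].
exists (Num.min d1 d2); first by rewrite lt_min d10.
move=> z; rewrite lt_min => /andP[z1 z2].
apply/eqP; rewrite -subr_eq0 -normc_eq0 eq_le normc_ge0 andbT.
apply/ler_addgt0Pr => e e0; rewrite add0r.
pose h := Num.min (Num.min ((d1 - normc (z - z0)) / 2) ((d2 - normc (z - z0)) / 2)) (e / (C1 + C2 + 1)).
have h0 : 0 < h by rewrite !lt_min !divr_gt0//; lra.
have [h1 [h2 h3]] : h <= (d1 - normc (z - z0)) / 2 /\ h <= (d2 - normc (z - z0)) / 2 /\ h <= e / (C1 + C2 + 1).
  by rewrite /h !ge_min !lexx !orbT.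
have hE : normc (z + h%:C - z) = h by rewrite addrC addKr normc_real gtr0_norm.
have zh := ler_normc_trans z (z + h%:C) z0.
have zh1 : normc (z + h%:C - z0) < d1 by lra.
have zh2 : normc (z + h%:C - z0) < d2 by lra.
have := H1 _ _ z1 zh1; have := H2 _ _ z2 zh2; rewrite hE => b2 b1.
have : normc ((f1 z - f2 z) * (z + h%:C - z)) <= (C1 + C2) * h ^+ 2.
  rewrite [X in normc X](_ : _ = (f (z + h%:C) - f z - f2 z * (z + h%:C - z))
    - (f (z + h%:C) - f z - f1 z * (z + h%:C - z))); last ring.
  by rewrite (le_trans (ler_normcB _ _))// mulrDl; lra.
rewrite normcM hE expr2 mulrA ler_pM2r// => /le_trans; apply.
move: h3; rewrite ler_pdivlMr; last lra.
nra.
Qed.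

(** Each centre [z0] brings its own derivative [F z0]. By uniqueness the diagonal [F z z] coincides
    with [F z0] near [z0], so it is one derivative valid on the whole disc. *)
Lemma analytic_cderiv f : analytic_on_disc f ->
  exists f', forall z, normc z < 1 -> cderiv f f' z.
Proof.
move=> af; have loc z0 : exists f', normc z0 < 1 -> cderiv f f' z0.
  have [z1|] := boolP (normc z0 < 1); last by exists f.
  have [r [r0 [a Ha]]] := af _ z1.
  have [||f' hf'] := @power_series_cderiv f z0 (Num.min r (1 - normc z0)) a.
  - by rewrite lt_min r0 subr_gt0.
  - move=> z; rewrite lt_min => /andP[zr zd]; apply: Ha => //.
    by rewrite /udisc/=; have := lerB_normc z z0; lra.
  - by exists f'.
pose F z0 := sval (cid (loc z0)).
have FP z0 : normc z0 < 1 -> cderiv f (F z0) z0 by exact: (svalP (cid (loc z0))).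
exists (fun z => F z z) => z0 z01.
move: (FP _ z01) => [d [C [d0 C0 H]]].
exists (Num.min d (1 - normc z0)), C; split => //; first by rewrite lt_min d0 subr_gt0.
move=> z w; rewrite !lt_min => /andP[zd z1] /andP[wd w1].
suff -> : F z z = F z0 z by exact: H.
have zin : normc z < 1 by have := lerB_normc z z0; lra.
have loc2 : cderiv f (F z0) z.
  exists (d - normc (z - z0)), C; split => //; first by rewrite subr_gt0.
  by move=> u v ud vd; apply: H; [have := ler_normc_trans z u z0|have := ler_normc_trans z v z0]; lra.
have [e e0 he] := cderiv_unique (FP _ zin) loc2.
by apply: he; rewrite subrr normc0.
Qed.

End PowerSeries.

(** * Integrals along a segment *)

Section LineIntegral.
Context {R : realType}.
Implicit Types (f g h p P : R[i] -> R[i]) (z w : R[i]).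
Local Notation mu := (@lebesgue_measure R).

(** The parameter of an edge is real but is embedded in [R[i]], so that integrands are complex
    functions to which the closure properties of [ccont] apply. *)
Definition edge_cont g := forall y : R, -1 <= y <= 1 -> ccont g y%:C.

Definition cint g : R[i] := cintegral mu `[-1, 1] (fun y => g y%:C).

Let itvE (y : R) : (y \in `[-1, 1]) = (-1 <= y <= 1). Proof. by rewrite in_itv. Qed.

(** [F] stands for the real part, the imaginary part or the modulus, all of them 1-Lipschitz, so the
    three cases share one proof here and in the lemmas that follow. *)
Lemma ccont_continuous_comp (F : R[i] -> R) g (y : R) :
  (forall z w, `|F z - F w| <= normc (z - w)) ->
  ccont g y%:C -> {for y, continuous (fun t : R => F (g t%:C))}.
Proof.
move=> FL gy; apply/cvgrPdist_lt => e e0; have [d d0 H] := gy _ e0.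
exists d => //= t yt; rewrite distrC (le_lt_trans (FL _ _))//; apply: H.
by rewrite -rmorphB normc_real distrC.
Qed.

Lemma edge_cont_integrable (F : R[i] -> R) g :
  (forall z w, `|F z - F w| <= normc (z - w)) -> edge_cont g ->
  mu.-integrable `[-1, 1] (EFin \o (fun y => F (g y%:C))).
Proof.
move=> FL gc; apply: continuous_compact_integrable; first exact: segment_compact.
apply: continuous_in_subspaceT => y; rewrite inE/= itvE => y1.
exact: (ccont_continuous_comp FL (gc _ y1)).
Qed.

Lemma Re_lipschitz z w : `|complex.Re z - complex.Re w| <= normc (z - w).
Proof. by rewrite -ReB' ler_Re_normc. Qed.
Lemma Im_lipschitz z w : `|complex.Im z - complex.Im w| <= normc (z - w).
Proof. by rewrite -ImB' ler_Im_normc. Qed.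
Hint Resolve Re_lipschitz Im_lipschitz ler_dist_normc : core.

Let intRe g : edge_cont g -> mu.-integrable `[-1, 1] (EFin \o (fun y => complex.Re (g y%:C))).
Proof. by move=> gc; exact: edge_cont_integrable. Qed.
Let intIm g : edge_cont g -> mu.-integrable `[-1, 1] (EFin \o (fun y => complex.Im (g y%:C))).
Proof. by move=> gc; exact: edge_cont_integrable. Qed.

Lemma cintD g h : edge_cont g -> edge_cont h ->
  cint (fun z => g z + h z) = cint g + cint h.
Proof.
move=> gc hc; rewrite /cint /cintegral.
under eq_Rintegral do rewrite ReD'.
under [X in _ +i* X]eq_Rintegral do rewrite ImD'.
by rewrite !RintegralD//; do ?[exact: intIm|exact: intRe].
Qed.

Lemma cintM (c : R[i]) g : edge_cont g -> cint (fun z => c * g z) = c * cint g.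
Proof.
move=> gc; rewrite /cint /cintegral.
have iR (r : R) : mu.-integrable `[-1, 1] (EFin \o (fun y => r * complex.Re (g y%:C))).
  exact: (integrableZl _ _ (intRe gc)).
have iI (r : R) : mu.-integrable `[-1, 1] (EFin \o (fun y => r * complex.Im (g y%:C))).
  exact: (integrableZl _ _ (intIm gc)).
under eq_Rintegral do rewrite ReM'.
under [X in _ +i* X]eq_Rintegral do rewrite ImM'.
rewrite RintegralB ?RintegralD//.
rewrite !RintegralZl//; do ?[exact: intIm|exact: intRe].
by case: c {iR iI} => a b; apply/eqP; rewrite eq_complex/= !eqxx.
Qed.

Lemma edge_cont_cst c : edge_cont (fun=> c).
Proof. by move=> y _; exact: ccont_cst. Qed.

Lemma eq_cint g h : (forall y : R, -1 <= y <= 1 -> g y%:C = h y%:C) -> cint g = cint h.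
Proof.
by move=> gh; rewrite /cint /cintegral; congr (_ +i* _); apply: eq_Rintegral => y;
  rewrite inE/= itvE => /gh ->.
Qed.

Lemma normc_cint_le g : edge_cont g ->
  normc (cint g) <= 2 * \int[mu]_(y in `[-1, 1]) normc (g y%:C).
Proof.
move=> gc; rewrite (le_trans (normc_le_ReIm _))// mulr2n mulrDl mul1r.
have iN : mu.-integrable `[-1, 1] (EFin \o (fun y => normc (g y%:C))).
  exact: (edge_cont_integrable (@ler_dist_normc R) gc).
apply: lerD; rewrite /= (le_trans (le_normr_Rintegral _ _))//.
- exact: intRe.
- by apply: le_Rintegral => //; [exact: (integrable_norm (intRe gc))|move=> y _; exact: ler_Re_normc].
- exact: intIm.
- by apply: le_Rintegral => //; [exact: (integrable_norm (intIm gc))|move=> y _; exact: ler_Im_normc].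
Qed.

Lemma normc_cint_le_bound g (M : R) : edge_cont g ->
  (forall y : R, -1 <= y <= 1 -> normc (g y%:C) <= M) -> normc (cint g) <= 4 * M.
Proof.
move=> gc gM; rewrite (le_trans (normc_cint_le gc))//.
rewrite [leRHS](_ : _ = 2 * (M * 2)); last by ring.
rewrite ler_pM2l//.
apply: (@le_trans _ _ (\int[mu]_(y in `[-1, 1]) M)).
  apply: le_Rintegral => //.
  - exact: (edge_cont_integrable (@ler_dist_normc R) gc).
  - apply: (@edge_cont_integrable (fun=> M) (fun=> 0)).
      by move=> z w; rewrite subrr normr0 normc_ge0.
    exact: edge_cont_cst.
rewrite Rintegral_cst//= lebesgue_measure_itv/= lte_fin ifT; last by lra.
by rewrite -EFinD/= opprK.
Qed.

Lemma is_derive_second_order (F : R -> R) (l y0 d C : R) : 0 < d -> 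
  (forall t, `|t| < d -> `|F (y0 + t) - F y0 - l * t| <= C * t ^+ 2) ->
  is_derive y0 1 F l.
Proof.
move=> d0 H.
have C0 : 0 <= C.
  have := H (d / 2); rewrite gtr0_norm; last lra.
  move=> /(_ ltac:(lra)) h; have := le_trans (normr_ge0 _) h.
  by rewrite pmulr_lge0// exprn_gt0; lra.
suff h : h^-1 *: (F (h *: 1 + y0) - F y0) @[h --> 0^'] --> l.
  by apply: DeriveDef; [apply/cvg_ex; exists l|apply/cvg_lim => //].
apply/cvgrPdist_lt => e e0.
have r0 : 0 < Num.min d (e / (C + 1)) by rewrite lt_min d0 divr_gt0//; lra.
exists (Num.min d (e / (C + 1))) => // t; rewrite /ball_/= sub0r normrN lt_min => /andP[td te] t0.
rewrite /GRing.scale/= mulr1 addrC.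
have tn : 0 < `|t| by rewrite normr_gt0.
rewrite -(ltr_pM2l tn) -normrM.
rewrite [X in `|X|](_ : _ = - (F (y0 + t) - F y0 - l * t)); last by rewrite [y0 + t]addrC; field.
rewrite normrN (le_lt_trans (H _ td))// -(real_normK (num_real t)) expr2 mulrA mulrC ltr_pM2l//.
by move: te; rewrite ltr_pdivlMr; [nra|lra].
Qed.

Lemma ftc_cderiv P p (c v : R[i]) :
  (forall y : R, -1 <= y <= 1 -> cderiv P p (c + v * y%:C)) ->
  cint (fun z => v * p (c + v * z)) = P (c + v) - P (c - v).
Proof.
move=> HP.
have gc : edge_cont (fun z => v * p (c + v * z)).
  move=> y y1; apply: ccontM; first exact: ccont_cst.
  apply: (@ccont_comp _ p (fun z => c + v * z)).
    by apply: ccontD; [exact: ccont_cst|apply: ccontM; [exact: ccont_cst|exact: ccont_id]].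
  exact: cderiv_ccont_deriv (HP _ y1).
(* Here [F] is the real or the imaginary part; real linearity suffices to apply the fundamental
   theorem of calculus to [F] of the primitive. *)
have key (F : R[i] -> R) : (forall z w, F (z - w) = F z - F w) ->
    (forall z, `|F z| <= normc z) -> (forall (r : R) z, F (r%:C * z) = r * F z) ->
  \int[mu]_(y in `[-1, 1]) F (v * p (c + v * y%:C)) = F (P (c + v)) - F (P (c - v)).
  move=> FB FN FZ.
  have FL z w : `|F z - F w| <= normc (z - w) by rewrite -FB.
  pose G (y : R) := F (P (c + v * y%:C)).
  have dG (y : R) : -1 <= y <= 1 -> is_derive y 1 G (F (v * p (c + v * y%:C))).
    move=> y1; have /(cderiv_comp_affine (z0 := y%:C)) := HP _ y1.
    move=> [d [C [d0 C0 H]]]; apply: (is_derive_second_order (d := d) (C := C)) => // t td.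
    have := H y%:C (y + t)%:C; rewrite subrr normc0 => /(_ d0).
    rewrite (_ : (y + t)%:C - y%:C = t%:C); last by rewrite -rmorphB/=; congr (_%:C); ring.
    rewrite normc_real real_normK ?num_real// => /(_ td) h.
    by rewrite /G [F _ * t]mulrC -FZ -!FB (le_trans (FN _))// [t%:C * _]mulrC.
  rewrite /Rintegral (@continuous_FTC2 _ _ G)//.
  - by rewrite /G -[X in F (P (c - X))](mulr1 v) -mulrN !rmorphN !rmorph1 mulr1.
  - apply: continuous_in_subspaceT => y; rewrite inE/= itvE => y1.
    exact: (ccont_continuous_comp FL (gc _ y1)).
  - have dc y : -1 <= y <= 1 -> {for y, continuous G}.
      move=> y1; apply: differentiable_continuous; apply/derivable1_diffP.
      by have [] := dG _ y1.
    split.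
    + move=> y; rewrite in_itv/= => /andP[/ltW y1 /ltW y2].
      by have [] := dG y (introT andP (conj y1 y2)).
    + by apply: cvg_at_right_filter; apply: dc; lra.
    + by apply: cvg_at_left_filter; apply: dc; lra.
  - move=> y; rewrite in_itv/= => /andP[/ltW y1 /ltW y2].
    by rewrite derive1E; have [_ ->] := dG y (introT andP (conj y1 y2)).
rewrite /cint /cintegral !key.
- by rewrite -ReB' -ImB'; case: (_ - _).
- exact: ImB'. 
- exact: ler_Im_normc.
- exact: ImMr.
- exact: ReB'.
- exact: ler_Re_normc.
- exact: ReMr.
Qed.

End LineIntegral.

(** * Contour integrals and Cauchy's formula *)

Section Contour.
Context {R : realType}.
Implicit Types (f g h p P F : R[i] -> R[i]) (z w u e : R[i]).
Local Notation mu := (@lebesgue_measure R).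

Definition dirs : seq R[i] := [:: 1; 'i; -1; - 'i].

(* The boundary of the square [-1,1]^2, as the four rotations of its right edge. *)
Definition onbd z := exists e (y : R), [/\ e \in dirs, -1 <= y <= 1 & z = e * (1 + 'i * y%:C)].

Definition bd_cont g := forall z, onbd z -> ccont g z.

(** The factor [e * 'i] is the derivative of the parametrization [e * (1 + 'i * y)] of an edge, so
    this is the contour integral in the positive direction. *)
Definition oint g : R[i] :=
  \sum_(e <- dirs) (e * 'i) * cint (fun z => g (e * (1 + 'i * z))).

Definition inbox z := `|complex.Re z| <= 1 /\ `|complex.Im z| <= 1.

Lemma normc_dir e : e \in dirs -> normc e = 1.
Proof.
by rewrite !inE => /or4P[]/eqP->; rewrite ?normcN' ?normc1 ?normc_i.
Qed.

Lemma dir_neq0 e : e \in dirs -> e != 0.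
Proof. by move=> he; rewrite -normc_gt0 normc_dir. Qed.

Lemma edge_pointE (y : R) : 1 + 'i * y%:C = 1 +i* y :> R[i].
Proof. by apply/eqP; rewrite eq_complex /=; apply/andP; split; apply/eqP; ring. Qed.

Lemma onbd_inbox z : onbd z -> inbox z.
Proof.
move=> [e [y [he y1 ->]]]; have y2 : `|y| <= 1 by rewrite ler_norml.
move: he; rewrite !inE => /or4P[]/eqP->; split; simpc; rewrite /= ?normrN ?normr1//.
Qed.

Lemma onbd_normc z : onbd z -> 1 <= normc z <= 2.
Proof.
move=> [e [y [he y1 ->]]]; have y2 : `|y| <= 1 by rewrite ler_norml.
rewrite normcM (normc_dir he) mul1r; apply/andP; split.
  by have := ler_Re_normc (1 + 'i * y%:C); rewrite (edge_pointE y) /= normr1.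
rewrite (le_trans (ler_normcD _ _))// normc1 normcM normc_i normc_real mul1r; lra.
Qed.

Lemma onbd_neq0 z : onbd z -> z != 0.
Proof. by move=> /onbd_normc/andP[h _]; rewrite -normc_gt0; lra. Qed.

Lemma onbd_neq z w : onbd z -> normc w < 1 -> z - w != 0.
Proof.
move=> /onbd_normc/andP[h _] w1; rewrite -normc_gt0.
by have := lerB_normc z w; lra.
Qed.

Lemma inbox_normc z : inbox z -> normc z <= 2.
Proof. by move=> [h1 h2]; rewrite (le_trans (normc_le_ReIm _))//; lra. Qed.

Lemma normc_inbox z : normc z <= 1 -> inbox z.
Proof. by split; [exact: le_trans (ler_Re_normc z) _|exact: le_trans (ler_Im_normc z) _]. Qed.

Lemma inbox_convex z w (t : R) : 0 <= t <= 1 -> inbox z -> inbox w -> inbox (w + t%:C * (z - w)).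
Proof.
move=> t01 [z1 z2] [w1 w2]; rewrite /inbox ReD' ImD' ReMr ImMr ReB' ImB'.
move: z1 z2 w1 w2; rewrite !ler_norml => *; split; nra.
Qed.

Lemma bd_edge_cont g e : bd_cont g -> e \in dirs -> edge_cont (fun z => g (e * (1 + 'i * z))).
Proof.
move=> gc he y y1; apply: (@ccont_comp _ g (fun z => e * (1 + 'i * z))).
  by do ?[apply: ccontM|apply: ccontD|exact: ccont_cst|exact: ccont_id].
by apply: gc; exists e, y.
Qed.

Lemma eq_oint g h : (forall z, onbd z -> g z = h z) -> oint g = oint h.
Proof.
move=> gh; rewrite /oint; apply: eq_big_seq => e he; congr (_ * _).
by apply: eq_cint => y y1; apply: gh; exists e, y.
Qed.

Lemma ointD g h : bd_cont g -> bd_cont h -> oint (fun z => g z + h z) = oint g + oint h.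
Proof.
move=> gc hc; rewrite /oint -big_split /=; apply: eq_big_seq => e he.
by rewrite -mulrDr -cintD//; exact: bd_edge_cont.
Qed.

Lemma ointM (c : R[i]) g : bd_cont g -> oint (fun z => c * g z) = c * oint g.
Proof.
move=> gc; rewrite /oint mulr_sumr; apply: eq_big_seq => e he.
by rewrite cintM 1?mulrCA//; exact: bd_edge_cont.
Qed.

Lemma bd_contM g h : bd_cont g -> bd_cont h -> bd_cont (fun z => g z * h z).
Proof. by move=> gc hc z zb; apply: ccontM; [exact: gc|exact: hc]. Qed.
Lemma bd_contD g h : bd_cont g -> bd_cont h -> bd_cont (fun z => g z + h z).
Proof. by move=> gc hc z zb; apply: ccontD; [exact: gc|exact: hc]. Qed.
Lemma bd_contN g : bd_cont g -> bd_cont (fun z => - g z).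
Proof. by move=> gc z zb; apply: ccontN; exact: gc. Qed.
Lemma bd_cont_cst c : bd_cont (fun=> c).
Proof. by move=> z _; exact: ccont_cst. Qed.
Lemma bd_cont_id : bd_cont id.
Proof. by move=> z _; exact: ccont_id. Qed.
Lemma bd_contV g : (forall z, onbd z -> g z != 0) -> bd_cont g -> bd_cont (fun z => (g z)^-1).
Proof. by move=> g0 gc z zb; apply: ccontV; [exact: g0|exact: gc]. Qed.

Lemma ointN g : bd_cont g -> oint (fun z => - g z) = - oint g.
Proof. by move=> gc; rewrite -mulN1r -ointM//; apply: eq_oint => z _; rewrite mulN1r. Qed.

Lemma ointB g h : bd_cont g -> bd_cont h -> oint (fun z => g z - h z) = oint g - oint h.
Proof. by move=> gc hc; rewrite ointD ?ointN//; exact: bd_contN. Qed.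

(** Four sides, each of length 2, with the factor 2 of the complex integral. *)
Lemma normc_oint_le g (M : R) : bd_cont g ->
  (forall z, onbd z -> normc (g z) <= M) -> normc (oint g) <= 16 * M.
Proof.
move=> gc gM.
have b e : e \in dirs -> normc (e * 'i * cint (fun z => g (e * (1 + 'i * z)))) <= 4 * M.
  move=> he; rewrite !normcM normc_i (normc_dir he) !mul1r.
  apply: normc_cint_le_bound; first exact: bd_edge_cont.
  by move=> y y1; apply: gM; exists e, y.
rewrite /oint !big_cons big_nil addr0.
have := b 1; have := b 'i; have := b (-1); have := b (- 'i).
rewrite !inE !eqxx !orbT => /(_ isT) b4 /(_ isT) b3 /(_ isT) b2 /(_ isT) b1.
have t := @ler_normcD R; rewrite (le_trans (t _ _))//.
rewrite [leRHS](_ : _ = 4 * M + (4 * M + (4 * M + 4 * M))); last by ring.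
apply: lerD; first exact: b1.
apply: (le_trans (t _ _)); apply: lerD; first exact: b2.
exact: (le_trans (t _ _) (lerD b3 b4)).
Qed.

(** Each edge contributes the difference of [P] at its two corners [e + e * 'i] and [e - e * 'i],
    and these differences telescope around the square. *)
Lemma oint_deriv P p : (forall z, onbd z -> cderiv P p z) -> oint p = 0.
Proof.
move=> HP.
have pc : bd_cont p by move=> z /HP; exact: cderiv_ccont_deriv.
have E e : e \in dirs -> e * 'i * cint (fun z => p (e * (1 + 'i * z))) =
    P (e + e * 'i) - P (e - e * 'i).
  move=> he; rewrite -cintM; last exact: bd_edge_cont.
  rewrite -(@ftc_cderiv _ P p e (e * 'i)).
    by apply: eq_cint => y _; congr (_ * p _); ring.
  move=> y y1; apply: HP; exists e, y; split => //; ring.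
rewrite /oint !big_cons big_nil addr0 !E ?inE ?eqxx ?orbT//.
have i2 : 'i * 'i = -1 :> R[i] by rewrite -expr2 sqr_i.
rewrite !mulNr !mul1r i2 !opprK.
have -> : 'i + -1 = -1 + 'i :> R[i] by ring.
have -> : 'i + 1 = 1 + 'i :> R[i] by ring.
have -> : - 'i + 1 = 1 - 'i :> R[i] by ring.
have -> : - 'i - 1 = -1 - 'i :> R[i] by ring.
by ring.
Qed.

(* The integral of A t is Lipschitz-square in t, hence constant. *)
Lemma oint_homotopy (A B : R -> R[i] -> R[i]) (d C : R) : 0 < d ->
  (forall t, 0 <= t <= 1 -> bd_cont (A t)) ->
  (forall t, 0 <= t <= 1 -> bd_cont (B t)) ->
  (forall t, 0 <= t <= 1 -> oint (B t) = 0) ->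
  (forall (t h : R), 0 <= t -> 0 <= h < d -> t + h <= 1 -> forall z, onbd z ->
    normc (A (t + h) z - A t z - h%:C * B t z) <= C * h ^+ 2) ->
  oint (A 1) = oint (A 0).
Proof.
move=> d0 cA cB B0 H.
have step (t h : R) : 0 <= t -> 0 <= h < d -> t + h <= 1 ->
    normc (oint (A (t + h)) - oint (A t)) <= 16 * C * h ^+ 2.
  move=> t0 hd th1; have /andP[h0 hd'] := hd.
  have t01 : 0 <= t <= 1 by rewrite t0/=; lra.
  have th01 : 0 <= t + h <= 1 by rewrite th1 andbT; lra.
  have cAt := cA _ t01; have cAth := cA _ th01; have cBt := cB _ t01.
  have chB : bd_cont (fun z => h%:C * B t z) by apply: bd_contM => //; exact: bd_cont_cst.
  have -> : oint (A (t + h)) - oint (A t) = oint (fun z => (A (t + h) z - A t z) - h%:C * B t z).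
    rewrite ointB//; last by apply: bd_contD => //; exact: bd_contN.
    by rewrite ointB// ointM// B0// mulr0 subr0.
  rewrite -mulrA; apply: normc_oint_le; last by move=> z zb; exact: H.
  by do ?[apply: bd_contD => //|apply: bd_contN => //].
have C0 : 0 <= C.
  pose h := Num.min (d / 2) 1; have h0 : 0 < h by rewrite lt_min ltr01 andbT; lra.
  have h1 : h <= 1 by rewrite ge_min lexx orbT.
  have hd : h < d.
    by apply: (@le_lt_trans _ _ (d / 2)); [rewrite ge_min lexx|lra].
  have := step 0 h (lexx _); rewrite (ltW h0) hd add0r => /(_ isT h1) b.
  have := le_trans (normc_ge0 _) b.
  by rewrite pmulr_lge0 ?exprn_gt0// pmulr_rge0.
apply/eqP; rewrite -subr_eq0 -normc_eq0 eq_le normc_ge0 andbT.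
apply/ler_addgt0Pr => e e0; rewrite add0r.
pose K := Num.max (d^-1) (16 * C / e).
have [n Kn] : exists n : nat, K < n%:R.
  by exists (Num.truncn K).+1; exact: truncnS_gt.
have K0 : 0 < K by rewrite lt_max invr_gt0 d0.
have n0 : 0 < n%:R :> R by apply: lt_trans Kn.
have nd : n%:R^-1 < d.
  by rewrite invf_plt// (le_lt_trans _ Kn)// le_max lexx.
have ne : 16 * C / n%:R <= e.
  rewrite ler_pdivrMr// [leRHS]mulrC -ler_pdivrMr//.
  by rewrite (le_trans _ (ltW Kn))// le_max lexx orbT.
have ind k : (k <= n)%N -> normc (oint (A (k%:R / n%:R)) - oint (A 0)) <=
    k%:R * (16 * C * (n%:R^-1) ^+ 2).
  elim: k => [|k IH] kn; first by rewrite !mul0r subrr normc0.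
  have kn' : k%:R / n%:R + n%:R^-1 <= 1 :> R.
    by rewrite -[X in _ + X]mul1r -mulrDl natr1 ler_pdivrMr// mul1r ler_nat.
  rewrite (le_trans (ler_normc_trans (oint (A (k%:R / n%:R))) _ _))//.
  rewrite -natr1 mulrDl [leRHS]mulrDl [leRHS]addrC !mul1r.
  apply: lerD; last by apply: IH; exact: ltnW.
  by apply: step => //; rewrite ?divr_ge0 ?nd ?invr_ge0 ?ler0n.
have := ind n (leqnn _); rewrite divff ?gt_eqF// => /le_trans; apply.
rewrite (_ : _ * _ = 16 * C / n%:R)//.
by field; rewrite gt_eqF.
Qed.

End Contour.

(** * Cauchy's formula on the square *)

Section Cauchy.
Context {R : realType}.
Implicit Types (f g h p P F : R[i] -> R[i]) (z w u e : R[i]).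
Local Notation mu := (@lebesgue_measure R).

(** Compactness of the square, transported from [[-1, 1]] times itself. The index [n] is an upper
    bound, or the inverse of a radius, that has to be made uniform in [z]. *)
Lemma inbox_compact (Q : nat -> R[i] -> Prop) :
  (forall z0, inbox z0 -> exists (d : R) (N : nat), 0 < d /\
     forall n z, (N <= n)%N -> normc (z - z0) < d -> Q n z) ->
  exists n, forall z, inbox z -> Q n z.
Proof.
move=> H.
have := compact_setX (@segment_compact R (-1) 1) (@segment_compact R (-1) 1).
move=> /compact_near_coveringP/(_ nat \oo (fun n xy => Q n (xy.1 +i* xy.2)) _) [|N _ HN].
  move=> [x y] [/= xI yI].
  have [|d [N [d0 HN]]] := H (x +i* y).
    by split; rewrite ler_norml; [move: xI|move: yI]; rewrite in_itv.
  have d2 : 0 < d / 2 by lra.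
  exists ([set xy : R * R | `|x - xy.1| < d / 2 /\ `|y - xy.2| < d / 2], [set n | (N <= n)%N]) => /=.
    split; last by exists N.
    exists ([set t | `|x - t| < d / 2], [set t | `|y - t| < d / 2]) => /=.
      by split; exists (d / 2).
    by move=> [s t].
  move=> [[s t] n] /= [[hs ht] Nn]; apply: HN => //.
  rewrite (le_lt_trans (normc_le_ReIm _))// ReB' ImB' /= distrC [`|t - y|]distrC; lra.
exists N => z [z1 z2]; have := HN N (leqnn N) (complex.Re z, complex.Im z) => /=.
rewrite !in_itv/= -!ler_norml z1 z2 => h.
by case: z {z1 z2} h => a b; apply.
Qed.

Lemma inbox_bounded F : (forall z, inbox z -> ccont F z) ->
  exists2 M : R, 0 < M & forall z, inbox z -> normc (F z) <= M.
Proof.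
move=> cF; have [|n Hn] := @inbox_compact (fun n z => normc (F z) <= n%:R).
  move=> z0 /cF/ccont_bounded[d [M [d0 M0 HM]]].
  exists d, (Num.truncn M).+1; split => // n z Nn /HM h.
  by rewrite (le_trans h)// (le_trans (ltW (truncnS_gt M)))// ler_nat.
exists (n%:R + 1); first by rewrite ltr_wpDl.
by move=> z /Hn; lra.
Qed.

(** Contract the contour to [w]: the function [F (w + t (z - w)) / (z - w)] joins [F w / (z - w)] at
    [t = 0] to the integrand at [t = 1]. Its derivative in [t] is [F' (w + t (z - w))], whose
    contour integral vanishes: it is constant in [z] for [t = 0], and otherwise has the primitive
    [F (w + t (z - w)) / t]. *)
Lemma cauchy_center F F' w : normc w < 1 -> (forall z, inbox z -> cderiv F F' z) ->
  oint (fun z => F z / (z - w)) = F w * oint (fun z => (z - w)^-1).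
Proof.
move=> w1 dF; have wb : inbox w by apply: normc_inbox; exact: ltW.
have zw z : onbd z -> z - w != 0 by move=> zb; exact: onbd_neq.
have zw3 z : onbd z -> normc (z - w) <= 3.
  by move=> /onbd_normc/andP[_ h]; rewrite (le_trans (ler_normcB _ _))//; lra.
pose seg (t : R) z := w + t%:C * (z - w).
have segb t z : 0 <= t <= 1 -> onbd z -> inbox (seg t z).
  by move=> t01 /onbd_inbox zb; exact: inbox_convex.
have segc t : bd_cont (seg t).
  by do ?[apply: bd_contD => //|apply: bd_contM => //|exact: bd_cont_cst|exact: bd_cont_id].
have compc (G : R[i] -> R[i]) t : (forall z, inbox z -> ccont G z) -> 0 <= t <= 1 ->
    bd_cont (fun z => G (seg t z)).
  move=> cG t01 z zb; apply: (@ccont_comp _ G (seg t)); first exact: segc.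
  by apply: cG; exact: segb.
have invc : bd_cont (fun z => (z - w)^-1).
  by apply: bd_contV => //; apply: bd_contD; [exact: bd_cont_id|exact: bd_cont_cst].
(* One integer serves as error constant and as inverse radius of validity on the whole box. *)
have [|N HN] := @inbox_compact (fun n z => forall u, normc (u - z) < n.+1%:R^-1 ->
    normc (F u - F z - F' z * (u - z)) <= n.+1%:R * normc (u - z) ^+ 2).
  move=> z0 /dF[d [C [d0 C0 H]]].
  pose K := Num.max (2 / d) C.
  exists (d / 2), (Num.truncn K); split; first lra.
  move=> n z Kn zd u uz.
  have Kn' : K <= n.+1%:R.
    by rewrite (le_trans (ltW (truncnS_gt K)))// ler_nat.
  have n2 : n.+1%:R^-1 <= d / 2.
    rewrite -[d / 2]invrK lef_pV2 ?posrE ?invr_gt0//; last by lra.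
    by rewrite invf_div (le_trans _ Kn')// le_max lexx.
  have ud : normc (u - z0) < d.
    by rewrite (le_lt_trans (ler_normc_trans z u z0))//; have := lt_le_trans uz n2; lra.
  have zd' : normc (z - z0) < d by lra.
  rewrite (le_trans (H z u zd' ud))//.
  by rewrite ler_wpM2r ?sqr_ge0// (le_trans _ Kn')// le_max lexx orbT.
have N0 : 0 < N.+1%:R :> R by [].
(* Dividing by [z - w] leaves one factor [normc (z - w) <= 3] in the error; a step below a quarter
   of the radius keeps the displacement [h * (z - w)] within it. *)
have := @oint_homotopy R (fun t z => F (seg t z) / (z - w)) (fun t z => F' (seg t z))
  (N.+1%:R^-1 / 4) (N.+1%:R * 3).
rewrite (_ : oint (fun z => F (seg 1 z) / (z - w)) = oint (fun z => F z / (z - w))); last first.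
  by apply: eq_oint => z _; rewrite /seg mul1r addrC subrK.
rewrite (_ : oint (fun z => F (seg 0 z) / (z - w)) = F w * oint (fun z => (z - w)^-1)); last first.
  by rewrite -ointM//; apply: eq_oint => z _; rewrite /seg mul0r addr0.
apply.
- by rewrite divr_gt0 ?invr_gt0.
- by move=> t t01; apply: bd_contM => //; apply: compc => // z /dF/cderiv_ccont.
- by move=> t t01; apply: compc => // z /dF/cderiv_ccont_deriv.
- move=> t t01.
  have [->|t0] := eqVneq t 0.
    have -> : oint (fun z => F' (seg 0 z)) = oint (fun z => 0 * z + F' w * 1).
      by apply: eq_oint => z _; rewrite /seg !mul0r addr0 add0r mulr1.
    apply: (@oint_deriv R (fun z => F' w * z)) => z _.
    by apply: cderivM; [exact: cderiv_cst|exact: cderiv_id].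
  suff : oint (fun z => t%:C * F' (seg t z)) = 0.
    rewrite ointM; last by apply: compc => // z /dF/cderiv_ccont_deriv.
    move/eqP; rewrite mulf_eq0 => /orP[|/eqP//].
    by rewrite -normc_eq0 normc_real normr_eq0 (negbTE t0).
  have sE z : seg t z = (w - t%:C * w) + t%:C * z by rewrite /seg; ring.
  rewrite (_ : oint _ = oint (fun z => t%:C * F' ((w - t%:C * w) + t%:C * z))); last first.
    by apply: eq_oint => z _; rewrite sE.
  apply: (@oint_deriv R (fun z => F ((w - t%:C * w) + t%:C * z))) => z zb.
  by apply: cderiv_comp_affine; rewrite -sE; apply: dF; exact: segb.
- move=> t h t0 /andP[h0 hd] th1 z zb.
  have t01 : 0 <= t <= 1 by rewrite t0/=; lra.
  have dE : seg (t + h) z - seg t z = h%:C * (z - w) by rewrite /seg rmorphD/=; ring.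
  have hN : normc (seg (t + h) z - seg t z) < N.+1%:R^-1.
    rewrite dE normcMr ger0_norm//; have z3 := zw3 _ zb.
    have q0 : 0 < N.+1%:R^-1 :> R by rewrite invr_gt0.
    by move: (N.+1%:R^-1) hd q0 => q hd q0; have := ler_wpM2l h0 z3; lra.
  have := HN _ (segb _ _ t01 zb) _ hN; rewrite dE normcMr ger0_norm// => b.
  have m0 : 0 < normc (z - w) by rewrite normc_gt0; exact: zw.
  rewrite -(ler_pM2r m0) -normcM.
  rewrite [X in normc X](_ : _ = F (seg (t + h) z) - F (seg t z) - F' (seg t z) * (h%:C * (z - w))); last first.
    by field; exact: zw.
  rewrite (le_trans b)// exprMn expr2 [in leLHS]expr2 !mulrA ler_pM2r//.
  have := zw3 _ zb; rewrite -!mulrA => z3; rewrite ler_wpM2l//.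
  by rewrite [leRHS]mulrC -!mulrA ler_wpM2l// ler_wpM2l.
Qed.

(** This is the number [2 * pi * 'i], kept in the form of the contour integral that defines it. *)
Definition winding : R[i] := oint (fun z => z^-1).

(** Move the pole along [t * w]: the derivative of the integrand in [t] is [w / (z - t * w) ^ 2],
    which has the primitive [- w / (z - t * w)] in [z]. *)
Lemma oint_winding w : normc w < 1 -> oint (fun z => (z - w)^-1) = winding.
Proof.
move=> w1; set m := 1 - normc w; have m0 : 0 < m by rewrite /m; lra.
have n0 := normc_ge0 w.
have tw (t : R) z : 0 <= t <= 1 -> onbd z -> m <= normc (z - t%:C * w).
  move=> /andP[t0 t1] /onbd_normc/andP[z1 _].
  have := lerB_normc z (t%:C * w); rewrite normcMr ger0_norm// /m.
  by have : t * normc w <= normc w; [rewrite ler_piMl|lra].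
have tw0 (t : R) z : 0 <= t <= 1 -> onbd z -> z - t%:C * w != 0.
  by move=> t01 zb; rewrite -normc_gt0; exact: lt_le_trans (tw _ _ t01 zb).
have invc (t : R) : 0 <= t <= 1 -> bd_cont (fun z => (z - t%:C * w)^-1).
  move=> t01; apply: bd_contV; first by move=> z; exact: tw0.
  by apply: bd_contD; [exact: bd_cont_id|exact: bd_cont_cst].
have := @oint_homotopy R (fun t z => (z - t%:C * w)^-1)
  (fun t z => w * ((z - t%:C * w)^-1 * (z - t%:C * w)^-1)) 1 (normc w ^+ 2 / m ^+ 3).
rewrite (_ : oint (fun z => (z - 1%:C * w)^-1) = oint (fun z => (z - w)^-1)); last first.
  by apply: eq_oint => z _; rewrite mul1r.
rewrite (_ : oint (fun z => (z - 0%:C * w)^-1) = winding); last first.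
  by apply: eq_oint => z _; rewrite mul0r subr0.
apply => //.
- move=> t t01; apply: bd_contM; first exact: bd_cont_cst.
  by apply: bd_contM; exact: invc.
- move=> t t01.
  have -> : oint (fun z => w * ((z - t%:C * w)^-1 * (z - t%:C * w)^-1)) =
      oint (fun z => 0 * (- (t%:C * w) + 1 * z)^-1 + - w * (1 * - ((- (t%:C * w) + 1 * z)^-1 ^+ 2))).
    apply: eq_oint => z _; rewrite mul0r add0r !mul1r mulrNN expr2.
    by rewrite (addrC (- _) z).
  apply: (@oint_deriv R (fun z => - w * (- (t%:C * w) + 1 * z)^-1)) => z zb.
  apply: cderivM; first exact: cderiv_cst.
  apply: (@cderiv_comp_affine _ (fun z => z^-1) (fun z => - z^-1 ^+ 2)).
  by apply: cderiv_inv; rewrite mul1r addrC; exact: tw0.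
- move=> t h t0 /andP[h0 hd] th1 z zb.
  have t01 : 0 <= t <= 1 by rewrite t0/=; lra.
  have th01 : 0 <= t + h <= 1 by rewrite th1 andbT; lra.
  have u1 := tw _ _ t01 zb; have u2 := tw _ _ th01 zb.
  have a0 := tw0 _ _ t01 zb; have b0 := tw0 _ _ th01 zb.
  rewrite [X in normc X](_ : _ = (h%:C * w) ^+ 2 /
     ((z - t%:C * w) ^+ 2 * (z - (t + h)%:C * w))); last first.
    by move: a0 b0; rewrite rmorphD/= => a0 b0; field; rewrite a0 b0.
  rewrite [normc (_ / _)]normcM normcV normcX [normc (_ ^+ 2 * _)]normcM normcX normcMr ger0_norm// exprMn.
  rewrite [leRHS](_ : _ = h ^+ 2 * normc w ^+ 2 * (m ^+ 2 * m)^-1); last first.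
    by field; rewrite gt_eqF.
  apply: ler_wpM2l; first by rewrite mulr_ge0 ?exprn_ge0.
  rewrite lef_pV2 ?posrE ?mulr_gt0 ?exprn_gt0//; try by lra.
  by apply: ler_pM; rewrite ?exprn_ge0 ?(ltW m0)// lerXn2r ?nnegrE ?normc_ge0 ?(ltW m0).
Qed.

(** The rotation [e] cancels between [dz] and [1 / z], so the four edges contribute equally. On one
    edge the real part of [1 / (1 + 'i * y)] is [1 / (1 + y ^ 2) >= 1 / 2], over a length 2. *)
Lemma winding_neq0 : winding != 0.
Proof.
have ec : edge_cont (fun z : R[i] => (1 + 'i * z)^-1).
  move=> y y1; apply: ccontV; last first.
    by do ?[apply: ccontM|apply: ccontD|exact: ccont_cst|exact: ccont_id].
  by rewrite edge_pointE eq_complex/= oner_eq0.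
have E e : e \in dirs -> e * 'i * cint (fun z => (e * (1 + 'i * z))^-1) =
    'i * cint (fun z => (1 + 'i * z)^-1).
  move=> he; rewrite mulrAC (_ : cint _ = e^-1 * cint (fun z => (1 + 'i * z)^-1)).
    by rewrite mulrA mulfV ?dir_neq0// mul1r mulrC.
  by rewrite -cintM//; apply: eq_cint => y _; rewrite invfM.
rewrite /winding /oint !big_cons big_nil !E ?inE ?eqxx ?orbT// addr0.
set c := cint _.
have cR : 1 <= complex.Re c.
  rewrite /c /cint /cintegral /=.
  apply: (@le_trans _ _ (\int[mu]_(y in `[-1, 1]) 2^-1)).
    rewrite Rintegral_cst//= lebesgue_measure_itv/= lte_fin ifT; last by lra.
    by rewrite -EFinD/= opprK; lra.
  apply: le_Rintegral => //.
  - apply: (@edge_cont_integrable _ (fun=> 2^-1) (fun=> 0)).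
      by move=> z w; rewrite subrr normr0 normc_ge0.
    exact: edge_cont_cst.
  - exact: (edge_cont_integrable (@Re_lipschitz R) ec).
  - have H (t : R) : -1 <= t <= 1 -> 2^-1 <= complex.Re ((1 + 'i * t%:C)^-1).
      move=> /andP[t1 t2]; rewrite edge_pointE /= expr1n mul1r lef_pV2 ?posrE//; nra.
    by move=> y; rewrite /= in_itv/=; exact: H.
rewrite (_ : _ + _ = 'i * (4 * c)); last by ring.
rewrite -normc_gt0 normcM normc_i mul1r.
have := ler_Re_normc (4 * c); rewrite (_ : 4 * c = 4%:C * c).
  by rewrite ReMr ger0_norm; lra.
by congr (_ * _); rewrite rmorph_nat.
Qed.

Lemma cauchy_formula F F' w : normc w < 1 -> (forall z, inbox z -> cderiv F F' z) ->
  oint (fun z => F z / (z - w)) = F w * winding.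
Proof. by move=> w1 dF; rewrite (cauchy_center w1 dF) oint_winding. Qed.

End Cauchy.

(** * Consequences of Cauchy's formula *)

Section Analyticity.
Context {R : realType}.
Implicit Types (f g F : R[i] -> R[i]) (z w : R[i]).

Lemma cderiv_rescale f f' z0 (p : R) : 0 < p ->
  (forall z, normc (z - z0) <= 2 * p -> cderiv f f' z) ->
  forall z, inbox z -> cderiv (fun z => f (z0 + p%:C * z)) (fun z => p%:C * f' (z0 + p%:C * z)) z.
Proof.
move=> p0 df z /inbox_normc zb; apply: cderiv_comp_affine; apply: df.
by rewrite addrC addKr normcMr gtr0_norm// mulrC ler_pM2r.
Qed.

(** Expand the Cauchy kernel at the centre of a square of half-side [p]. In rescaled variables the
    contour satisfies [normc u >= 1] while [normc w < 1 / 2], so the remainder of the geometric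
    expansion decays like [2 ^ (- N)]. *)
Lemma cderiv_analytic f f' : (forall z, normc z < 1 -> cderiv f f' z) -> analytic_on_disc f.
Proof.
move=> df z0 z01; rewrite /udisc/= in z01.
pose p := (1 - normc z0) / 4; have p0 : 0 < p by rewrite /p; lra.
have pC : p%:C != 0 by rewrite -normc_eq0 normc_real normr_eq0 gt_eqF.
pose F z := f (z0 + p%:C * z).
have dF : forall z, inbox z -> cderiv F (fun z => p%:C * f' (z0 + p%:C * z)) z.
  apply: cderiv_rescale => // z zz0; apply: df.
  by have := lerB_normc z z0; rewrite /p in zz0; lra.
have cF : bd_cont F by move=> z zb; exact: cderiv_ccont (dF _ (onbd_inbox zb)).
have [M M0 FM] := inbox_bounded (fun z zb => cderiv_ccont (dF z zb)).
have invc : bd_cont (fun z : R[i] => z^-1).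
  by apply: bd_contV; [exact: onbd_neq0|exact: bd_cont_id].
have powc n : bd_cont (fun z : R[i] => z^-1 ^+ n).
  elim: n => [|n IH]; first exact: bd_cont_cst.
  by under eq_fun do rewrite exprS; exact: bd_contM.
pose J : R[i] := winding; have J0 : J != 0 by exact: winding_neq0.
pose a n := J^-1 * oint (fun z => F z * z^-1 ^+ n.+1) / p%:C ^+ n.
exists (p / 2); split; first lra.
exists a => z _ zr.
pose w := (z - z0) / p%:C.
have wz : p%:C * w = z - z0 by rewrite /w mulrC divfK.
have w2 : normc w < 1 / 2.
  by rewrite /w normcM normcV normc_real gtr0_norm// ltr_pdivrMr//; lra.
have Fw : F w = f z by rewrite /F wz addrC subrK.
have w1 : normc w < 1 by lra.
have zwc : bd_cont (fun z => (z - w)^-1).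
  apply: bd_contV; first by move=> u ub; exact: onbd_neq.
  by apply: bd_contD; [exact: bd_cont_id|exact: bd_cont_cst].
(* Exact finite expansion: [1 / (u - w)] equals [1 / u] plus [w / u] times itself, iterated [N]
   times under the integral. *)
have rem N : F w * J = J * series (fun n => a n * (z - z0) ^+ n) N +
    w ^+ N * oint (fun u => F u * (u^-1 ^+ N * (u - w)^-1)).
  elim: N => [|N IH].
    rewrite /series/= big_nil mulr0 add0r expr0 mul1r -(cauchy_formula w1 dF).
    by apply: eq_oint => u _; rewrite expr0 mul1r.
  have sE : series (fun n => a n * (z - z0) ^+ n) N.+1 =
      series (fun n => a n * (z - z0) ^+ n) N + a N * (z - z0) ^+ N.
    by rewrite /series/= big_nat_recr.
  rewrite IH sE mulrDr -addrA; congr (_ + _).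
  have -> : J * (a N * (z - z0) ^+ N) = w ^+ N * oint (fun u => F u * u^-1 ^+ N.+1).
    by rewrite /a /w expr_div_n; field; rewrite J0 expf_neq0.
  rewrite exprSr -mulrA -mulrDr; congr (_ * _).
  rewrite -ointM; last by apply: bd_contM => //; exact: bd_contM.
  rewrite -ointD; [|exact: bd_contM|]; last first.
    by apply: bd_contM; [exact: bd_cont_cst|apply: bd_contM => //; exact: bd_contM].
  apply: eq_oint => u ub; have u0 := onbd_neq0 ub; have uw := onbd_neq ub w1.
  by rewrite exprS; field; rewrite u0 uw.
apply/cvgC_normcP => e e0.
have J0' : 0 < normc J by rewrite normc_gt0.
have bnd N : normc (series (fun n => a n * (z - z0) ^+ n) N - f z) <= (32 * M / normc J) * (2 ^+ N)^-1.
  rewrite -Fw normc_distC -(ler_pM2r J0') -normcM mulrBl (rem N) [J * _]mulrC addrC addKr.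
  rewrite normcM normcX.
  have b : normc (oint (fun u => F u * (u^-1 ^+ N * (u - w)^-1))) <= 16 * (M * (1 * 2)).
    apply: normc_oint_le; first by apply: bd_contM => //; exact: bd_contM.
    move=> u ub; rewrite !normcM normcX !normcV.
    have /andP[u1 _] := onbd_normc ub.
    apply: ler_pM; rewrite ?normc_ge0 ?mulr_ge0 ?exprn_ge0 ?invr_ge0 ?normc_ge0//.
      by apply: FM; exact: onbd_inbox.
    apply: ler_pM; rewrite ?exprn_ge0 ?invr_ge0 ?normc_ge0//.
      by rewrite exprn_ile1 ?invr_ge0 ?normc_ge0// invf_le1//; lra.
    rewrite -[leRHS]invrK lef_pV2 ?posrE ?invr_gt0//.
      by have := lerB_normc u w; lra.
    by rewrite normc_gt0 onbd_neq.
  rewrite [leRHS](_ : _ = (1 / 2) ^+ N * (16 * (M * (1 * 2)))); last first.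
    by rewrite expr_div_n expr1n; field; rewrite ?expf_neq0 ?gt_eqF.
  by apply: ler_pM; rewrite ?exprn_ge0 ?normc_ge0// lerXn2r ?nnegrE ?normc_ge0 ?ltW//; lra.
have K0 : 0 < 32 * M / normc J by rewrite divr_gt0// mulr_gt0.
exists (Num.truncn (32 * M / normc J / e)).+1 => n Kn; rewrite (le_lt_trans (bnd n))//.
rewrite ltr_pdivrMr ?exprn_gt0// [ltRHS]mulrC -ltr_pdivrMr//.
by rewrite (lt_le_trans (truncnS_gt _))// (le_trans _ (natr_leX2 _))// ler_nat.
Qed.

(** The 16 comes from [normc_oint_le]; the 8 bounds three factors [1 / (z - w)], each at most 2 when
    [normc w < 1 / 2]. *)
Definition cauchy_const : R := 16 * 8 / normc (winding : R[i]).

(** The second-order remainder is itself a Cauchy integral, with kernel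
    [(w' - w) ^ 2 / ((z - w) ^ 2 * (z - w'))]. This is first shown with Cauchy's integral [D] for
    the derivative, and [F' = D] follows by uniqueness. The constant depends only on the size of [F]
    on the contour, hence is uniform over a bounded family of functions. *)
Lemma cauchy_second_order F F' (M : R) : (forall z, inbox z -> cderiv F F' z) ->
  (forall z, onbd z -> normc (F z) <= M) ->
  forall w w', normc w < 1 / 2 -> normc w' < 1 / 2 ->
  normc (F w' - F w - F' w * (w' - w)) <= cauchy_const * M * normc (w' - w) ^+ 2.
Proof.
move=> dF FM.
pose J : R[i] := winding; have J0 : 0 < normc J by rewrite normc_gt0 winding_neq0.
have cF : bd_cont F by move=> z zb; exact: cderiv_ccont (dF _ (onbd_inbox zb)).
have zwc w : normc w < 1 / 2 -> bd_cont (fun z => (z - w)^-1).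
  move=> w1; apply: bd_contV; first by move=> u ub; apply: onbd_neq => //; lra.
  by apply: bd_contD; [exact: bd_cont_id|exact: bd_cont_cst].
pose D w := J^-1 * oint (fun z => F z * ((z - w)^-1 * (z - w)^-1)).
have DP w w' : normc w < 1 / 2 -> normc w' < 1 / 2 ->
  normc (F w' - F w - D w * (w' - w)) <= cauchy_const * M * normc (w' - w) ^+ 2.
  move=> w2 w'2; rewrite -(ler_pM2r J0) -normcM.
  have w1 : normc w < 1 by lra.
  have w'1 : normc w' < 1 by lra.
  have -> : (F w' - F w - D w * (w' - w)) * J =
     F w' * J - F w * J - (w' - w) * oint (fun z => F z * ((z - w)^-1 * (z - w)^-1)).
    by rewrite /D; field; rewrite winding_neq0.
  have c1 := zwc _ w2; have c2 := zwc _ w'2.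
  have c3 : bd_cont (fun z => F z * ((z - w)^-1 * (z - w)^-1)) by apply: bd_contM => //; exact: bd_contM.
  rewrite -(cauchy_formula w1 dF) -(cauchy_formula w'1 dF) -ointM// -ointB//; [|exact: bd_contM|exact: bd_contM].
  rewrite -ointB//; [|by apply: bd_contD; [exact: bd_contM|apply: bd_contN; exact: bd_contM]
    |by apply: bd_contM => //; exact: bd_cont_cst].
  rewrite [leRHS](_ : _ = 16 * (M * (2 * 2 * 2 * normc (w' - w) ^+ 2))); last first.
    by rewrite /cauchy_const; field; rewrite gt_eqF.
  have -> : oint (fun z => F z / (z - w') - F z / (z - w) - (w' - w) * (F z * ((z - w)^-1 * (z - w)^-1))) =
    oint (fun z => F z * ((z - w)^-1 * (z - w)^-1 * (z - w')^-1 * (w' - w) ^+ 2)).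
    apply: eq_oint => z zb; have z1 := onbd_neq zb w1; have z2 := onbd_neq zb w'1.
    by field; rewrite z1 z2.
  apply: normc_oint_le.
    by do ?[apply: bd_contM => //|exact: bd_cont_cst].
  move=> z zb; rewrite normcM; apply: ler_pM; rewrite ?normc_ge0//; first exact: FM.
  have iv u : normc u < 1 / 2 -> normc (z - u)^-1 <= 2.
    move=> u2; rewrite normcV -[leRHS]invrK lef_pV2 ?posrE ?invr_gt0//.
      by have := lerB_normc z u; have /andP[] := onbd_normc zb; lra.
    by rewrite normc_gt0 onbd_neq//; lra.
  rewrite [leLHS]normcM normcX ler_wpM2r ?sqr_ge0//.
  rewrite [leLHS]normcM ler_pM ?normc_ge0 ?iv//.
  by rewrite normcM ler_pM ?normc_ge0 ?iv.
move=> w w' w2 w'2.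
suff -> : F' w = D w by exact: DP.
have M0 : 0 <= M.
  apply: le_trans (normc_ge0 (F 1)) (FM _ _); exists 1, 0.
  by split; rewrite ?inE ?eqxx//; [lra|rewrite mulr0 addr0 mulr1].
have cD : cderiv F D w.
  exists (1 / 2 - normc w), (cauchy_const * M); split; first by rewrite subr_gt0.
    by rewrite mulr_ge0// divr_ge0 ?normc_ge0.
  by move=> u v uw vw; apply: DP; [have := lerB_normc u w|have := lerB_normc v w]; lra.
have cF' : cderiv F F' w by apply/dF/normc_inbox; lra.
have [d d0 H] := cderiv_unique cF' cD.
by apply: H; rewrite subrr normc0.
Qed.

Lemma cauchy_second_order_disc f f' z0 (p M : R) : 0 < p -> normc z0 + 2 * p < 1 ->
  (forall z, normc z < 1 -> cderiv f f' z) ->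
  (forall z, normc z <= normc z0 + 2 * p -> normc (f z) <= M) ->
  forall z z', normc (z - z0) < p / 2 -> normc (z' - z0) < p / 2 ->
  normc (f z' - f z - f' z * (z' - z)) <= cauchy_const * M / p ^+ 2 * normc (z' - z) ^+ 2.
Proof.
move=> p0 z0p df fM z z' zz zz'.
have pC : p%:C != 0 by rewrite -normc_eq0 normc_real normr_eq0 gt_eqF.
have dF := @cderiv_rescale f f' z0 p p0.
have /dF{}dF : forall z, normc (z - z0) <= 2 * p -> cderiv f f' z.
  by move=> u uz; apply: df; have := lerB_normc u z0; lra.
have nw u : normc (u - z0) < p / 2 -> normc ((u - z0) / p%:C) < 1 / 2.
  by move=> h; rewrite normcM normcV normc_real gtr0_norm// ltr_pdivrMr//; lra.
have := cauchy_second_order dF (M := M).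
move=> /(_ _ _ _ (nw _ zz) (nw _ zz')).
have E u : z0 + p%:C * ((u - z0) / p%:C) = u by field.
rewrite !E (_ : (z' - z0) / p%:C - (z - z0) / p%:C = (z' - z) / p%:C); last by ring.
rewrite (_ : p%:C * f' z * ((z' - z) / p%:C) = f' z * (z' - z)); last by field.
rewrite normcM normcV normc_real gtr0_norm// exprMn => h.
rewrite [leRHS](_ : _ = cauchy_const * M * (normc (z' - z) ^+ 2 * p^-1 ^+ 2)); last first.
  by field; rewrite gt_eqF.
apply: h => u ub; apply: fM; rewrite (le_trans (ler_normcD _ _))// lerD2l normcMr gtr0_norm//.
by rewrite mulrC ler_pM2r//; have /andP[] := onbd_normc ub.
Qed.

End Analyticity.

(** * Integrals of complex-valued functions *)

Section ComplexIntegral.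
Context {R : realType}.
Variable nu : {measure set (measurableTypeR R) -> \bar R}.
Variable A : set R.
Hypothesis mA : measurable (A : set (measurableTypeR R)).
Implicit Types (g h : R -> R[i]).

Definition cmeasurable g := measurable_fun (A : set (measurableTypeR R)) (fun x => complex.Re (g x)) /\
  measurable_fun (A : set (measurableTypeR R)) (fun x => complex.Im (g x)).

Definition cintegrable g := nu.-integrable A (EFin \o (fun x => complex.Re (g x))) /\
  nu.-integrable A (EFin \o (fun x => complex.Im (g x))).

Lemma bounded_cintegrable g (M : R) : (nu A < +oo)%E -> cmeasurable g ->
  (forall x, A x -> normc (g x) <= M) -> cintegrable g.
Proof.
move=> nuA [m1 m2] gM.
have bd (F : R[i] -> R) : (forall z, `|F z| <= normc z) -> [bounded F (g x) | x in A].
  move=> FN; exists M; split; first exact: num_real.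
  by move=> y My x Ax; rewrite /= (le_trans (FN _))// (le_trans (gM _ Ax))// ltW.
split; apply: measurable_bounded_integrable => //; apply: bd.
  exact: ler_Re_normc.
exact: ler_Im_normc.
Qed.

Lemma cintegrableB g h : cintegrable g -> cintegrable h -> cintegrable (fun x => g x - h x).
Proof.
move=> [g1 g2] [h1 h2]; split.
  rewrite (_ : _ \o _ = EFin \o (fun x => complex.Re (g x)) \- (EFin \o (fun x => complex.Re (h x))))%E.
    exact: integrableB.
  by apply/funext => x /=; rewrite ReB'.
rewrite (_ : _ \o _ = EFin \o (fun x => complex.Im (g x)) \- (EFin \o (fun x => complex.Im (h x))))%E.
  exact: integrableB.
by apply/funext => x /=; rewrite ImB'.
Qed.

Lemma cintegrableM (c : R[i]) g : cintegrable g -> cintegrable (fun x => c * g x).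
Proof.
move=> [g1 g2].
have Z1 r := integrableZl mA r g1; have Z2 r := integrableZl mA r g2.
split.
  have := integrableB mA (Z1 (complex.Re c)) (Z2 (complex.Im c)).
  by congr (_.-integrable _ _); apply/funext => x /=; rewrite ReM'.
have := integrableD mA (Z2 (complex.Re c)) (Z1 (complex.Im c)).
by congr (_.-integrable _ _); apply/funext => x /=; rewrite ImM'.
Qed.

Lemma cintegralB g h : cintegrable g -> cintegrable h ->
  cintegral nu A (fun x => g x - h x) = cintegral nu A g - cintegral nu A h.
Proof.
move=> [g1 g2] [h1 h2]; rewrite /cintegral.
under eq_Rintegral do rewrite ReB'.
under [X in _ +i* X]eq_Rintegral do rewrite ImB'.
by rewrite !RintegralB.
Qed.

Lemma cintegralM (c : R[i]) g : cintegrable g ->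
  cintegral nu A (fun x => c * g x) = c * cintegral nu A g.
Proof.
move=> [g1 g2]; rewrite /cintegral.
have Z1 r : nu.-integrable A (EFin \o (fun x => r * complex.Re (g x))) := integrableZl mA r g1.
have Z2 r : nu.-integrable A (EFin \o (fun x => r * complex.Im (g x))) := integrableZl mA r g2.
under eq_Rintegral do rewrite ReM'.
under [X in _ +i* X]eq_Rintegral do rewrite ImM'.
rewrite RintegralB ?RintegralD// !RintegralZl//.
by case: c => a b; apply/eqP; rewrite eq_complex/= !eqxx.
Qed.

Lemma cmeasurable_normc g : cmeasurable g ->
  measurable_fun (A : set (measurableTypeR R)) (fun x => normc (g x)).
Proof.
move=> [g1 g2].
rewrite (_ : (fun x => _) = (fun x => Num.sqrt (complex.Re (g x) ^+ 2 + complex.Im (g x) ^+ 2))).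
  apply: (measurableT_comp (continuous_measurable_fun (@sqrt_continuous R))).
  by apply: measurable_funD; apply: measurable_funX.
by apply/funext => x; case: (g x).
Qed.

Lemma cintegrable_cmeasurable g : cintegrable g -> cmeasurable g.
Proof. by move=> [/measurable_int/measurable_EFinP g1 /measurable_int/measurable_EFinP g2]. Qed.

Lemma normc_cintegral_le_ge0 g : cintegrable g ->
  (((normc (cintegral nu A g))%:E <= 2%:E * \int[nu]_(x in A) (normc (g x))%:E))%E.
Proof.
move=> [g1 g2].
have mN : measurable_fun (A : set (measurableTypeR R)) (fun x => (normc (g x))%:E).
  by apply/measurable_EFinP; apply: cmeasurable_normc; exact: cintegrable_cmeasurable.
have b (F : R[i] -> R) : (forall z, `|F z| <= normc z) -> nu.-integrable A (EFin \o (fun x => F (g x))) ->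
    (`|\int[nu]_(x in A) F (g x)|%:E <= \int[nu]_(x in A) (normc (g x))%:E)%E.
  move=> FN Fi.
  apply: (@le_trans _ _ (\int[nu]_(x in A) `|(F (g x))%:E|))%E; last first.
    apply: ge0_le_integral => //.
      by apply: measurableT_comp => //; exact: measurable_int Fi.
    by move=> x _; rewrite /= lee_fin.
  rewrite (le_trans _ (le_abse_integral _ _ _))//; last exact: measurable_int Fi.
  rewrite /Rintegral -abse_EFin fineK//; exact: integrable_fin_num.
rewrite (le_trans (_ : _ <= (`|complex.Re (cintegral nu A g)| + `|complex.Im (cintegral nu A g)|)%:E)%E)//.
  by rewrite lee_fin normc_le_ReIm.
rewrite EFinD mule_natl mule2n; apply: leeD.
  by apply: b => //; exact: ler_Re_normc.
by apply: b => //; exact: ler_Im_normc.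
Qed.

Lemma normc_cintegral_le g (M : R) : (nu A < +oo)%E -> cintegrable g ->
  (forall x, A x -> normc (g x) <= M) ->
  normc (cintegral nu A g) <= 2 * (M * fine (nu A)).
Proof.
move=> nuA gi gM; rewrite -lee_fin (le_trans (normc_cintegral_le_ge0 gi))//.
rewrite EFinM lee_pmul2l// EFinM fineK; last by rewrite ge0_fin_numE.
have mN : measurable_fun (A : set (measurableTypeR R)) (fun x => (normc (g x))%:E).
  by apply/measurable_EFinP; apply: cmeasurable_normc; exact: cintegrable_cmeasurable.
rewrite -integral_cst//; apply: ge0_le_integral => //.
  by move=> x _; rewrite lee_fin normc_ge0.
Qed.

End ComplexIntegral.

(** * Differentiation under the integral sign *)

Section AnalyticIntegral.
Context {R : realType}.

(** A bound uniform in [x] on smaller discs becomes, through [cauchy_second_order_disc], a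
    second-order error whose constant does not depend on [x]. Such an error can be integrated,
    provided the derivative is integrable in [x]. *)
Lemma analytic_cintegral (nu : {measure set (measurableTypeR R) -> \bar R}) (A : set R)
    (H : R -> R[i] -> R[i]) :
  measurable (A : set (measurableTypeR R)) -> (nu A < +oo)%E ->
  (forall x, A x -> analytic_on_disc (H x)) ->
  (forall z, normc z < 1 -> cmeasurable A (fun x => H x z)) ->
  (forall r : R, r < 1 -> exists M : R, forall x z, A x -> normc z <= r -> normc (H x z) <= M) ->
  analytic_on_disc (fun z => cintegral nu A (fun x => H x z)).
Proof.
move=> mA nuA aH mH bH.
have /choice[H' HH'] : forall x, exists h', A x -> forall z, normc z < 1 -> cderiv (H x) h' z.
  move=> x; have [Ax|nAx] := pselect (A x); last by exists (H x).
  by have [h' hh'] := analytic_cderiv (aH _ Ax); exists h'.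
have nz1 (z : R[i]) : normc z < 1 -> exists M : R, forall x, A x -> normc (H x z) <= M.
  by move=> z1; have [M HM] := bH _ z1; exists M => x Ax; exact: HM.
have intH z : normc z < 1 -> cintegrable nu A (fun x => H x z).
  by move=> z1; have [M HM] := nz1 _ z1; apply: (bounded_cintegrable mA (M := M)) => //; exact: mH.
have err z0 : normc z0 < 1 -> exists p K : R, [/\ 0 < p, 0 <= K, normc z0 + 2 * p < 1 &
    forall x, A x -> forall z z', normc (z - z0) < p / 2 -> normc (z' - z0) < p / 2 ->
      normc (H x z' - H x z - H' x z * (z' - z)) <= K * normc (z' - z) ^+ 2].
  move=> z01; pose p := (1 - normc z0) / 4; have p0 : 0 < p by rewrite /p; lra.
  have z0p : normc z0 + 2 * p < 1 by rewrite /p; lra.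
  have [M HM] := bH _ z0p; exists p, (cauchy_const * Num.max M 0 / p ^+ 2); split => //.
    rewrite divr_ge0 ?sqr_ge0// mulr_ge0 ?le_max ?lexx ?orbT//.
    by rewrite divr_ge0 ?normc_ge0.
  move=> x Ax z z' zz zz'; apply: (@cauchy_second_order_disc _ _ _ z0) => //.
    exact: HH'.
  by move=> u ur; rewrite (le_trans (HM _ _ Ax ur))// le_max lexx.
(* As a function of [x] the derivative is a pointwise limit of difference quotients with real
   increments [t n], hence measurable; it lies within [K * t 0] of the first quotient, hence is
   bounded. *)
have intH' z : normc z < 1 -> cintegrable nu A (fun x => H' x z).
  move=> z1; have [p [K [p0 K0 zp HK]]] := err _ z1.
  pose t (n : nat) : R := p / 4 / n.+1%:R.
  have t0 n : 0 < t n by rewrite divr_gt0//; lra.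
  have tp n : t n <= p / 4 by rewrite ler_pdivrMr// ler_peMr ?ler1n//; lra.
  have tz n : normc (z + (t n)%:C - z) = t n.
    by rewrite addrC addKr normc_real gtr0_norm.
  have tC n : (t n)%:C != 0 by rewrite -normc_eq0 normc_real normr_eq0 gt_eqF.
  have nz n : normc (z + (t n)%:C) < 1.
    rewrite (le_lt_trans (ler_normcD _ _))// normc_real gtr0_norm//.
    by have := tp n; lra.
  have z0z : normc (z - z) < p / 2 by rewrite subrr normc0; lra.
  have ntz n : normc (z + (t n)%:C - z) < p / 2 by rewrite tz; have := tp n; lra.
  have cvg_H' x : A x -> forall n,
      normc ((t n)^-1%:C * (H x (z + (t n)%:C) - H x z) - H' x z) <= K * t n.
    move=> Ax n; have := HK _ Ax _ _ z0z (ntz n); rewrite tz => h.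
    rewrite -(ler_pM2l (t0 n)) -[X in X * normc _](gtr0_norm (t0 n)) -normcMr.
    rewrite (_ : _ * _ = H x (z + (t n)%:C) - H x z - H' x z * (z + (t n)%:C - z)); last first.
      by rewrite fmorphV/=; field; exact: tC.
    by rewrite (le_trans h)// expr2 mulrCA.
  have mH' : cmeasurable A (fun x => H' x z).
    have mq n : cmeasurable A (fun x => (t n)^-1%:C * (H x (z + (t n)%:C) - H x z)).
      have [a1 a2] := mH _ (nz n); have [b1 b2] := mH _ z1.
      split; [under eq_fun do rewrite ReMr ReB'|under eq_fun do rewrite ImMr ImB'].
        by apply: measurable_funM => //; exact: measurable_funB.
      by apply: measurable_funM => //; exact: measurable_funB.
    have cvgF (F : R[i] -> R) : (forall u v, `|F u - F v| <= normc (u - v)) -> forall x, A x ->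
        (fun n => F ((t n)^-1%:C * (H x (z + (t n)%:C) - H x z))) @ \oo --> F (H' x z).
      move=> FL x Ax; apply/cvgrPdist_lt => e e0.
      exists (Num.truncn (K * p / e)).+1 => // n /= Kn.
      rewrite distrC (le_lt_trans (FL _ _))// (le_lt_trans (cvg_H' _ Ax n))//.
      have Kn' : K * p / e < n.+1%:R.
        by rewrite (lt_le_trans (truncnS_gt _))// ler_nat leqW.
      rewrite /t mulrA ltr_pdivrMr// mulrC -ltr_pdivrMl// mulrC.
      by rewrite (le_lt_trans _ Kn')// [leLHS]mulrC ler_pM2r ?invr_gt0// ler_wpM2l//; lra.
    split.
      apply: (measurable_fun_cvg (h := fun n x => complex.Re ((t n)^-1%:C * (H x (z + (t n)%:C) - H x z)))) => //.
        by move=> n; exact: (mq n).1.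
      by apply: cvgF => u v; rewrite -ReB' ler_Re_normc.
    apply: (measurable_fun_cvg (h := fun n x => complex.Im ((t n)^-1%:C * (H x (z + (t n)%:C) - H x z)))) => //.
      by move=> n; exact: (mq n).2.
    by apply: cvgF => u v; rewrite -ImB' ler_Im_normc.
  have [M1 HM1] := nz1 _ z1; have [M2 HM2] := nz1 _ (nz 0%N).
  apply: (bounded_cintegrable mA (M := K * t 0%N + (t 0%N)^-1 * (M2 + M1))) => //.
  move=> x Ax.
  rewrite -[H' x z](subKr ((t 0%N)^-1%:C * (H x (z + (t 0%N)%:C) - H x z))) addrC.
  rewrite (le_trans (ler_normcD _ _))// normcN'; apply: lerD; first exact: cvg_H'.
  rewrite normcMr gtr0_norm ?invr_gt0//; apply: ler_wpM2l; first by rewrite invr_ge0 ltW.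
  by rewrite (le_trans (ler_normcB _ _))// lerD ?HM1 ?HM2.
apply: (@cderiv_analytic _ _ (fun z => cintegral nu A (fun x => H' x z))) => z0 z01.
have [p [K [p0 K0 zp HK]]] := err _ z01.
exists (p / 2), (2 * (K * fine (nu A))); split; first lra.
  by rewrite !mulr_ge0// fine_ge0.
move=> z z' zz zz'.
have in1 u : normc (u - z0) < p / 2 -> normc u < 1.
  by move=> h; have := lerB_normc u z0; lra.
have i1 := intH _ (in1 _ zz'); have i2 := intH _ (in1 _ zz); have i3 := intH' _ (in1 _ zz).
have i3' := cintegrableM mA (z' - z) i3.
rewrite -(cintegralB mA i1 i2) mulrC -(cintegralM mA _ i3) -cintegralB//; last exact: cintegrableB.
rewrite [leRHS](_ : _ = 2 * (K * normc (z' - z) ^+ 2 * fine (nu A))); last by ring.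
apply: normc_cintegral_le => //; first by apply: cintegrableB => //; exact: cintegrableB.
by move=> x Ax; rewrite [_ * H' x z]mulrC; exact: HK.
Qed.

End AnalyticIntegral.

(** * Principal powers *)

Section PrincipalPower.
Context {R : realType}.
Implicit Types (z w : R[i]) (x y b : R).

Lemma normr_sin_le x : `|sin x| <= `|x|.
Proof.
wlog x0 : x / 0 <= x.
  move=> H; have [/H//|/ltW x0] := leP 0 x.
  by have := H (- x); rewrite oppr_ge0 sinN !normrN => /(_ x0).
move: x0; rewrite le_eqVlt => /predU1P[<-|x0]; first by rewrite sin0 normr0.
have cs : {within `[0, x], continuous (@sin R)}.
  by apply: continuous_subspaceT => t; exact: continuous_sin.
have [c _] := MVT x0 (fun t _ => is_derive_sin t) cs.
rewrite sin0 !subr0 => ->; rewrite normrM ler_piMl//.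
by rewrite ler_norml cos_geN1 cos_le1.
Qed.

Lemma cos_second_order x : `|cos x - 1| <= x ^+ 2.
Proof.
pose y := x / 2; have -> : x = y *+ 2 by rewrite /y -mulr_natr; field.
rewrite cos_mulr2n cos2sin2.
have := normr_sin_le y; rewrite -ler_sqr ?nnegrE// !real_normK ?num_real// => h.
have s0 := sqr_ge0 (sin y).
rewrite ler_norml; lra.
Qed.

Lemma sin_second_order x : `|x| <= 1 -> `|sin x - x| <= x ^+ 2.
Proof.
wlog x0 : x / 0 <= x.
  move=> H; have [/H//|/ltW x0] := leP 0 x.
  have := H (- x); rewrite oppr_ge0 normrN sinN sqrrN -opprD normrN => H1.
  exact: H1.
move: x0; rewrite le_eqVlt => /predU1P[<-|x0]; first by rewrite sin0 subrr normr0 expr0n.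
rewrite gtr0_norm// => x1.
have dF (t : R) : is_derive t 1 (fun t => sin t - t) (cos t - 1) by exact: is_deriveB.
have cF : {within `[0, x], continuous (fun t : R => sin t - t)}.
  apply: continuous_subspaceT => t; apply: continuousB; first exact: continuous_sin.
  exact: cvg_id.
have [c /[!in_itv]/= /andP[c0 cx]] := MVT x0 (fun t _ => dF t) cF.
rewrite sin0 !subr0 => ->; rewrite normrM [`|x|]gtr0_norm// expr2 ler_pM2r//.
have := cos_second_order c; rewrite expr2; nra.
Qed.

(** The inequality [1 + x <= expR x] at [x] gives the lower bound, and at [- x] the upper bound
    [expR x <= 1 / (1 - x)]. *)
Lemma expR_second_order x : `|x| <= 1 / 2 -> `|expR x - 1 - x| <= 2 * x ^+ 2.
Proof.
rewrite ler_norml => /andP[x1 x2].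
have h1 := expR_ge1Dx x; have h2 := expR_ge1Dx (- x).
have e0 := expR_gt0 x.
have : expR x * expR (- x) = 1 by rewrite -expRD subrr expR0.
move: (expR (- x)) h2 => u h2 eu.
have : expR x * (1 - x) <= 1 by rewrite -[leRHS]eu ler_wpM2l// ltW.
have x20 := sqr_ge0 x.
move=> h3; rewrite ler_norml; apply/andP; split; first lra.
have h4 : 1 <= (1 + x + 2 * x ^+ 2) * (1 - x).
  have -> : (1 + x + 2 * x ^+ 2) * (1 - x) = 1 + x ^+ 2 * (1 - 2 * x) by ring.
  by rewrite lerDl mulr_ge0//; lra.
suff : expR x <= 1 + x + 2 * x ^+ 2 by lra.
have x10 : 0 < 1 - x by lra.
by rewrite -(ler_pM2r x10); lra.
Qed.

Lemma cexpD z w : cexp (z + w) = cexp z * cexp w.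
Proof.
rewrite /cexp ReD' ImD' expRD cosD sinD rmorphM/=.
rewrite [RHS]mulrACA; congr (_ * _).
by apply/eqP; rewrite eq_complex/=; apply/andP; split; apply/eqP; ring.
Qed.

Lemma normc_cexp z : normc (cexp z) = expR (complex.Re z).
Proof.
by rewrite /cexp normcMr gtr0_norm ?expR_gt0//= cos2Dsin2 sqrtr1 mulr1.
Qed.

Lemma cexp_neq0 z : cexp z != 0.
Proof. by rewrite -normc_gt0 normc_cexp expR_gt0. Qed.

Lemma cexp_second_order z : normc z <= 1 / 2 -> normc (cexp z - 1 - z) <= 5 * normc z ^+ 2.
Proof.
move=> z2; have xz := ler_Re_normc z; have yz := ler_Im_normc z.
rewrite normc_sqr; move: z z2 xz yz => [x y]; rewrite [complex.Re _]/= [complex.Im _]/= => z2 xz yz.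
have x2 : `|x| <= 1 / 2 by exact: le_trans xz z2.
have y1 : `|y| <= 1 by have := le_trans yz z2; lra.
have h1 := expR_second_order x2; have h2 := cos_second_order y.
have h3 := sin_second_order y1; have h4 := normr_sin_le y.
rewrite (le_trans (normc_le_ReIm _))//.
have c1 : `|cos y| <= 1 by rewrite ler_norml cos_geN1 cos_le1.
have s1 : `|sin y| <= 1 by rewrite ler_norml sin_geN1 sin_le1.
have x1 : `|1 + x| <= 3 / 2.
  by move: x2; rewrite !ler_norml => /andP[? ?]; apply/andP; split; lra.
have hA : `|(expR x - 1 - x) * cos y| <= 2 * x ^+ 2.
  by rewrite normrM -[leRHS]mulr1 ler_pM.
have hB : `|(1 + x) * (cos y - 1)| <= 3 / 2 * y ^+ 2 by rewrite normrM ler_pM.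
have hC : `|(expR x - 1 - x) * sin y| <= 2 * x ^+ 2.
  by rewrite normrM -[leRHS]mulr1 ler_pM.
have hD : `|x * sin y| <= (x ^+ 2 + y ^+ 2) / 2.
  rewrite normrM (le_trans (ler_wpM2l (normr_ge0 _) h4))//.
  rewrite -(real_normK (num_real x)) -(real_normK (num_real y)).
  by have := sqr_ge0 (`|x| - `|y|); rewrite sqrrB; lra.
rewrite [X in `|X| + _](_ : _ = (expR x - 1 - x) * cos y + (1 + x) * (cos y - 1)); last first.
  by rewrite /=; ring.
rewrite [X in _ + `|X|](_ : _ = (expR x - 1 - x) * sin y + (x * sin y + (sin y - y))); last first.
  by rewrite /=; ring.
have t1 := ler_normD ((expR x - 1 - x) * cos y) ((1 + x) * (cos y - 1)).
have t2 := ler_normD ((expR x - 1 - x) * sin y) (x * sin y + (sin y - y)).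
have t3 := ler_normD (x * sin y) (sin y - y).
have y20 := sqr_ge0 y; have x20 := sqr_ge0 x; lra.
Qed.

Lemma cexp_clog w : w != 0 -> cexp (clog w) = w.
Proof.
move=> w0; have n0 : 0 < normc w by rewrite normc_gt0.
rewrite /cexp /clog [complex.Re _]/= [complex.Im _]/= lnK ?posrE// /carg.
have := normc_sqr w; have := ler_Re_normc w.
case: w w0 n0 => x y _; set m := normc _ => m0; rewrite [complex.Re _]/= [complex.Im _]/=.
move=> xm mE.
have q1 : -1 <= x / m <= 1.
  by rewrite -ler_norml normrM normfV (gtr0_norm m0) ler_pdivrMr// mul1r.
have sE : Num.sqrt (1 - (x / m) ^+ 2) = `|y| / m.
  rewrite (_ : 1 - _ = (y / m) ^+ 2); last first.
    rewrite !expr_div_n -[1](@divff _ (m ^+ 2)); last by rewrite expf_neq0// gt_eqF.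
    by rewrite -mulrBl mE addrC addKr.
  by rewrite sqrtr_sqr normrM normfV (gtr0_norm m0).
case: ifPn => y0.
  rewrite acosK ?in_itv// sin_acos// sE ger0_norm//.
  by apply/eqP; rewrite eq_complex/=; apply/andP; split; apply/eqP; field; rewrite gt_eqF.
rewrite cosN sinN acosK ?in_itv// sin_acos// sE ltr0_norm ?ltNge//.
by apply/eqP; rewrite eq_complex/=; apply/andP; split; apply/eqP; field; rewrite gt_eqF.
Qed.

(** The sign test in [carg], and [acos] at the endpoint 1, hide the continuity of the argument
    across the positive real axis; the [asin] form makes it visible on the right half-plane. *)
Lemma carg_asin w : 0 < complex.Re w -> carg w = asin (complex.Im w / normc w).
Proof.
move=> w0; have n0 : 0 < normc w.
  by apply: lt_le_trans (ler_Re_normc w); rewrite normr_gt0 gt_eqF.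
have w0' : w != 0 by rewrite -normc_gt0.
have := cexp_clog w0'; rewrite /cexp /clog [complex.Re (_ +i* _)]/= [complex.Im (_ +i* _)]/=.
rewrite lnK ?posrE// => /(congr1 (@complex.Im R)); rewrite ImMr [complex.Im _]/= => h.
have sE : sin (carg w) = complex.Im w / normc w by rewrite -h; field; rewrite gt_eqF.
rewrite -sE sinK// in_itv/= /carg.
have q1 : -1 <= complex.Re w / normc w <= 1.
  by rewrite -ler_norml normrM normfV (gtr0_norm n0) ler_pdivrMr// mul1r ler_Re_normc.
have q0 : 0 < complex.Re w / normc w by rewrite divr_gt0.
have a0 := acos_ge0 q1.
have a2 : acos (complex.Re w / normc w) <= pi / 2.
  rewrite leNgt; apply/negP => /ltW h2.
  have : cos (acos (complex.Re w / normc w)) <= cos (pi / 2).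
    have := @ltr_cos R; move=> lc; rewrite leNgt lc ?in_itv/=.
    - by rewrite -leNgt.
    - by rewrite a0 acos_lepi.
    - by rewrite divr_ge0 ?pi_ge0//= ler_pdivrMr// ler_peMr ?pi_ge0// ler1n.
  by rewrite acosK ?in_itv// cos_pihalf; lra.
by case: ifP => _; apply/andP; split; lra.
Qed.

Lemma normc_realB x y : normc (x%:C - y%:C) = `|x - y|.
Proof. by rewrite -rmorphB normc_real. Qed.

Lemma ccont_real_comp (F : R[i] -> R) (phi : R -> R) z0 :
  {for F z0, continuous phi} -> ccont (fun z => (F z)%:C) z0 ->
  ccont (fun z => (phi (F z))%:C) z0.
Proof.
move=> /cvgrPdist_lt cphi cF e e0; have [d d0 H] := cphi _ e0; rewrite /= in d0.
have [r r0 HF] := cF _ d0; exists r => // z /HF.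
by rewrite !normc_realB distrC => /H /=; rewrite distrC.
Qed.

Lemma ccont_clog z0 : 0 < complex.Re z0 -> ccont (@clog R) z0.
Proof.
move=> z00; have n0 : 0 < normc z0.
  by apply: lt_le_trans (ler_Re_normc z0); rewrite normr_gt0 gt_eqF.
have cn : ccont (fun z => (normc z)%:C) z0.
  move=> e e0; exists e => // z h; rewrite normc_realB.
  exact: le_lt_trans (ler_dist_normc _ _) h.
have cim : ccont (fun z => (complex.Im z)%:C) z0.
  move=> e e0; exists e => // z h; rewrite normc_realB -ImB'.
  exact: le_lt_trans (ler_Im_normc _) h.
have nC : (normc z0)%:C != 0 by rewrite -normc_eq0 normc_real normr_eq0 gt_eqF.
apply: (@ccont_eq_near _ (fun z => (ln (normc z))%:C + 'i * (asin (complex.Im z / normc z))%:C) _ _ (complex.Re z0)) => //.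
  move=> z zz0; have z1 : 0 < complex.Re z.
    have := le_lt_trans (ler_Re_normc (z - z0)) zz0.
    by rewrite ReB' ltr_norml => /andP[? ?]; lra.
  rewrite /clog carg_asin//.
  by apply/eqP; rewrite eq_complex/=; apply/andP; split; apply/eqP; ring.
apply: ccontD; first by apply: ccont_real_comp => //; exact: continuous_ln.
apply: ccontM; first exact: ccont_cst.
apply: (@ccont_real_comp (fun z => complex.Im z / normc z) asin).
  apply: continuous_asin; rewrite -ltr_norml normrM normfV (gtr0_norm n0) ltr_pdivrMr// mul1r.
  rewrite -ltr_sqr ?nnegrE ?normc_ge0// real_normK ?num_real// normc_sqr ltrDr.
  by rewrite exprn_gt0.
apply: (@ccont_eq_near _ (fun z => (complex.Im z)%:C * ((normc z)%:C)^-1) _ _ 1) => //.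
  by move=> z _; rewrite rmorphM/= fmorphV.
by apply: ccontM => //; exact: ccontV.
Qed.

Lemma normc_cpowR w b : w != 0 -> normc (cpowR w b) = normc w `^ b.
Proof.
move=> w0; rewrite /cpowR normc_cexp ReMr/= /powR normc_eq0 (negbTE w0).
by [].
Qed.

Lemma cpowR_real x b : 0 < x -> cpowR x%:C b = (x `^ b)%:C.
Proof.
move=> x0; have E : clog x%:C = (ln x)%:C.
  rewrite /clog normc_real gtr0_norm// /carg [complex.Im _]/= lexx [complex.Re _]/=.
  by rewrite normc_real gtr0_norm// divff ?gt_eqF// acos1.
rewrite /cpowR E -rmorphM/= /cexp/= cos0 sin0 /powR gt_eqF//.
by rewrite -[1 +i* 0]/(1%:C) mulr1.
Qed.

Lemma Re_oneB_gt0 z : normc z < 1 -> 0 < complex.Re (1 - z).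
Proof.
move=> z1; rewrite ReB' /=.
have := le_lt_trans (ler_Re_normc z) z1; rewrite ltr_norml => /andP[_]; lra.
Qed.

(** Continuity of the logarithm is enough to start. The increment [eta] of [clog (1 - z)] satisfies
    [cexp eta - 1 = k] with [k = - (w - z) / (1 - z)]; the expansion of [cexp] turns this into
    [eta = k] up to an error of order [normc k ^+ 2]. The power is multiplied by [cexp (- b * eta)],
    to which the same expansion applies. *)
Lemma cpowR_inv_cderiv b z0 : normc z0 < 1 ->
  cderiv (fun z => (cpowR (1 - z) b)^-1) (fun z => b%:C * (cpowR (1 - z) b)^-1 / (1 - z)) z0.
Proof.
move=> z01; pose L z := clog (1 - z).
pose E z := (cpowR (1 - z) b)^-1.
have EE z w : E w = E z * cexp (- b%:C * (L w - L z)).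
  rewrite /E /cpowR -/(L z) -/(L w); apply: (mulfI (cexp_neq0 (b%:C * L w))).
  rewrite mulfV ?cexp_neq0// mulrCA -cexpD; have -> : b%:C * L w + - b%:C * (L w - L z) = b%:C * L z by ring.
  by rewrite mulVf ?cexp_neq0.
have cL : ccont L z0.
  apply: (@ccont_comp _ (@clog R) (fun z => 1 - z)).
    by apply: ccontD; [exact: ccont_cst|apply: ccontN; exact: ccont_id].
  by apply: ccont_clog; exact: Re_oneB_gt0.
pose B := `|b|; have B0 : 0 <= B by exact: normr_ge0.
(* Increments of [L] between two nearby points are then at most [2 * q], so both [eta] and [b * eta]
   have modulus at most [1 / 10]. *)
pose q := (10 * (B + 1))^-1 / 2.
have q0 : 0 < q by rewrite divr_gt0// invr_gt0 mulr_gt0//; lra.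
have qB : q * (20 * (B + 1)) = 1 by rewrite /q; field; rewrite gt_eqF//; lra.
have [d d0 Hd] := cL _ q0.
pose m := (1 - normc z0) / 2; have m0 : 0 < m by rewrite /m; lra.
have E0 := normc_ge0 (E z0).
pose N := 3 * normc (E z0).
exists (Num.min d m), (N * (20 * B ^+ 2 + 20 * B) / m ^+ 2); split.
- by rewrite lt_min d0.
- by rewrite divr_ge0 ?sqr_ge0// mulr_ge0 ?addr_ge0 ?mulr_ge0 ?sqr_ge0.
move=> z w; rewrite !lt_min => /andP[zd zm] /andP[wd wm].
have nm u : normc (u - z0) < m -> m < normc (1 - u).
  move=> h; have := lerB_normc 1 u; have := lerB_normc u z0; rewrite normc1 /m in h *; lra.
have lt1 u : normc (u - z0) < m -> normc u < 1.
  by move=> h; have := lerB_normc u z0; rewrite /m in h; lra.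
have ne u : normc (u - z0) < m -> 1 - u != 0.
  by move=> /nm h; rewrite -normc_gt0; lra.
have small (eta : R[i]) : normc eta <= 2 * q -> normc eta <= 1 / 10 /\ normc (- b%:C * eta) <= 1 / 10.
  move=> h; have e0 := normc_ge0 eta; split; first nra.
  rewrite normcM normcN' normc_real -/B; nra.
have Ebd : normc (E z) <= N.
  have [|h1 h2] := small (L z - L z0).
    by rewrite (le_trans (ltW (Hd _ zd)))//; lra.
  rewrite (EE z0 z) normcM mulrC /N ler_wpM2r//.
  have := cexp_second_order (le_trans h2 (ltac:(lra) : 1 / 10 <= 1 / 2 :> R)).
  set u := - b%:C * _ in h2 *; have := lerB_normc (cexp u) (1 + u).
  have := ler_normcD 1 u; rewrite normc1.
  rewrite (_ : cexp u - (1 + u) = cexp u - 1 - u); last by ring.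
  have := normc_ge0 u; rewrite expr2; nra.
pose eta := L w - L z; pose k := - (w - z) / (1 - z).
have eta2 : normc eta <= 2 * q.
  have := ler_normc_trans (L z0) (L w) (L z); rewrite [normc (L z0 - _)]normc_distC.
  by have := Hd _ zd; have := Hd _ wd; rewrite -/eta; lra.
have [e1 e2] := small eta eta2.
have kE : cexp eta - 1 = k.
  have zne := ne _ zm; have wne := ne _ wm.
  have := cexp_clog wne; rewrite -/(L w) (_ : L w = L z + eta); last by rewrite /eta; ring.
  rewrite cexpD cexp_clog// => h.
  by apply: (mulfI zne); rewrite mulrBr h /k; field.
have half x : x <= 1 / 10 -> x <= 1 / 2 by lra.
have k1 : normc (k - eta) <= 5 * normc eta ^+ 2 by rewrite -kE; apply: cexp_second_order; exact: half.
(* As [normc eta <= 1 / 10], the error [5 * normc eta ^+ 2] is at most half of [normc eta] and is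
   absorbed. *)
have etak : normc eta <= 2 * normc k.
  have := lerB_normc eta k; rewrite normc_distC; have := normc_ge0 eta.
  by move: k1; rewrite expr2; nra.
have k2 : normc (k - eta) <= 20 * normc k ^+ 2.
  have := normc_ge0 eta; have := normc_ge0 k; move: k1; rewrite !expr2; nra.
have k3 : normc k <= normc (w - z) / m.
  rewrite /k normcM normcV normcN' ler_wpM2l ?normc_ge0// lef_pV2 ?posrE//.
    by rewrite ltW// nm.
  by rewrite normc_gt0 ne.
set u := - b%:C * eta in e2.
rewrite (_ : E w - E z - _ = E z * ((cexp u - 1 - u) + b%:C * (k - eta))); last first.
  rewrite (EE z w) -/eta -/u -[(cpowR (1 - z) b)^-1]/(E z).
  move: (E z) (cexp u) => ez cu; rewrite /u /k; field; exact: ne.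
have u2 := cexp_second_order (half _ e2).
have un : normc u = B * normc eta by rewrite /u normcM normcN' normc_real.
have bk : normc (b%:C * (k - eta)) <= B * (20 * normc k ^+ 2).
  by rewrite normcMr ler_wpM2l.
have ek2 : normc eta ^+ 2 <= 4 * normc k ^+ 2.
  have := normc_ge0 eta; have := normc_ge0 k; rewrite !expr2; nra.
have uu : normc ((cexp u - 1 - u) + b%:C * (k - eta)) <= (20 * B ^+ 2 + 20 * B) * normc k ^+ 2.
  rewrite (le_trans (ler_normcD _ _))// mulrDl; apply: lerD.
    rewrite (le_trans u2)// un exprMn.
    have -> : 5 * (B ^+ 2 * normc eta ^+ 2) = (5 * B ^+ 2) * normc eta ^+ 2 by ring.
    have -> : 20 * B ^+ 2 * normc k ^+ 2 = (5 * B ^+ 2) * (4 * normc k ^+ 2) by ring.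
    by apply: ler_wpM2l => //; apply: mulr_ge0 => //; exact: sqr_ge0.
  by rewrite (le_trans bk)//; lra.
rewrite normcM (le_trans (ler_pM (normc_ge0 _) (normc_ge0 _) Ebd uu))//.
have N0 : 0 <= N by rewrite /N; lra.
have B2 : 0 <= 20 * B ^+ 2 + 20 * B by rewrite addr_ge0 ?mulr_ge0 ?sqr_ge0.
rewrite [leRHS](_ : _ = N * ((20 * B ^+ 2 + 20 * B) * (normc (w - z) / m) ^+ 2)); last first.
  by field; rewrite gt_eqF.
apply: ler_wpM2l => //; apply: ler_wpM2l => //.
by rewrite lerXn2r ?nnegrE ?normc_ge0// divr_ge0 ?normc_ge0 ?ltW.
Qed.

End PrincipalPower.

(** * Integration over the plane *)

Section Plane.
Context {R : realType}.
Local Notation mR := (measurableTypeR R).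
Local Notation leb := (@lebesgue_measure R).
Implicit Types (f : R[i] -> R[i]) (z : R[i]).
Local Open Scope ereal_scope.

(** The plane carries the product sigma-algebra, generated by rectangles; an open set is the
    countable union of the boxes with rational centre and half-side [1 / (n + 1)] that it
    contains. *)
Lemma measurable_plane_open (S : set (mR * mR)) :
  (forall w, S w -> exists r : R, (0 < r)%R /\ forall v : mR * mR,
     (`|v.1 - w.1| < r -> `|v.2 - w.2| < r -> S v)%R) ->
  measurable S.
Proof.
move=> oS.
pose box (a b : rat) (n : nat) : set (mR * mR) :=
  `](ratr a - n.+1%:R^-1)%R, (ratr a + n.+1%:R^-1)%R[%classic `*`
  `](ratr b - n.+1%:R^-1)%R, (ratr b + n.+1%:R^-1)%R[%classic.
have -> : S = \bigcup_(a : rat) \bigcup_(b : rat) \bigcup_(n : nat)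
    (if pselect (box a b n `<=` S) then box a b n else set0).
  apply/seteqP; split => [[x y] Sxy|w [a _ [b _ [n _]]]]; last by case: pselect => // h; exact: h.
  have [r [r0 Hr]] := oS _ Sxy.
  have [n nr] : exists n, (n.+1%:R^-1 < r / 2)%R.
    exists (Num.truncn (2 / r)); rewrite -[(r / 2)%R]invrK ltf_pV2 ?posrE ?invr_gt0 ?divr_gt0//.
    by rewrite invf_div truncnS_gt.
  have n0 : (0 < n.+1%:R^-1 :> R)%R by [].
  have ratx (t : R) : exists a : rat, (t - n.+1%:R^-1 < ratr a < t + n.+1%:R^-1)%R.
    have [|a] := @rat_in_itvoo R (t - n.+1%:R^-1)%R (t + n.+1%:R^-1)%R.
      by rewrite ltrBlDr -addrA ltrDl addr_gt0.
    by rewrite in_itv/= => h; exists a.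
  have [a /andP[a1 a2]] := ratx x; have [b /andP[b1 b2]] := ratx y.
  exists a => //; exists b => //; exists n => //.
  rewrite /box; move: (n.+1%:R^-1)%R n0 nr a1 a2 b1 b2 => q q0 qr a1 a2 b1 b2.
  case: pselect => [h|[]].
    by split; rewrite /= in_itv/=; apply/andP; split; lra.
  move=> [u v] [/=]; rewrite !in_itv/= => /andP[u1 u2] /andP[v1 v2].
  by apply: Hr; rewrite /= ltr_norml; apply/andP; split; lra.
apply: bigcupT_measurable_rat => a; apply: bigcupT_measurable_rat => b.
apply: bigcupT_measurable => n; case: pselect => h /=; last exact: measurable0.
by apply: measurableX; exact: measurable_itv.
Qed.

Definition cpt (w : mR * mR) : R[i] := (w.1 +i* w.2)%C.

Definition delta (w : mR * mR) : R := (1 - normc (cpt w))%R.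

Definition pdisc : set (mR * mR) := [set w | (0 < delta w)%R].

Lemma pdiscP w : pdisc w <-> (normc (cpt w) < 1)%R.
Proof. by rewrite /pdisc /delta /= subr_gt0. Qed.

Lemma normc_cptB_le (v w : mR * mR) : (normc (cpt v - cpt w) <= `|v.1 - w.1| + `|v.2 - w.2|)%R.
Proof. by rewrite (le_trans (normc_le_ReIm _))// ReB' ImB'. Qed.

Lemma plane_measurable_fun (F : R[i] -> R) (g : R[i] -> R[i]) (D : set (mR * mR)) :
  (forall u v, `|F u - F v| <= normc (u - v))%R ->
  (forall w, D w -> exists r : R, (0 < r)%R /\ forall v : mR * mR,
     (`|v.1 - w.1| < r -> `|v.2 - w.2| < r -> D v)%R) ->
  (forall w, D w -> ccont g (cpt w)) ->
  measurable_fun D (fun w => F (g (cpt w))).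
Proof.
move=> FL oD cg mD; apply: (measurability _ (RGenOInfty.measurableE R)) => //.
move=> _ [_ [a ->] <-]; apply: measurable_plane_open => w [Dw]; rewrite /= in_itv/= andbT => aw.
have e0 : (0 < F (g (cpt w)) - a)%R by rewrite subr_gt0.
have [d d0 H] := cg _ Dw _ e0; have [r [r0 Hr]] := oD _ Dw.
exists (Num.min r (d / 2))%R; split; first by rewrite lt_min r0 divr_gt0.
move=> v; rewrite !lt_min => /andP[v1 v1'] /andP[v2 v2']; split; first exact: Hr.
rewrite /= in_itv/= andbT.
have /H h : (normc (cpt v - cpt w) < d)%R.
  by rewrite (le_lt_trans (normc_cptB_le _ _))//; lra.
have := le_lt_trans (FL _ _) h; rewrite ltr_norml => /andP[? ?]; lra.
Qed.

Lemma pdisc_open w : pdisc w -> exists r : R, (0 < r)%R /\ forall v : mR * mR,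
     (`|v.1 - w.1| < r -> `|v.2 - w.2| < r -> pdisc v)%R.
Proof.
move=> dw; exists (delta w / 2)%R; split; first by rewrite divr_gt0.
move=> v v1 v2; apply/pdiscP; have := lerB_normc (cpt v) (cpt w).
by have := normc_cptB_le v w; rewrite /delta in v1 v2; lra.
Qed.

Lemma measurable_pdisc : measurable pdisc.
Proof. exact: measurable_plane_open pdisc_open. Qed.

Lemma measurable_delta : measurable_fun setT delta.
Proof.
apply: measurable_funB => //.
apply: (@plane_measurable_fun (@normc R) id) => //.
- exact: ler_dist_normc.
- by move=> w _; exists 1%R.
- by move=> w _; exact: ccont_id.
Qed.

(** Extension by zero, so that Tonelli and changes of variables are applied on the whole plane. *)
Definition on_disc (k : mR * mR -> R) (w : mR * mR) : R := if (0 < delta w)%R then k w else 0%R.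

Lemma on_disc_ge0 k w : (forall w, pdisc w -> 0 <= k w)%R -> (0 <= on_disc k w)%R.
Proof. by move=> k0; rewrite /on_disc; case: ifPn => // dw; exact: k0. Qed.

Lemma measurable_on_disc k : measurable_fun pdisc k -> measurable_fun setT (on_disc k).
Proof.
move=> mk; apply: measurable_fun_if => //.
- by apply: measurable_fun_ltr => //; exact: measurable_delta.
- by rewrite setTI; exact: mk.
Qed.

Lemma analytic_ccont f z : analytic_on_disc f -> (normc z < 1)%R -> ccont f z.
Proof. by move=> /analytic_cderiv[f' df] /df; exact: cderiv_ccont. Qed.

Lemma measurable_normc_analytic f : analytic_on_disc f ->
  measurable_fun pdisc (fun w => normc (f (cpt w))).
Proof.
move=> af; apply: plane_measurable_fun.
- exact: ler_dist_normc.
- exact: pdisc_open.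
- by move=> w /pdiscP; exact: analytic_ccont.
Qed.

(** [b] times the pushforward agrees with Lebesgue measure on intervals, and Lebesgue measure is
    determined by these values. *)
Lemma pushforward_affine (a b : R) (A : set mR) : (0 < b)%R -> measurable A ->
  leb ((fun x => a + b * x)%R @^-1` A) = b^-1%:E * leb A.
Proof.
move=> b0 mA.
have mphi : measurable_fun setT (fun x : mR => (a + b * x)%R : mR).
  by apply: measurable_funD => //; exact: measurable_funM.
have b0' : (0 <= b)%R by exact: ltW.
pose nu := (mscale (NngNum b0') (pushforward leb (fun x : mR => (a + b * x)%R : mR))
  : {measure set mR -> \bar R}).
suff -> : leb A = nu mphi A.
  by rewrite /nu/= /mscale/= muleA -EFinM mulVf ?gt_eqF// mul1e.
apply: lebesgue_measure_unique => //= _ [[x y]] _ <-.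
rewrite /nu/= /mscale/= /pushforward.
rewrite (_ : _ @^-1` _ = `]((x - a) / b)%R, ((y - a) / b)%R]%classic); last first.
  apply/seteqP; split => t /=; rewrite !in_itv/= ltr_pdivrMr// ler_pdivlMr//.
    by move=> /andP[h1 h2]; apply/andP; split; lra.
  by move=> /andP[h1 h2]; apply/andP; split; lra.
rewrite !lebesgue_measure_itv/= !lte_fin ltr_pM2r ?invr_gt0// ltrD2r.
case: ifP => _; last by rewrite mule0.
by rewrite -!EFinD -EFinM; congr (_%:E); field; rewrite gt_eqF.
Qed.

Lemma integral_affine_pos (a b : R) (h : R -> \bar R) : (0 < b)%R ->
  measurable_fun (setT : set mR) h -> (forall x, 0 <= h x) ->
  \int[leb]_x h (a + b * x)%R = b^-1%:E * \int[leb]_x h x.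
Proof.
move=> b0 mh h0.
have mphi : measurable_fun setT (fun x : mR => (a + b * x)%R : mR).
  by apply: measurable_funD => //; exact: measurable_funM.
have b0' : (0 <= b^-1)%R by rewrite invr_ge0 ltW.
rewrite -[RHS](@ge0_integral_mscale _ _ _ leb setT measurableT (NngNum b0') h)//.
transitivity (\int[pushforward leb (fun x : mR => (a + b * x)%R : mR)]_x h x).
  by rewrite ge0_integral_pushforward// => x _.
apply: eq_measure_integral => //= A mA _.
by rewrite /pushforward pushforward_affine.
Qed.

Lemma integral_affine (a b : R) (h : R -> \bar R) : b != 0%R ->
  measurable_fun (setT : set mR) h -> (forall x, 0 <= h x) ->
  \int[leb]_x h (a + b * x)%R = `|b|^-1%:E * \int[leb]_x h x.
Proof.
move=> b0 mh h0; have [bp|bn|/eqP] := ltgtP b 0%R; last by rewrite (negbTE b0).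
  rewrite ltr0_norm//.
  have <- : \int[leb]_x h (- x)%R = \int[leb]_x h x.
    transitivity (\int[pushforward leb (-%R : mR -> mR)]_x h x).
      by rewrite ge0_integral_pushforward// => x _.
    by apply: eq_measure_integral => //= A mA _; rewrite lebesgue_measureN.
  rewrite -(integral_affine_pos (- a)) ?oppr_gt0//.
  - by apply: eq_integral => x _; congr h; ring.
  - exact: measurableT_comp.
by rewrite gtr0_norm// integral_affine_pos.
Qed.

End Plane.

(** * Monotonicity of the integral and Jensen's inequality *)

Section IntegralTools.
Local Open Scope ereal_scope.

(** The integral of a nonnegative function is a supremum over the simple functions below it, so
    comparison holds without any measurability assumption on either side. *)
Lemma le_integral_nonneg d (T : measurableType d) (R : realType)
    (mu : {measure set T -> \bar R}) (D : set T) (f1 f2 : T -> \bar R) :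
  (forall x, D x -> 0 <= f1 x) -> (forall x, D x -> f1 x <= f2 x) ->
  \int[mu]_(x in D) f1 x <= \int[mu]_(x in D) f2 x.
Proof.
move=> f10 f12; rewrite 2!(integral_mkcond D).
have g1 x : 0 <= (f1 \_ D) x by rewrite patchE; case: ifPn => // /[!inE] /f10.
have g2 x : (f1 \_ D) x <= (f2 \_ D) x by rewrite !patchE; case: ifPn => // /[!inE] /f12.
rewrite !ge0_integralTE//; last by move=> x; exact: le_trans (g1 x) (g2 x).
apply: le_ereal_sup => _ [h hf <-]; exists h => // x.
exact: le_trans (hf x) (g2 x).
Qed.

Section Jensen.
Context d (T : measurableType d) (R : realType) (mu : {measure set T -> \bar R}).
Variables (D : set T) (mD : measurable D) (k x : T -> R) (p m : R).
Hypotheses (p1 : (1 <= p)%R) (m0 : (0 < m)%R).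
Hypotheses (k0 : forall t, D t -> (0 <= k t)%R) (x0 : forall t, D t -> (0 <= x t)%R).
Hypotheses (mk : measurable_fun D k) (mx : measurable_fun D x).
Hypothesis (km : \int[mu]_(t in D) (k t)%:E <= m%:E).

(* Young's inequality x <= l^(1-p) x^p + l, optimized over l. *)
Lemma jensen_le (v c : R) : (0 <= v)%R -> (0 < c)%R ->
  v%:E <= c%:E * \int[mu]_(t in D) (k t * x t)%:E ->
  (v `^ p)%:E <= ((2 * c) `^ p * m `^ (p - 1))%:E *
    \int[mu]_(t in D) (k t * x t `^ p)%:E.
Proof.
move: p1 m0 => q1 q0 v0 c0 vle; have p0 : (0 < p)%R by lra.
have mkx : measurable_fun D (fun t => (k t * x t `^ p)%:E).
  apply/measurable_EFinP; apply: measurable_funM => //.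
  exact: (measurableT_comp (measurable_powR p)).
have kx0 t : D t -> 0 <= (k t * x t `^ p)%:E.
  by move=> Dt; rewrite lee_fin mulr_ge0 ?powR_ge0 ?k0.
have C0 : (0 < (2 * c) `^ p * m `^ (p - 1))%R.
  by rewrite mulr_gt0// powR_gt0// mulr_gt0.
set P := (X in _ <= _ * X).
have P0 : 0 <= P by exact: integral_ge0.
have [->|] := eqVneq P +oo; first by rewrite gt0_muley ?lte_fin// leey.
move=> Pfin; have {}Pfin : P \is a fin_num by rewrite ge0_fin_numE// ltey.
rewrite -(fineK Pfin) -EFinM lee_fin.
set r := fine P; have r0 : (0 <= r)%R by exact: fine_ge0.
have young l : (0 < l)%R -> (v <= c * (l `^ (1 - p) * r + l * m))%R.
  move=> l0; rewrite -lee_fin (le_trans vle)// EFinM lee_pmul2l//.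
  have l1 : (0 <= l `^ (1 - p))%R by exact: powR_ge0.
  rewrite (@le_trans _ _ (\int[mu]_(t in D) ((l `^ (1 - p))%:E * (k t * x t `^ p)%:E + l%:E * (k t)%:E)))//.
    apply: le_integral_nonneg => t Dt; first by rewrite lee_fin mulr_ge0 ?k0 ?x0.
    rewrite -!EFinM -EFinD lee_fin mulrCA [(l * _)%R]mulrC -mulrDr.
    apply: ler_wpM2l; first exact: k0.
    have xt := x0 Dt; have [xl|lx] := leP (x t) l.
      by rewrite (le_trans xl)// lerDr mulr_ge0 ?powR_ge0.
    rewrite -[leLHS]addr0 lerD//; last exact: ltW.
    have xt0 : (0 < x t)%R by exact: lt_trans lx.
    have -> : (x t <= l `^ (1 - p) * x t `^ p)%R = (x t `^ (1 - p) * x t `^ p <= l `^ (1 - p) * x t `^ p)%R.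
      by rewrite -powRD ?(gt_eqF xt0) ?implybT// subrK powRr1.
    apply: ler_wpM2r; first exact: powR_ge0.
    rewrite -(opprB p 1%R) !powRN lef_pV2 ?posrE ?powR_gt0//.
    by apply: ge0_ler_powR; rewrite ?nnegrE//; lra.
  rewrite ge0_integralD//; last 4 first.
  - by move=> t Dt; rewrite mule_ge0 ?kx0// lee_fin.
  - exact: measurable_funeM.
  - by move=> t Dt; rewrite mule_ge0 ?lee_fin ?k0// ltW.
  - by apply: measurable_funeM; exact/measurable_EFinP.
  have -> : \int[mu]_(t in D) ((l `^ (1 - p))%:E * (k t * x t `^ p)%:E) = (l `^ (1 - p))%:E * P.
    by rewrite ge0_integralZl.
  have -> : \int[mu]_(t in D) (l%:E * (k t)%:E) = l%:E * \int[mu]_(t in D) (k t)%:E.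
    rewrite ge0_integralZl//; do ?[exact/measurable_EFinP|by move=> t Dt; rewrite lee_fin k0|by rewrite lee_fin ltW].
  rewrite EFinD !EFinM /r fineK//; apply: leeD => //.
  by apply: lee_wpmul2l => //; rewrite lee_fin ltW.
have [req|rn] := eqVneq r 0%R.
  suff -> : v = 0%R by rewrite powR0 ?gt_eqF// req mulr0.
  apply/eqP; rewrite eq_le v0 andbT; apply/ler_addgt0Pr => e e0; rewrite add0r.
  have l0 : (0 < e / (c * m))%R by rewrite divr_gt0// mulr_gt0.
  rewrite (le_trans (young _ l0))// req mulr0 add0r.
  by rewrite [leLHS](_ : _ = e)//; field; rewrite !gt_eqF.
have {}r0 : (0 < r)%R by rewrite lt_neqAle eq_sym rn.
(* This [l] makes the two terms [l ^ (1 - p) * r] and [l * m] equal, whence the factor 2. *)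
pose l := ((r / m) `^ p^-1)%R; have rm : (0 < r / m)%R by rewrite divr_gt0.
have l0 : (0 < l)%R by rewrite powR_gt0.
have lp : (l `^ p = r / m)%R.
  by rewrite /l -powRrM mulVf ?gt_eqF// powRr1// ltW.
have l1 : (l `^ (1 - p) * r = l * m)%R.
  rewrite powRD ?(gt_eqF l0) ?implybT// powRr1 ?ltW// powRN lp.
  by field; rewrite !gt_eqF.
have := young _ l0; rewrite l1 => vl.
have vl' : (v <= 2 * c * (l * m))%R by rewrite (le_trans vl)//; lra.
have lm0 : (0 <= l * m)%R by rewrite mulr_ge0// ltW.
rewrite (@le_trans _ _ ((2 * c * (l * m)) `^ p)%R)//.
  by apply: ge0_ler_powR; rewrite ?nnegrE ?(ltW p0)// mulr_ge0//; lra.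
have c2 : (0 <= 2 * c)%R by rewrite mulr_ge0// ltW.
rewrite (powRM p c2 lm0) (powRM p (ltW l0) (ltW m0)) lp.
have -> : (m `^ p = m `^ (p - 1) * m)%R.
  by rewrite -[X in (_ = _ * X)%R](powRr1 (ltW m0)) -powRD ?subrK// (gt_eqF m0) implybT.
by rewrite le_eqVlt; apply/orP; left; apply/eqP; field; rewrite gt_eqF.
Qed.

End Jensen.

End IntegralTools.

(** * Sub-mean value property *)

Section SubMean.
Context {R : realType}.
Local Notation mR := (measurableTypeR R).
Local Notation leb := (@lebesgue_measure R).
Local Notation pl := (leb \x leb)%E.
Implicit Types (f g : R[i] -> R[i]) (e : R[i]).
Local Open Scope ereal_scope.

Lemma normc_cint_le_ge0 (g : R[i] -> R[i]) : edge_cont g ->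
  (normc (cint g))%:E <= 2%:E * \int[leb]_(y in `[(-1)%R, 1%R]) (normc (g y%:C))%:E.
Proof.
move=> gc; apply: normc_cintegral_le_ge0; first exact: measurable_itv.
by split; apply: edge_cont_integrable => // z w; [exact: Re_lipschitz|exact: Im_lipschitz].
Qed.

(** Parametrizes a side of a small square, of half-length [normr b >= r], by [[-1, 1]], and bounds
    the integral along it by the integral over the whole line carrying that side. *)
Lemma edge_affine_le (G : mR -> \bar R) (g : R -> R) (a b r : R) : (0 < r <= `|b|)%R ->
  measurable_fun setT G -> (forall x, 0 <= G x) -> (forall y, 0 <= g y)%R ->
  (forall y, (-1 <= y <= 1)%R -> (g y)%:E <= G (a + b * y)%R) ->
  \int[leb]_(y in `[(-1)%R, 1%R]) (g y)%:E <= r^-1%:E * \int[leb]_x G x.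
Proof.
move=> /andP[r0 rb] mG G0 g0 gG.
have b0 : b != 0%R by rewrite -normr_gt0; exact: lt_le_trans rb.
have mphi : measurable_fun setT (fun x : mR => (a + b * x)%R : mR).
  by apply: measurable_funD => //; exact: measurable_funM.
have mGc : measurable_fun setT (fun y : mR => G (a + b * y)%R) by exact: measurableT_comp.
apply: (@le_trans _ _ (\int[leb]_(y in `[(-1)%R, 1%R]) G (a + b * y)%R)).
  apply: le_integral_nonneg => y; first by rewrite lee_fin.
  by rewrite /= in_itv/=; exact: gG.
apply: (@le_trans _ _ (\int[leb]_y G (a + b * y)%R)).
  by apply: ge0_subset_integral => //; exact: measurable_itv.
rewrite integral_affine//; apply: lee_wpmul2r; first exact: integral_ge0.
by rewrite lee_fin lef_pV2 ?posrE// normr_gt0.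
Qed.

Lemma integral_sum4_le (D : set mR) (g1 g2 g3 g4 : mR -> \bar R) a1 a2 a3 a4 : measurable D ->
  measurable_fun setT g1 -> measurable_fun setT g2 ->
  measurable_fun setT g3 -> measurable_fun setT g4 ->
  (forall x, 0 <= g1 x) -> (forall x, 0 <= g2 x) ->
  (forall x, 0 <= g3 x) -> (forall x, 0 <= g4 x) ->
  \int[leb]_(x in D) g1 x <= a1 -> \int[leb]_(x in D) g2 x <= a2 ->
  \int[leb]_(x in D) g3 x <= a3 -> \int[leb]_(x in D) g4 x <= a4 ->
  \int[leb]_(x in D) (g1 x + g2 x + g3 x + g4 x) <= a1 + a2 + a3 + a4.
Proof.
move=> mD /measurable_funTS m1 /measurable_funTS m2 /measurable_funTS m3 /measurable_funTS m4.
move=> p1 p2 p3 p4 h1 h2 h3 h4.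
have p12 x : 0 <= g1 x + g2 x by exact: adde_ge0.
have p123 x : 0 <= g1 x + g2 x + g3 x by exact: adde_ge0.
have m12 : measurable_fun D (fun x => g1 x + g2 x) by exact: emeasurable_funD.
have m123 : measurable_fun D (fun x => g1 x + g2 x + g3 x) by exact: emeasurable_funD.
by rewrite !ge0_integralD// !leeD.
Qed.

Definition in_square (w0 : mR * mR) (r : R) (v : mR * mR) : bool :=
  (`|v.1 - w0.1| <= r)%R && (`|v.2 - w0.2| <= r)%R.

Lemma measurable_in_square w0 r : measurable_fun setT (in_square w0 r).
Proof.
by apply: measurable_and; apply: measurable_fun_ler => //;
  apply: measurableT_comp => //; apply: measurable_funB.
Qed.

(* Cauchy's formula on the squares of half-side r s about w0, averaged over
   1/2 <= s <= 1: each of the four sides then sweeps out an area. *)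
Lemma submean_square : exists K : R, (0 < K)%R /\ forall f (w0 : mR * mR) (r : R),
  analytic_on_disc f -> (0 < r)%R -> (normc (cpt w0) + 2 * r < 1)%R ->
  (normc (f (cpt w0)))%:E <= (K / r ^+ 2)%:E *
    \int[pl]_v (if in_square w0 r v then on_disc (fun v => normc (f (cpt v))) v else 0%R)%:E.
Proof.
pose J := normc (winding : R[i]); have J0 : (0 < J)%R by rewrite normc_gt0 winding_neq0.
(* For one square, a factor 2 from the complex integral and [2 / r] from the half-side [>= r / 2]
   give [4 / r]. Averaging over an interval of length [1 / 2], each of the four sides yields at most
   [I / r], so [J / 2 * normc (f z0) <= 16 * I / r ^ 2]. *)
exists (32 / J)%R; split; first by rewrite divr_gt0.
move=> f [x0 y0] r af r0 z0r.
set h := fun v : mR * mR => (if in_square (x0, y0) r v then on_disc (fun v => normc (f (cpt v))) v else 0%R).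
have h0 v : (0 <= h v)%R.
  by rewrite /h; case: ifP => // _; apply: on_disc_ge0 => ? _; exact: normc_ge0.
have mh : measurable_fun setT h.
  apply: measurable_fun_ifT => //; first exact: measurable_in_square.
  by apply: measurable_on_disc; exact: measurable_normc_analytic.
have mhE : measurable_fun setT (EFin \o h) by exact/measurable_EFinP.
have h0E v : 0 <= (EFin \o h) v by rewrite lee_fin.
(* Integrals along full vertical and horizontal lines. Each has total integral [I], and the sides of
   the square of half-side [r * s] lie on the lines at [x0 + r * s], [x0 - r * s], [y0 + r * s] and
   [y0 - r * s]. *)
pose HX (x : mR) := \int[leb]_y (h (x, y))%:E.
pose HY (y : mR) := \int[leb]_x (h (x, y))%:E.
have mHX : measurable_fun setT HX.
  exact: (@measurable_fun_fubini_tonelli_F _ _ mR mR R leb _ mhE h0E).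
have mHY : measurable_fun setT HY.
  exact: (@measurable_fun_fubini_tonelli_G _ _ mR mR R leb _ mhE h0E).
have HX0 x : 0 <= HX x by apply: integral_ge0 => y _; rewrite lee_fin.
have HY0 y : 0 <= HY y by apply: integral_ge0 => x _; rewrite lee_fin.
pose I := \int[pl]_v (h v)%:E.
have IX : \int[leb]_x HX x = I by rewrite /I (@fubini_tonelli1 _ _ mR mR R leb leb _ mhE h0E).
have IY : \int[leb]_y HY y = I by rewrite /I (@fubini_tonelli2 _ _ mR mR R leb leb _ mhE h0E).
have I0 : 0 <= I by apply: integral_ge0 => v _; rewrite lee_fin.
have [f' df] := analytic_cderiv af.
pose z0 : R[i] := cpt (x0, y0).
have key (s : R) : (1 / 2 <= s <= 1)%R ->
  (J * normc (f z0))%:E <= (4 / r)%:E *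
    (HX (x0 + r * s)%R + HY (y0 + r * s)%R + HX (x0 + - r * s)%R + HY (y0 + - r * s)%R).
  move=> /andP[s1 s2]; pose p := (r * s)%R.
  have p0 : (0 < p)%R by rewrite mulr_gt0//; lra.
  have pr : (p <= r)%R by rewrite ler_piMr// ltW.
  have rp : (r / 2 <= p)%R by rewrite ler_pM2l//; lra.
  pose F (z : R[i]) := f (z0 + p%:C * z)%R.
  have dF : forall z, inbox z -> cderiv F (fun z => p%:C * f' (z0 + p%:C * z))%R z.
    apply: cderiv_rescale => // z zz0; apply: df.
    by have := lerB_normc z z0; rewrite /z0 in zz0 *; lra.
  have cF : bd_cont F by move=> z zb; exact: cderiv_ccont (dF _ (onbd_inbox zb)).
  have n01 : (normc (0 : R[i]) < 1)%R by rewrite normc0.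
  have c0 := @cauchy_formula R F _ 0%R n01 dF.
  have cG : bd_cont (fun z => F z / (z - 0))%R.
    apply: bd_contM => //; apply: bd_contV.
      by move=> z zb; rewrite subr0; exact: onbd_neq0.
    by apply: bd_contD; [exact: bd_cont_id|exact: bd_cont_cst].
  have eb e : e \in dirs -> (normc (e * 'i * cint (fun z => F (e * (1 + 'i * z)) / (e * (1 + 'i * z) - 0)))%R)%:E
     <= 2%:E * \int[leb]_(y in `[(-1)%R, 1%R]) (normc (F (e * (1 + 'i * y%:C))%R))%:E.
    move=> he; rewrite !normcM normc_i (normc_dir he) !mul1r.
    rewrite (le_trans (normc_cint_le_ge0 (bd_edge_cont cG he)))//.
    apply: lee_wpmul2l; first by rewrite lee_fin.
    apply: le_integral_nonneg => y; first by rewrite lee_fin normc_ge0.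
    rewrite /= in_itv/= => y1; rewrite lee_fin normcM normcV subr0.
    have zb : onbd (e * (1 + 'i * y%:C))%R by exists e, y.
    rewrite ler_piMr ?normc_ge0// invf_le1; have /andP[? ?] := onbd_normc zb => //.
    by apply: lt_le_trans ltr01 _.
  have hE (u v : R) : (`|u| <= p)%R -> (`|v| <= p)%R ->
      (normc (f (z0 + (u +i* v)%C)%R))%:E = (h (x0 + u, y0 + v)%R)%:E.
    move=> up vp; rewrite /h /in_square /= !(addrC x0) !(addrC y0) !addrK.
    rewrite (le_trans up pr) (le_trans vp pr) /= /on_disc /delta.
    have -> : cpt (u + x0, v + y0)%R = (z0 + (u +i* v)%C)%R.
      by rewrite /z0 /cpt/=; apply/eqP; rewrite eq_complex/= !(addrC u) !(addrC v) !eqxx.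
    rewrite ifT// subr_gt0 (le_lt_trans (ler_normcD _ _))//.
    rewrite (le_lt_trans _ z0r)// lerD2l (le_trans (normc_le_ReIm _))//=.
    by have := le_trans up pr; have := le_trans vp pr; lra.
  have mh1 (x : mR) : measurable_fun setT (fun y : mR => (h (x, y))%:E).
    by apply: (measurableT_comp mhE); exact: pair1_measurable.
  have mh2 (y : mR) : measurable_fun setT (fun x : mR => (h (x, y))%:E).
    by apply: (measurableT_comp mhE); exact: pair2_measurable.
  have r2 : (r / 2)^-1%:E = (2 / r)%:E by rewrite invf_div.
  have yp (y : R) : (-1 <= y <= 1)%R -> (`|p * y| <= p)%R /\ (`|- p * y| <= p)%R.
    by move=> y1; rewrite mulNr normrN normrM gtr0_norm// ler_piMr ?(ltW p0)// ler_norml.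
  have pp : (`|p| <= p)%R /\ (`|- p| <= p)%R by rewrite normrN gtr0_norm.
  have r2b : (0 < r / 2 <= `|p|)%R /\ (0 < r / 2 <= `|- p|)%R.
    by rewrite normrN gtr0_norm// rp divr_gt0.
  have FE e (y u v : R) : (p%:C * (e * (1 + 'i * y%:C)) = (u +i* v)%C)%R ->
      (`|u| <= p)%R -> (`|v| <= p)%R ->
      (normc (F (e * (1 + 'i * y%:C))%R))%:E = (h (x0 + u, y0 + v)%R)%:E.
    by move=> ee up vp; rewrite -hE// /F ee.
  have cE (z w : R[i]) : complex.Re z = complex.Re w -> complex.Im z = complex.Im w -> z = w.
    by case: z => a b; case: w => c d /= -> ->.
  have b1 : \int[leb]_(y in `[(-1)%R, 1%R]) (normc (F (1 * (1 + 'i * y%:C))%R))%:E <= (2 / r)%:E * HX (x0 + r * s)%R.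
    rewrite -r2; apply: (@edge_affine_le (fun y => (h (x0 + p, y)%R)%:E) (fun y => normc (F (1 * (1 + 'i * y%:C))%R)) y0 p) => //.
    - exact: r2b.1.
    - by move=> x; rewrite lee_fin.
    - by move=> y; exact: normc_ge0.
    - move=> y y1; rewrite (@FE _ y p (p * y)%R) ?(yp _ y1).1 ?pp.1//.
      by apply: cE => /=; ring.
  have b2 : \int[leb]_(y in `[(-1)%R, 1%R]) (normc (F ('i * (1 + 'i * y%:C))%R))%:E <= (2 / r)%:E * HY (y0 + r * s)%R.
    rewrite -r2; apply: (@edge_affine_le (fun x => (h (x, y0 + p)%R)%:E) (fun y => normc (F ('i * (1 + 'i * y%:C))%R)) x0 (- p)) => //.
    - exact: r2b.2.
    - by move=> x; rewrite lee_fin.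
    - by move=> y; exact: normc_ge0.
    - move=> y y1; rewrite (@FE _ y (- p * y)%R p) ?(yp _ y1).2 ?pp.1//.
      by apply: cE => /=; ring.
  have b3 : \int[leb]_(y in `[(-1)%R, 1%R]) (normc (F (-1 * (1 + 'i * y%:C))%R))%:E <= (2 / r)%:E * HX (x0 + - r * s)%R.
    rewrite -r2 mulNr; apply: (@edge_affine_le (fun y => (h (x0 + - p, y)%R)%:E) (fun y => normc (F (-1 * (1 + 'i * y%:C))%R)) y0 (- p)) => //.
    - exact: r2b.2.
    - by move=> x; rewrite lee_fin.
    - by move=> y; exact: normc_ge0.
    - move=> y y1; rewrite (@FE _ y (- p)%R (- p * y)%R) ?(yp _ y1).2 ?pp.2//.
      by apply: cE => /=; ring.
  have b4 : \int[leb]_(y in `[(-1)%R, 1%R]) (normc (F (- 'i * (1 + 'i * y%:C))%R))%:E <= (2 / r)%:E * HY (y0 + - r * s)%R.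
    rewrite -r2 mulNr; apply: (@edge_affine_le (fun x => (h (x, y0 + - p)%R)%:E) (fun y => normc (F (- 'i * (1 + 'i * y%:C))%R)) x0 p) => //.
    - exact: r2b.1.
    - by move=> x; rewrite lee_fin.
    - by move=> y; exact: normc_ge0.
    - move=> y y1; rewrite (@FE _ y (p * y)%R (- p)%R) ?(yp _ y1).1 ?pp.2//.
      by apply: cE => /=; ring.
  have -> : (J * normc (f z0))%R = normc (oint (fun z => F z / (z - 0))%R).
    by rewrite c0 normcM mulrC /F mulr0 addr0.
  rewrite /oint !big_cons big_nil addr0.
  have q e A : e \in dirs ->
      \int[leb]_(y in `[(-1)%R, 1%R]) (normc (F (e * (1 + 'i * y%:C))%R))%:E <= (2 / r)%:E * A ->
      (normc (e * 'i * cint (fun z => F (e * (1 + 'i * z)) / (e * (1 + 'i * z) - 0)))%R)%:E <= (4 / r)%:E * A.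
    move=> he hA; rewrite (le_trans (eb _ he))//.
    have -> : (4 / r)%:E = 2%:E * (2 / r)%:E :> \bar R by rewrite -EFinM; congr (_%:E); ring.
    by rewrite -muleA; apply: lee_wpmul2l => //; rewrite lee_fin.
  have d1 : (1%R : R[i]) \in @dirs R by rewrite !inE eqxx.
  have d2 : ('i%R : R[i]) \in @dirs R by rewrite !inE eqxx !orbT.
  have d3 : ((-1)%R : R[i]) \in @dirs R by rewrite !inE eqxx !orbT.
  have d4 : ((- 'i)%R : R[i]) \in @dirs R by rewrite !inE eqxx !orbT.
  have q1 := q _ _ d1 b1; have q2 := q _ _ d2 b2.
  have q3 := q _ _ d3 b3; have q4 := q _ _ d4 b4.
  move: (HX0 (x0 + r * s)%R) (HY0 (y0 + r * s)%R) (HX0 (x0 + - r * s)%R) (HY0 (y0 + - r * s)%R) q1 q2 q3 q4.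
  move: (HX _) (HY _) (HX _) (HY _) => A1 A2 A3 A4 A10 A20 A30 A40 q1 q2 q3 q4.
  rewrite !ge0_muleDr ?adde_ge0//.
  set t1 := (1 * 'i * _)%R in q1 *; set t2 := ('i * 'i * _)%R in q2 *.
  set t3 := (-1 * 'i * _)%R in q3 *; set t4 := (- 'i * 'i * _)%R in q4 *.
  apply: (@le_trans _ _ ((normc t1)%:E + (normc t2)%:E + (normc t3)%:E + (normc t4)%:E)).
    rewrite -!EFinD lee_fin (le_trans (ler_normcD _ _))// -!addrA lerD2l.
    by rewrite (le_trans (ler_normcD _ _))// lerD2l ler_normcD.
  by rewrite !leeD.
have aff (b : R) (H : mR -> \bar R) (a : R) : measurable_fun setT H -> (forall x, 0 <= H x) -> `|b|%R = r ->
    measurable_fun setT (fun s : mR => H (a + b * s)%R) /\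
    \int[leb]_(s in `[(1 / 2)%R, 1%R]) H (a + b * s)%R <= r^-1%:E * \int[leb]_x H x.
  move=> mH H0 br.
  have mphi : measurable_fun setT (fun x : mR => (a + b * x)%R : mR).
    by apply: measurable_funD => //; exact: measurable_funM.
  have mHc : measurable_fun setT (fun y : mR => H (a + b * y)%R) by exact: measurableT_comp.
  have b0 : b != 0%R by rewrite -normr_gt0 br.
  split => //; rewrite -br -(integral_affine a b0 mH H0).
  by apply: ge0_subset_integral => //; exact: measurable_itv.
have nr : (`|- r| = r)%R by rewrite normrN gtr0_norm.
have pr : (`|r| = r)%R by rewrite gtr0_norm.
have [m1 i1] := aff r HX x0 mHX HX0 pr.
have [m2 i2] := aff r HY y0 mHY HY0 pr.
have [m3 i3] := aff (- r)%R HX x0 mHX HX0 nr.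
have [m4 i4] := aff (- r)%R HY y0 mHY HY0 nr.
rewrite IX in i1 i3; rewrite IY in i2 i4.
pose S (s : mR) := HX (x0 + r * s)%R + HY (y0 + r * s)%R + HX (x0 + - r * s)%R + HY (y0 + - r * s)%R.
have mS : measurable_fun setT S.
  exact: (emeasurable_funD (emeasurable_funD (emeasurable_funD m1 m2) m3) m4).
have S0 s : 0 <= S s by exact: (adde_ge0 (adde_ge0 (adde_ge0 (HX0 _) (HY0 _)) (HX0 _)) (HY0 _)).
have mhalf : leb `[(1 / 2)%R, 1%R] = (1 / 2)%:E.
  by rewrite lebesgue_measure_itv/= lte_fin ifT -?EFinD; [congr (_%:E)|]; lra.
have half : (1 / 2 * (J * normc (f z0)))%:E <= (16 / r ^+ 2)%:E * I.
  apply: (@le_trans _ _ (\int[leb]_(s in `[(1 / 2)%R, 1%R]) ((4 / r)%:E * S s))).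
    apply: (@le_trans _ _ (\int[leb]_(s in `[(1 / 2)%R, 1%R]) (cst (J * normc (f z0))%:E s))).
      rewrite integral_cst; last exact: measurable_itv.
      by rewrite [X in _ * X]mhalf -EFinM lee_fin mulrC.
    apply: le_integral_nonneg => s; first by rewrite lee_fin mulr_ge0 ?normc_ge0// ltW.
    by rewrite /= in_itv/=; exact: key.
  rewrite ge0_integralZl//; [|exact: measurable_funTS|by rewrite lee_fin divr_ge0// ltW].
  have -> : (16 / r ^+ 2)%:E * I = (4 / r)%:E * (r^-1%:E * I + r^-1%:E * I + r^-1%:E * I + r^-1%:E * I).
    rewrite -!ge0_muleDl ?lee_fin ?addr_ge0 ?invr_ge0 ?(ltW r0)// -!EFinD muleA -EFinM.
    by congr (_%:E * _); field; rewrite gt_eqF.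
  apply: lee_wpmul2l; first by rewrite lee_fin divr_ge0// ltW.
  by apply: (integral_sum4_le (measurable_itv _) m1 m2 m3 m4 _ _ _ _ i1 i2 i3 i4) => x;
    [exact: HX0|exact: HY0|exact: HX0|exact: HY0].
clear key; clearbody J.
have J2 : (0 <= 2 / J)%R by rewrite divr_ge0// ltW.
have := lee_wpmul2l (ltac:(by rewrite lee_fin) : 0 <= (2 / J)%:E) half.
rewrite muleA -!EFinM.
have -> : (2 / J * (1 / 2 * (J * normc (f z0))))%R = normc (f z0) by field; rewrite gt_eqF.
have -> // : (2 / J * (16 / r ^+ 2))%R = (32 / J / r ^+ 2)%R.
by field; rewrite (gt_eqF r0) (gt_eqF J0).
Qed.

End SubMean.

(** * Sub-mean value property for powers *)

Section Growth.
Context {R : realType}.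
Local Notation mR := (measurableTypeR R).
Local Notation leb := (@lebesgue_measure R).
Local Notation pl := (leb \x leb)%E.
Implicit Types (f g : R[i] -> R[i]) (p alpha : R) (v w : mR * mR).
Local Open Scope ereal_scope.

(** Raising [a <= K * b] to a nonnegative power, or [b <= K * a] to the opposite of a negative one,
    gives the same factor with the absolute value of the exponent. Weights can thus be compared
    without knowing the sign of [alpha]. *)
Lemma powR_comparable (a b K e : R) : (0 < a -> 0 < b -> 1 <= K -> a <= K * b -> b <= K * a ->
  a `^ e <= K `^ `|e| * b `^ e)%R.
Proof.
move=> a0 b0 K1 ab ba; have K0 : (0 < K)%R by exact: lt_le_trans K1.
have [e0|e0] := leP 0%R e.
  rewrite (ger0_norm e0) -(powRM _ (ltW K0) (ltW b0)).
  by apply: ge0_ler_powR; rewrite ?nnegrE// ?mulr_ge0//; exact: ltW.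
rewrite ltr0_norm//.
have : (b `^ (- e) <= K `^ (- e) * a `^ (- e))%R.
  rewrite -(powRM _ (ltW K0) (ltW a0)).
  by apply: ge0_ler_powR; rewrite ?nnegrE ?oppr_ge0// ?mulr_ge0//; exact: ltW.
have -> : (a `^ e = (a `^ (- e))^-1)%R by rewrite -powRN opprK.
have -> : (b `^ e = (b `^ (- e))^-1)%R by rewrite -powRN opprK.
have := powR_gt0 (- e) a0; have := powR_gt0 (- e) b0.
move: (a `^ _)%R (b `^ _)%R => u v v0 u0 h.
by rewrite ler_pdivlMr// mulrC ler_pdivrMr.
Qed.

Lemma in_square_near w v : pdisc w -> in_square w (delta w / 4) v ->
  [/\ (normc (cpt v - cpt w) <= delta w / 2)%R, (delta w / 2 <= delta v)%R &
      (delta v <= 3 / 2 * delta w)%R].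
Proof.
move=> dw /andP[v1 v2].
have h : (normc (cpt v - cpt w) <= delta w / 2)%R.
  by rewrite (le_trans (normc_cptB_le _ _))//; lra.
split=> //; have := ler_dist_normc (cpt v) (cpt w); rewrite ler_norml => /andP[h1 h2];
  rewrite /delta in h *; lra.
Qed.

Lemma integral_in_square w (r : R) : (0 < r)%R ->
  \int[pl]_v (in_square w r v)%:R%:E = (4 * r ^+ 2)%:E.
Proof.
move=> r0; pose A (x : R) : set mR := `[(x - r)%R, (x + r)%R]%classic.
have -> : (fun v => ((in_square w r v)%:R : R)%:E) = (fun v => (\1_(A w.1 `*` A w.2) v)%:E).
  apply/funext => v; rewrite indicE; suff -> : in_square w r v = (v \in A w.1 `*` A w.2) by []; apply/idP/idP.
    move=> /andP[v1 v2]; apply/mem_set; split; rewrite /A /= in_itv/=.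
      by move: v1; rewrite ler_distlC => /andP[? ?]; apply/andP; split; lra.
    by move: v2; rewrite ler_distlC => /andP[? ?]; apply/andP; split; lra.
  move/set_mem => []; rewrite /A /= !in_itv/= => /andP[? ?] /andP[? ?].
  by rewrite /in_square !ler_distlC; apply/andP; split; apply/andP; split; lra.
have mA x : measurable (A x) by exact: measurable_itv.
rewrite integral_indic//; last exact: measurableX.
transitivity (leb (A w.1) * leb (A w.2)); first by rewrite setIT; exact: product_measure1E.
have lA x : leb (A x) = (2 * r)%:E.
  rewrite /A lebesgue_measure_itv/= lte_fin ifT; last by lra.
  by rewrite -EFinD; congr (_%:E); ring.
by rewrite !lA -EFinM; congr (_%:E); ring.
Qed.

(** Jensen's inequality with the indicator of the square, of mass [4 * r ^ 2], passes from the mean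
    of the modulus to the mean of its [p]-th power. *)
Lemma submean_pow p : (1 <= p)%R -> exists K : R, (0 < K)%R /\ forall f w,
  analytic_on_disc f -> pdisc w ->
  (normc (f (cpt w)) `^ p)%:E <= (K / delta w ^+ 2)%:E *
    \int[pl]_v (if in_square w (delta w / 4) v then on_disc (fun v => normc (f (cpt v)) `^ p) v else 0%R)%:E.
Proof.
move=> p1; have [K0 [K00 H]] := @submean_square R.
have pp : (0 < p)%R by lra.
(* The powers of [r] combine as [r ^ (- 2 p) * r ^ (2 (p - 1)) = r ^ (- 2)], and [r = delta w / 4]
   accounts for 16. *)
exists ((2 * K0) `^ p * 4 `^ (p - 1) * 16)%R; split.
  by rewrite !mulr_gt0 ?powR_gt0// mulr_gt0.
move=> f w af dw; pose r := (delta w / 4)%R; have r0 : (0 < r)%R by rewrite divr_gt0.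
have dwr : (delta w = 4 * r)%R by rewrite /r; field.
have dw' : (normc (cpt w) = 1 - 4 * r)%R by rewrite -dwr /delta; ring.
have c0 : (0 < K0 / r ^+ 2)%R by rewrite divr_gt0// exprn_gt0.
have m0 : (0 < 4 * r ^+ 2)%R by rewrite mulr_gt0// exprn_gt0.
have h1 : (normc (f (cpt w)))%:E <= (K0 / r ^+ 2)%:E *
    \int[pl]_v ((in_square w r v)%:R * on_disc (fun v => normc (f (cpt v))) v)%:E.
  have wr : (normc (cpt w) + 2 * r < 1)%R by rewrite dw'; lra.
  have := H f w r af r0 wr.
  rewrite (_ : (fun v => _) = (fun v => ((in_square w r v)%:R * on_disc (fun v0 => normc (f (cpt v0))) v)%:E))//.
  by apply/funext => v; case: ifP; rewrite ?mul1r ?mul0r.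
have := @jensen_le _ _ _ pl setT measurableT
  (fun v => (in_square w r v)%:R) (on_disc (fun v => normc (f (cpt v)))) p (4 * r ^+ 2) p1 m0
  _ _ _ _ _ (normc (f (cpt w))) (K0 / r ^+ 2)%R (normc_ge0 _) c0 h1.
rewrite -/r => /(_ _ _ _ _ _)/wrap[].
- by move=> v _; rewrite ler0n.
- by move=> v _; apply: on_disc_ge0 => ? _; exact: normc_ge0.
- rewrite (_ : (fun v => _) = (fun v => if in_square w r v then 1%R else 0%R : R)).
    by apply: measurable_fun_ifT => //; exact: measurable_in_square.
  by apply/funext => v; case: ifP.
- by apply: measurable_on_disc; exact: measurable_normc_analytic.
- by rewrite integral_in_square.
move=> h2; apply: (le_trans h2); apply: lee_pmul.
- by rewrite lee_fin mulr_ge0 ?powR_ge0.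
- by apply: integral_ge0 => v _; rewrite lee_fin mulr_ge0 ?powR_ge0.
- rewrite lee_fin dwr le_eqVlt; apply/orP; left; apply/eqP.
  have r2 : (0 < r ^+ 2)%R by rewrite exprn_gt0.
  have -> : (2 * (K0 / r ^+ 2) = (2 * K0) * (r ^+ 2)^-1)%R by ring.
  rewrite powRM ?invr_ge0 ?mulr_ge0 ?ltW// (powRM (p - 1))// ?(ltW r2)//.
  have -> : ((r ^+ 2)^-1 `^ p = ((r ^+ 2) `^ p)^-1)%R.
    by rewrite -(powR_inv1 (ltW r2)) -powRrM mulN1r powRN.
  have -> : ((r ^+ 2) `^ (p - 1) = (r ^+ 2) `^ p / r ^+ 2)%R.
    by rewrite powRB ?(gt_eqF r2) ?implybT// powRr1// ltW.
  by field; rewrite (gt_eqF r0) (gt_eqF (powR_gt0 p r2)).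
- apply: le_integral_nonneg => v _; first by rewrite lee_fin mulr_ge0 ?powR_ge0.
  rewrite lee_fin; case: ifP => _; rewrite ?mul0r// mul1r /on_disc.
  by case: ifP => // _; rewrite powR0 ?gt_eqF.
Qed.

End Growth.

(** * The Bergman integral and the growth of its functions *)

Section BergmanIntegral.
Context {R : realType}.
Local Notation mR := (measurableTypeR R).
Local Notation leb := (@lebesgue_measure R).
Local Notation pl := (leb \x leb)%E.
Implicit Types (f g : R[i] -> R[i]) (p alpha : R) (v w : mR * mR).
Local Open Scope ereal_scope.

(** Up to constants, the [p]-th power of the norm of [A^p_alpha]: the weight is a power of [1 - |z|]
    instead of [1 - |z|^2], which is additive along radii, and the plane measure is not
    normalized. *)
Definition bint p alpha f : \bar R :=
  \int[pl]_v (on_disc (fun v => normc (f (cpt v)) `^ p * delta v `^ alpha) v)%:E.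

Lemma measurable_normc_powR f p : analytic_on_disc f ->
  measurable_fun pdisc (fun v => (normc (f (cpt v)) `^ p)%R).
Proof.
by move=> af; apply: (measurableT_comp (measurable_powR p)); exact: measurable_normc_analytic.
Qed.

Lemma measurable_delta_powR alpha (D : set (mR * mR)) : measurable_fun D (fun v => (delta v `^ alpha)%R).
Proof.
apply: measurable_funTS; apply: (measurableT_comp (measurable_powR alpha)).
exact: measurable_delta.
Qed.

Lemma measurable_bint p alpha f : analytic_on_disc f -> measurable_fun setT
  (fun v => (on_disc (fun v => normc (f (cpt v)) `^ p * delta v `^ alpha)%R v)).
Proof.
move=> af; apply: measurable_on_disc; apply: measurable_funM.
  exact: measurable_normc_powR.
exact: measurable_delta_powR.
Qed.

Lemma on_disc_bint_ge0 p alpha f v :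
  (0 <= on_disc (fun v => normc (f (cpt v)) `^ p * delta v `^ alpha) v)%R.
Proof. by apply: on_disc_ge0 => w _; rewrite mulr_ge0 ?powR_ge0. Qed.

Lemma bint_ge0 p alpha f : 0 <= bint p alpha f.
Proof. by apply: integral_ge0 => v _; rewrite lee_fin on_disc_bint_ge0. Qed.

Lemma powR_mulN (x a : R) : (0 < x -> x `^ a * x `^ (- a) = 1)%R.
Proof. by move=> x0; rewrite powRN divff// gt_eqF// powR_gt0. Qed.

(** On the square used by [submean_pow], [delta] stays within a factor 2 of its value at the centre,
    so the weight [delta v ^ alpha] can be inserted under the integral and compensated at the
    centre. *)
Lemma growth_pow p alpha : (1 <= p)%R -> exists K : R, (0 < K)%R /\ forall f w,
  analytic_on_disc f -> pdisc w ->
  (normc (f (cpt w)) `^ p)%:E <= (K * delta w `^ (- (alpha + 2)))%:E * bint p alpha f.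
Proof.
move=> p1; have [K0 [K00 H]] := @submean_pow R p p1.
exists (K0 * 2 `^ `|alpha|)%R; split; first by rewrite mulr_gt0// powR_gt0.
move=> f w af dw; apply: (le_trans (H f w af dw)).
have d2 : (0 < delta w ^+ 2)%R by rewrite exprn_gt0.
apply: (@le_trans _ _ ((K0 / delta w ^+ 2)%:E * ((2 `^ `|alpha| * delta w `^ (- alpha))%:E * bint p alpha f))).
  apply: lee_wpmul2l; first by rewrite lee_fin divr_ge0 ?ltW.
  rewrite /bint -ge0_integralZl//; last 3 first.
  - by apply/measurable_EFinP; exact: measurable_bint.
  - by move=> v _; rewrite lee_fin on_disc_bint_ge0.
  - by rewrite lee_fin mulr_ge0 ?powR_ge0.
  apply: le_integral_nonneg => v _.
    by rewrite lee_fin; case: ifP => // _; apply: on_disc_ge0 => ? _; exact: powR_ge0.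
  rewrite -EFinM lee_fin; case: ifP => [sq|_]; last first.
    by rewrite mulr_ge0 ?on_disc_bint_ge0// mulr_ge0 ?powR_ge0.
  have [_ h1 h2] := in_square_near dw sq.
  rewrite /on_disc; case: ifP => dv; last by rewrite mulr0.
  rewrite mulrCA -[leLHS]mulr1; apply: ler_wpM2l; first exact: powR_ge0.
  rewrite -[leLHS](powR_mulN alpha dv) mulrC; apply: ler_wpM2r; first exact: powR_ge0.
  have w0 : (0 < delta w)%R by [].
  by rewrite -normrN; apply: powR_comparable => //; lra.
rewrite muleA -EFinM; apply: lee_wpmul2r; first exact: bint_ge0.
have w0 : (0 < delta w)%R by [].
rewrite lee_fin opprD powRD ?(gt_eqF w0) ?implybT// (powRN _ 2) powR_mulrn ?(ltW w0)//.
by rewrite le_eqVlt; apply/orP; left; apply/eqP; field; rewrite (gt_eqF w0).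
Qed.

(** Since [1 - n <= 1 - n ^ 2 <= 2 * (1 - n)] for [0 <= n < 1], the two weights differ by at most a
    factor 2 to the absolute value of [alpha]. *)
Lemma bergman_bint p alpha f : bergman p alpha f <-> analytic_on_disc f /\ bint p alpha f < +oo.
Proof.
pose G v : R := (normc (f (cpt v)) `^ p * (1 - normc (cpt v) ^+ 2) `^ alpha)%R.
have G0 v : (0 <= G v)%R by rewrite mulr_ge0 ?powR_ge0.
suff H : analytic_on_disc f ->
    ((\int[@area R]_(w in [set w | udisc (w.1 +i* w.2)%C]) (G w)%:E < +oo)%E <-> bint p alpha f < +oo).
  by split => -[af h]; split => //; apply/(H af).
move=> af.
have DE : [set w : mR * mR | udisc (w.1 +i* w.2)%C] = pdisc.
  by apply/seteqP; split => w; [move=> h; exact/pdiscP|move/pdiscP].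
have mG : measurable_fun pdisc G.
  apply: measurable_funM; first exact: measurable_normc_powR.
  apply: (measurableT_comp (measurable_powR alpha)); apply: measurable_funTS.
  rewrite (_ : (fun v => _) = (fun v => 1 - (1 - delta v) ^+ 2)%R).
    apply: measurable_funB => //; apply: measurable_funX; apply: measurable_funB => //.
    exact: measurable_delta.
  by apply/funext => v; rewrite /delta; congr (1 - _ ^+ 2)%R; ring.
have mGo : measurable_fun setT (on_disc G) by exact: measurable_on_disc.
have Go0 v : (0 <= on_disc G v)%R by apply: on_disc_ge0.
have aE : \int[@area R]_(w in [set w | udisc (w.1 +i* w.2)%C]) (G w)%:E =
    (1 / pi)%:E * \int[pl]_v (on_disc G v)%:E.
  rewrite DE /area ge0_integral_mscale//=; last 3 first.
    - exact: measurable_pdisc.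
    - by apply/measurable_EFinP.
    - by move=> v _; rewrite lee_fin.
  congr (_ * _); rewrite integral_mkcond; apply: eq_integral => v _.
  rewrite patchE /on_disc; have [dv|dv] := boolP (0 < delta v)%R; first by rewrite mem_set.
  by rewrite memNset//; apply/negP.
have comp v : pdisc v -> (1 - normc (cpt v) ^+ 2 <= 2 * delta v /\ delta v <= 2 * (1 - normc (cpt v) ^+ 2) /\ 0 < 1 - normc (cpt v) ^+ 2)%R.
  move=> /pdiscP; rewrite /delta; have := normc_ge0 (cpt v).
  move: (normc _) => n n0 n1.
  have -> : (1 - n ^+ 2 = (1 - n) + (1 - n) * n)%R by ring.
  have u0 : (0 <= (1 - n) * n)%R by rewrite mulr_ge0//; lra.
  have u1 : ((1 - n) * n <= 1 - n)%R by rewrite ler_piMr//; lra.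
  by move: ((1 - n) * n)%R u0 u1 => u u0 u1; split; [|split]; lra.
pose K := (2 `^ `|alpha|)%R; have K0 : (0 < K)%R by exact: powR_gt0.
have le1 : \int[pl]_v (on_disc G v)%:E <= K%:E * bint p alpha f.
  rewrite /bint -ge0_integralZl//; last 3 first.
  - by apply/measurable_EFinP; exact: measurable_bint.
  - by move=> v _; rewrite lee_fin on_disc_bint_ge0.
  - by rewrite lee_fin ltW.
  apply: le_integral_nonneg => v _; first by rewrite lee_fin.
  rewrite -EFinM lee_fin /on_disc; case: ifP => dv; last by rewrite mulr0.
  have [c1 [c2 c3]] := comp _ dv.
  rewrite mulrCA; apply: ler_wpM2l; first exact: powR_ge0.
  by apply: powR_comparable => //; lra.
have le2 : bint p alpha f <= K%:E * \int[pl]_v (on_disc G v)%:E.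
  rewrite -ge0_integralZl//; last 3 first.
  - exact/measurable_EFinP.
  - by move=> v _; rewrite lee_fin.
  - by rewrite lee_fin ltW.
  apply: le_integral_nonneg => v _; first by rewrite lee_fin on_disc_bint_ge0.
  rewrite -EFinM lee_fin /on_disc; case: ifP => dv; last by rewrite mulr0.
  have [c1 [c2 c3]] := comp _ dv.
  rewrite mulrCA; apply: ler_wpM2l; first exact: powR_ge0.
  by apply: powR_comparable => //; lra.
have pi0 : (0 < 1 / pi :> R)%R by rewrite divr_gt0// pi_gt0.
move: (1 / pi)%R pi0 aE => c c0 aE.
have fin_mul (a : R) (x : \bar R) : (0 < a)%R -> x < +oo -> a%:E * x < +oo.
  by move=> a0 xoo; apply: lte_mul_pinfty => //; rewrite lee_fin ltW.
rewrite aE; split => h; last exact: (fin_mul _ _ c0 (le_lt_trans le1 (fin_mul _ _ K0 h))).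
apply: (le_lt_trans le2); apply: (fin_mul _ _ K0).
by rewrite ltNge leye_eq; apply/eqP => e; move: h; rewrite e gt0_muley ?lte_fin// ltxx.
Qed.

Lemma cpt_ReIm (z : R[i]) : cpt (complex.Re z, complex.Im z) = z.
Proof. by case: z. Qed.

Lemma bergman_growth p alpha f : (1 <= p)%R -> bergman p alpha f ->
  exists C : R, (0 < C)%R /\ forall z, (normc z < 1)%R ->
    (normc (f z) <= C * (1 - normc z) `^ (- ((alpha + 2) / p)))%R.
Proof.
move=> p1 /bergman_bint[af fin]; have [K [K0 H]] := growth_pow alpha p1.
have p0 : (0 < p)%R by lra.
have fin' : bint p alpha f \is a fin_num by rewrite ge0_fin_numE ?bint_ge0.
pose B := (fine (bint p alpha f) + 1)%R.
have B0 : (0 < B)%R by rewrite ltr_wpDl// fine_ge0// bint_ge0.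
exists ((K * B) `^ p^-1)%R; split; first by rewrite powR_gt0// mulr_gt0.
move=> z z1; pose w : mR * mR := (complex.Re z, complex.Im z).
have zE : cpt w = z by exact: cpt_ReIm.
have dw : pdisc w by apply/pdiscP; rewrite zE.
have := H f w af dw; rewrite /delta zE => h.
have {}h : (normc (f z) `^ p <= K * B * (1 - normc z) `^ (- (alpha + 2)))%R.
  rewrite -lee_fin (le_trans h)// -(fineK fin') -EFinM lee_fin mulrAC.
  apply: ler_wpM2r; first exact: powR_ge0.
  by apply: ler_wpM2l; [exact: ltW|rewrite lerDl].
have -> : ((1 - normc z) `^ (- ((alpha + 2) / p)) = ((1 - normc z) `^ (- (alpha + 2))) `^ p^-1)%R.
  by rewrite -powRrM mulNr.
rewrite -powRM ?powR_ge0//; last by rewrite mulr_ge0// ltW.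
have -> : (normc (f z) = (normc (f z) `^ p) `^ p^-1)%R.
  by rewrite -powRrM mulfV ?gt_eqF// powRr1// normc_ge0.
by apply: ge0_ler_powR; rewrite ?nnegrE ?invr_ge0 ?powR_ge0 ?(ltW p0)// mulr_ge0 ?powR_ge0// mulr_ge0// ltW.
Qed.

End BergmanIntegral.

(** * One-dimensional estimates *)

Section PowerIntegrals.
Context {R : realType}.
Local Notation mR := (measurableTypeR R).
Local Notation leb := (@lebesgue_measure R).
Implicit Types (a b c e k s x d : R).
Local Open Scope ereal_scope.

Lemma measurable_powRx k (D : set mR) : measurable_fun D (fun x : mR => (x `^ k)%R).
Proof. by apply: measurable_funTS; exact: measurable_powR. Qed.

Lemma integral_powR_itv k a b : (0 < a < b)%R -> k != (- 1)%R ->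
  \int[leb]_(x in `[a, b]) (x `^ k)%:E = ((b `^ (k + 1) - a `^ (k + 1)) / (k + 1))%:E.
Proof.
move=> /andP[a0 ab] kN1; have k1 : (k + 1)%R != 0%R by rewrite addr_eq0.
have pos x : (a <= x)%R -> (0 < x)%R by exact: lt_le_trans.
pose G x := ((k + 1)^-1 * x `^ (k + 1))%R.
have dG x : (0 < x)%R -> is_derive x 1%R G (x `^ k)%R.
  move=> x0; have h := is_derive1_powR (k + 1)%R x0.
  rewrite (_ : (x `^ k)%R = ((k + 1)^-1 *: ((k + 1) * x `^ (k + 1 - 1)) : R)%R).
    exact: is_deriveZ.
  by rewrite addrK /GRing.scale/= mulrA mulVf// mul1r.
have cG x : (0 < x)%R -> {for x, continuous G}.
  by move=> x0; apply: differentiable_continuous; apply/derivable1_diffP; have [] := dG x x0.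
rewrite (@continuous_FTC2 _ _ G)//.
- by rewrite /G -EFinD; congr (_%:E); rewrite -mulrBr mulrC.
- apply: continuous_in_subspaceT => x; rewrite inE/= in_itv/= => /andP[ax _].
  have x0 := pos _ ax; have h := is_derive1_powR k x0.
  by apply: differentiable_continuous; apply/derivable1_diffP; have [] := h.
- split.
  + by move=> x; rewrite in_itv/= => /andP[/ltW ax _]; have [] := dG x (pos _ ax).
  + by apply: cvg_at_right_filter; apply: cG.
  + by apply: cvg_at_left_filter; apply: cG; exact: lt_trans ab.
- move=> x; rewrite in_itv/= => /andP[/ltW ax _].
  by rewrite derive1E; have [_ ->] := dG x (pos _ ax).
Qed.

(** Reduces improper integrals to compact intervals, where the fundamental theorem of calculus
    applies. *)
Lemma ge0_integral_bigcup_le (F : (set mR)^nat) (f : mR -> \bar R) (M : \bar R) :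
  nondecreasing_seq F -> (forall i, measurable (F i)) -> measurable_fun setT f ->
  (forall x, 0 <= f x) -> (forall i, \int[leb]_(x in F i) f x <= M) ->
  \int[leb]_(x in \bigcup_i F i) f x <= M.
Proof.
move=> ndF mF mf f0 h.
have := @ge0_nondecreasing_set_cvg_integral _ mR R F f leb ndF mF
  (fun i => measurable_funTS mf) (fun i x _ => f0 x).
move=> cv; rewrite -(cvg_lim _ cv)//; apply: lime_le; first exact: (cvgP _ cv).
exact: nearW.
Qed.

Lemma integral_powR0_le k c : (-1 < k)%R -> (0 < c)%R ->
  \int[leb]_(x in `]0%R, c]) (x `^ k)%:E <= (c `^ (k + 1) / (k + 1))%:E.
Proof.
move=> k1 c0; have k10 : (0 < k + 1)%R by lra.
have -> : `]0%R, c]%classic = \bigcup_i `[(c / i.+2%:R)%R, c]%classic :> set mR.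
  apply/seteqP; split => [x|x [i _]] /=; rewrite !in_itv/= => /andP[x0 xc].
    exists (Num.truncn (c / x)) => //=; rewrite in_itv/= xc andbT.
    rewrite ler_pdivrMr// mulrC -ler_pdivrMr// (le_trans (ltW (truncnS_gt _)))//.
    by rewrite ler_nat.
  by rewrite xc andbT (lt_le_trans _ x0)// divr_gt0.
apply: ge0_integral_bigcup_le => [|i||x|i].
- apply/nondecreasing_seqP => i; rewrite subsetEset => x /=; rewrite !in_itv/= => /andP[x1 ->].
  by rewrite andbT (le_trans _ x1)// ler_pM2l// lef_pV2 ?posrE// ler_nat.
- exact: measurable_itv.
- by apply/measurable_EFinP; exact: measurable_powRx.
- by rewrite lee_fin powR_ge0.
- rewrite integral_powR_itv ?gt_eqF//.
    by rewrite lee_fin ler_pM2r ?invr_gt0// lerBlDr lerDl powR_ge0.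
  by rewrite divr_gt0//= ltr_pdivrMr// ltr_pMr// ltr1n.
Qed.

Lemma integral_powRoo_le k c : (k < -1)%R -> (0 < c)%R ->
  \int[leb]_(x in `[c, +oo[) (x `^ k)%:E <= (c `^ (k + 1) / - (k + 1))%:E.
Proof.
move=> k1 c0; have k10 : (0 < - (k + 1))%R by lra.
have -> : `[c, +oo[%classic = \bigcup_i `[c, (c + i.+1%:R)%R]%classic :> set mR.
  apply/seteqP; split => [x|x [i _]] /=; rewrite !in_itv/= ?andbT => h.
    exists (Num.truncn (x - c)) => //=; rewrite in_itv/= h/= -lerBlDl.
    exact/ltW/truncnS_gt.
  by case/andP: h.
apply: ge0_integral_bigcup_le => [|i||x|i].
- apply/nondecreasing_seqP => i; rewrite subsetEset => x /=; rewrite !in_itv/= => /andP[-> x1] /=.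
  by rewrite (le_trans x1)// lerD2l ler_nat.
- exact: measurable_itv.
- by apply/measurable_EFinP; exact: measurable_powRx.
- by rewrite lee_fin powR_ge0.
- rewrite integral_powR_itv ?lt_eqF//; last by rewrite c0 ltrDl ltr0n.
  rewrite lee_fin -[X in (X / _ <= _)%R]opprB mulNr -mulrN -invrN ler_pM2r ?invr_gt0//.
  by rewrite lerBlDr lerDl powR_ge0.
Qed.

(** Split at [x = d]: below, [(d + x) ^ (- a) <= d ^ (- a)] and [s > 0] gives convergence at 0;
    above, [(d + x) ^ (- a) <= x ^ (- a)] and [s < a] gives convergence at infinity. Both parts
    scale like [d ^ (s - a)]. *)
Lemma beta_type_integral_le s a : (0 < s < a)%R -> exists C : R, (0 < C)%R /\ forall d, (0 < d)%R ->
  \int[leb]_(x in `]0%R, +oo[) (x `^ (s - 1) * (d + x) `^ (- a))%:E <= (C * d `^ (s - a))%:E.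
Proof.
move=> /andP[s0 sa]; pose C := (s^-1 + (a - s)^-1)%R.
have C1 : (0 < s^-1)%R by rewrite invr_gt0.
have C2 : (0 < (a - s)^-1)%R by rewrite invr_gt0 subr_gt0.
exists C; split; first exact: addr_gt0.
move=> d d0; have a0 : (0 < a)%R by exact: lt_trans sa.
have antitone x y : (0 < x)%R -> (x <= y)%R -> (y `^ (- a) <= x `^ (- a))%R.
  move=> x0 xy; rewrite !powRN lef_pV2 ?posrE ?powR_gt0//; last exact: lt_le_trans xy.
  apply: ge0_ler_powR; rewrite ?nnegrE ?(ltW a0)// ltW//; exact: lt_le_trans xy.
have -> : `]0%R, +oo[%classic = `]0%R, d]%classic `|` `]d, +oo[%classic :> set mR.
  apply/seteqP; split => x /=; rewrite !in_itv/= ?andbT.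
    by move=> ->; have [|] := leP x d; [left|right].
  by move=> [/andP[]//|]; exact: lt_trans.
have mi : measurable_fun setT (fun x : mR => (x `^ (s - 1) * (d + x) `^ (- a))%:E).
  apply/measurable_EFinP; apply: measurable_funM; first exact: measurable_powRx.
  by apply: (measurableT_comp (measurable_powR _)); exact: measurable_funD.
rewrite ge0_integral_setU//=; last 3 first.
- exact: measurable_funTS.
- by move=> x _; rewrite lee_fin mulr_ge0 ?powR_ge0.
- by apply/disj_setPS => x /= []; rewrite !in_itv/= andbT => /andP[_ /le_lt_trans h] /h; rewrite ltxx.
rewrite /C mulrDl EFinD; apply: leeD.
  apply: (@le_trans _ _ (\int[leb]_(x in `]0%R, d]) ((d `^ (- a))%:E * (x `^ (s - 1))%:E))).
    apply: le_integral_nonneg => x; first by rewrite lee_fin mulr_ge0 ?powR_ge0.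
    rewrite /= in_itv/= => /andP[x0 xd]; rewrite -EFinM lee_fin mulrC.
    by apply: ler_wpM2r; [exact: powR_ge0|apply: antitone => //; rewrite lerDl ltW].
  rewrite ge0_integralZl//; last 3 first.
  - by apply/measurable_EFinP; exact: measurable_powRx.
  - by move=> x _; rewrite lee_fin powR_ge0.
  - by rewrite lee_fin powR_ge0.
  have sm : (-1 < s - 1)%R by lra.
  rewrite (le_trans (lee_wpmul2l _ (integral_powR0_le sm d0))) ?lee_fin ?powR_ge0//.
  rewrite subrK powRD ?(gt_eqF d0) ?implybT// le_eqVlt; apply/orP; left.
  by apply/eqP; ring.
apply: (@le_trans _ _ (\int[leb]_(x in `[d, +oo[) (x `^ (s - 1 - a))%:E)).
  apply: (@le_trans _ _ (\int[leb]_(x in `]d, +oo[) (x `^ (s - 1 - a))%:E)).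
    apply: le_integral_nonneg => x; first by rewrite lee_fin mulr_ge0 ?powR_ge0.
    rewrite /= in_itv/= andbT => dx; have x0 : (0 < x)%R by exact: lt_trans dx.
    rewrite lee_fin (powRD (r := s - 1) (s := - a)) ?(gt_eqF x0) ?implybT//.
    by apply: ler_wpM2l; [exact: powR_ge0|apply: antitone => //; rewrite lerDr ltW].
  apply: ge0_subset_integral => //.
  - by apply/measurable_EFinP; exact: measurable_powRx.
  - by move=> x _; rewrite lee_fin powR_ge0.
  - by move=> x /=; rewrite !in_itv/= !andbT; exact: ltW.
have sa1 : (s - 1 - a < -1)%R by lra.
rewrite (le_trans (integral_powRoo_le sa1 d0))// lee_fin.
have -> : (s - 1 - a + 1 = s - a)%R by ring.
by rewrite opprB mulrC.
Qed.

Lemma integral_powR_affine_le k a b d (D : set mR) : (-1 < k)%R -> (0 < d)%R -> (`|b| = 1)%R ->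
  measurable D -> (forall u, D u -> 0 < a + b * u <= d)%R ->
  \int[leb]_(u in D) ((a + b * u) `^ k)%:E <= (d `^ (k + 1) / (k + 1))%:E.
Proof.
move=> k1 d0 b1 mD H.
have b0 : b != 0%R by rewrite -normr_gt0 b1.
pose h (x : mR) : \bar R := ((fun x : mR => (x `^ k)%:E) \_ `]0%R, d]) x.
have h0 x : 0 <= h x by rewrite /h patchE; case: ifP => // _; rewrite lee_fin powR_ge0.
have mh : measurable_fun setT h.
  apply/(measurable_restrictT (fun x : mR => (x `^ k)%:E)); first exact: measurable_itv.
  by apply/measurable_EFinP; exact: measurable_powRx.
rewrite (le_trans _ (integral_powR0_le k1 d0))// [leRHS]integral_mkcond -/h.
rewrite -[leRHS]mul1e -[in leRHS](invr1) -b1 -(integral_affine a b0 mh h0) [leLHS]integral_mkcond.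
apply: le_integral_nonneg => u _; rewrite patchE; case: ifPn => // /[!inE] Du; rewrite ?lee_fin ?powR_ge0//.
by rewrite /h patchE mem_set//= in_itv/=; exact: H.
Qed.

(** Split at the midpoint of []r, 1[]: on each half one of the two factors is comparable to a power
    of [1 - r], and the other is integrated as a pure power. *)
Lemma beta_integral_le k s : (-1 < k)%R -> (0 < s)%R -> exists C : R, (0 < C)%R /\ forall r, (r < 1)%R ->
  \int[leb]_(u in `]r, 1%R[) ((u - r) `^ k * (1 - u) `^ (s - 1))%:E <= (C * (1 - r) `^ (k + s))%:E.
Proof.
move=> k1 s0; pose A := (2 `^ `|s - 1|)%R; pose B := (2 `^ `|k|)%R.
have A0 : (0 < A)%R by rewrite powR_gt0. have B0 : (0 < B)%R by rewrite powR_gt0.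
have k10 : (0 < k + 1)%R by lra.
exists (A / (k + 1) + B / s)%R; split; first by rewrite addr_gt0// divr_gt0.
move=> r r1; pose d := (1 - r)%R; have d0 : (0 < d)%R by rewrite subr_gt0.
have mf (a b e : R) (D : set mR) : measurable_fun D (fun u : mR => ((a + b * u) `^ e)%:E).
  apply: measurable_funTS; apply/measurable_EFinP; apply: (measurableT_comp (measurable_powR _)).
  by apply: measurable_funD => //; exact: measurable_funM.
apply: (@le_trans _ _ (\int[leb]_(u in `]r, 1%R[)
  ((A * d `^ (s - 1))%:E * ((- r + 1 * u) `^ k)%:E + (B * d `^ k)%:E * ((1 + -1 * u) `^ (s - 1))%:E))).
  apply: le_integral_nonneg => u; first by rewrite lee_fin mulr_ge0 ?powR_ge0.
  rewrite /= in_itv/= => /andP[ru u1].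
  have -> : (- r + 1 * u = u - r)%R by ring.
  have -> : (1 + -1 * u = 1 - u)%R by ring.
  rewrite -!EFinM -EFinD lee_fin.
  have [h|h] := leP (u - r)%R (d / 2)%R.
    rewrite -[leLHS]addr0; apply: lerD; last by rewrite !mulr_ge0 ?powR_ge0.
    rewrite mulrC; apply: ler_wpM2r; first exact: powR_ge0.
    by apply: powR_comparable => //; rewrite /d in d0 h *; lra.
  rewrite -[leLHS]add0r; apply: lerD; first by rewrite !mulr_ge0 ?powR_ge0.
  apply: ler_wpM2r; first exact: powR_ge0.
  by apply: powR_comparable => //; rewrite /d in d0 h *; lra.
rewrite ge0_integralD//; last 4 first.
- by move=> u _; rewrite -EFinM lee_fin !mulr_ge0 ?powR_ge0.
- exact: measurable_funeM.
- by move=> u _; rewrite -EFinM lee_fin !mulr_ge0 ?powR_ge0.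
- exact: measurable_funeM.
rewrite !ge0_integralZl//; last 4 first.
- by move=> u _; rewrite lee_fin powR_ge0.
- by rewrite lee_fin mulr_ge0 ?powR_ge0.
- by move=> u _; rewrite lee_fin powR_ge0.
- by rewrite lee_fin mulr_ge0 ?powR_ge0.
have I1 : \int[leb]_(u in `]r, 1%R[) ((- r + 1 * u) `^ k)%:E <= (d `^ (k + 1) / (k + 1))%:E.
  apply: integral_powR_affine_le => //; first by rewrite normr1.
  by move=> u /=; rewrite in_itv/= /d => /andP[? ?]; apply/andP; split; lra.
have sm : (-1 < s - 1)%R by lra.
have I2 : \int[leb]_(u in `]r, 1%R[) ((1 + -1 * u) `^ (s - 1))%:E <= (d `^ s / s)%:E.
  rewrite -{2 3}(subrK 1%R s); apply: integral_powR_affine_le => //; first by rewrite normrN1.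
  by move=> u /=; rewrite in_itv/= /d => /andP[? ?]; apply/andP; split; lra.
apply: (@le_trans _ _ ((A * d `^ (s - 1))%:E * (d `^ (k + 1) / (k + 1))%:E + (B * d `^ k)%:E * (d `^ s / s)%:E)).
  by apply: leeD; apply: lee_wpmul2l => //; rewrite lee_fin mulr_ge0 ?powR_ge0.
rewrite -!EFinM -EFinD lee_fin -/d le_eqVlt; apply/orP; left; apply/eqP.
have e1 : (d `^ (k + s) = d `^ k * d `^ s)%R by rewrite powRD// (gt_eqF d0) implybT.
have e2 : (d `^ (k + s) = d `^ (s - 1) * d `^ (k + 1))%R.
  by rewrite -powRD ?(gt_eqF d0) ?implybT//; congr (_ `^ _)%R; ring.
by rewrite mulrDl {1}e2 e1; field; rewrite (gt_eqF s0) (gt_eqF k10).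
Qed.

End PowerIntegrals.

(** * From a Carleson measure to a power density *)

Section Smoothing.
Context {R : realType} (mu : {finite_measure set (measurableTypeR R) -> \bar R}).
Local Notation mR := (measurableTypeR R).
Local Notation leb := (@lebesgue_measure R).
Local Open Scope ereal_scope.

(* Averaging over J_t = [(1 + t) / 2, (3 + t) / 4], of length (1 - t) / 4, replaces
   mu by a density: u in J_t forces t >= 4 u - 3 and 1 - t >= 2 (1 - u). *)
Lemma carleson_smoothing (C s : R) (k : R -> \bar R) (K : mR -> \bar R) :
  (0 < C)%R -> (forall r : R, (r < 1)%R -> mu `[r, 1%R[%classic <= (C * (1 - r) `^ s)%:E) ->
  measurable_fun setT K -> (forall u, 0 <= K u) ->
  (forall t, (0 <= t < 1)%R -> 0 <= k t) ->
  (forall t u, (0 <= t < 1)%R -> ((1 + t) / 2 <= u <= (3 + t) / 4)%R -> k t <= K u) ->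
  \int[mu]_(t in `[0%R, 1%R[) k t <=
    (2 * C * 4 `^ s)%:E * \int[leb]_(u in `[(1 / 2)%R, 1%R[) (K u * ((1 - u) `^ (s - 1))%:E).
Proof.
move=> C0 HC mK K0 k0 kK.
pose J (w : mR * mR) : bool := [&& (0 <= w.1)%R, (w.1 < 1)%R, ((1 + w.1) / 2 <= w.2)%R & (w.2 <= (3 + w.1) / 4)%R].
pose Phi (w : mR * mR) : \bar R := if J w then (4 * (1 - w.1) `^ (-1))%:E * K w.2 else 0.
have mJ : measurable_fun setT J.
  apply: measurable_and; first exact: measurable_fun_ler.
  apply: measurable_and; first exact: measurable_fun_ltr.
  apply: measurable_and; apply: measurable_fun_ler => //; apply: measurable_funM => //; exact: measurable_funD.
have Phi0 w : 0 <= Phi w.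
  by rewrite /Phi; case: ifP => // _; rewrite mule_ge0// lee_fin mulr_ge0// powR_ge0.
have mPhi : measurable_fun setT Phi.
  apply: measurable_fun_ifT => //; apply: emeasurable_funM.
    apply/measurable_EFinP; apply: measurable_funM => //.
    by apply: (measurableT_comp (measurable_powR _)); exact: measurable_funB.
  exact: measurableT_comp.
have step1 t : (0 <= t < 1)%R -> k t <= \int[leb]_u Phi (t, u).
  move=> /andP[t0 t1]; have tt : (0 <= t < 1)%R by rewrite t0.
  have t2 : (0 < 1 - t)%R by rewrite subr_gt0.
  have mI : measurable (`[((1 + t) / 2)%R, ((3 + t) / 4)%R]%classic : set mR) by exact: measurable_itv.
  apply: (@le_trans _ _ (\int[leb]_(u in `[((1 + t) / 2)%R, ((3 + t) / 4)%R]) cst ((4 * (1 - t) `^ (-1))%:E * k t) u)).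
    rewrite integral_cst//.
    have lJ : leb `[((1 + t) / 2)%R, ((3 + t) / 4)%R] = ((1 - t) / 4)%:E.
      rewrite lebesgue_measure_itv/= lte_fin ifT; last by lra.
      by rewrite -EFinD; congr (_%:E); field.
    rewrite [X in _ * X]lJ muleAC -EFinM powR_inv1 ?(ltW t2)//.
    have -> : (4 / (1 - t) * ((1 - t) / 4) = 1)%R by field; rewrite gt_eqF.
    by rewrite mul1e.
  rewrite integral_mkcond; apply: le_integral_nonneg => u _; rewrite patchE; case: ifPn => //.
    by rewrite inE /= => _; rewrite mule_ge0 ?k0// lee_fin mulr_ge0 ?powR_ge0.
  rewrite inE /= in_itv/= => uJ; rewrite /Phi /J /= t0 t1 /= uJ.
  by apply: lee_wpmul2l; [rewrite lee_fin mulr_ge0 ?powR_ge0|exact: kK].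
have step2 u : \int[mu]_t Phi (t, u) <= (2 * C * 4 `^ s)%:E *
    ((fun u => K u * ((1 - u) `^ (s - 1))%:E) \_ `[(1 / 2)%R, 1%R[) u.
  rewrite patchE; case: ifPn => [/[!inE]/=|/negP uI]; last first.
    rewrite mule0 integral0_eq// => t _; rewrite /Phi /J /=; case: ifP => // /and4P[t0 t1 u1 u2].
    by exfalso; apply: uI; apply/mem_set => /=; rewrite in_itv/=; apply/andP; split; lra.
  rewrite in_itv/= => /andP[u0 u1]; have u2 : (0 < 1 - u)%R by rewrite subr_gt0.
  apply: (@le_trans _ _ (\int[mu]_(t in `[(4 * u - 3)%R, 1%R[) cst ((2 * (1 - u) `^ (-1))%:E * K u) t)).
    rewrite [leRHS]integral_mkcond; apply: le_integral_nonneg => t _ //.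
    rewrite patchE /Phi; case: ifP => [/and4P/=[t0 t1 v1 v2]|_]; last first.
      by case: ifP => // _; rewrite mule_ge0// lee_fin mulr_ge0 ?powR_ge0.
    rewrite ifT; last by apply/mem_set; rewrite /= in_itv/= t1 andbT; lra.
    have t2 : (0 < 1 - t)%R by rewrite subr_gt0.
    apply: lee_wpmul2r => //; rewrite lee_fin (powR_inv1 (ltW t2)) (powR_inv1 (ltW u2)).
    by rewrite ler_pdivrMr// mulrAC ler_pdivlMr//; lra.
  rewrite integral_cst; last exact: measurable_itv.
  have h := HC (4 * u - 3)%R (ltac:(lra)).
  apply: (@le_trans _ _ ((2 * (1 - u) `^ (-1))%:E * K u * (C * (4 * (1 - u)) `^ s)%:E)).
    apply: lee_wpmul2l; first by rewrite mule_ge0// lee_fin mulr_ge0 ?powR_ge0.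
    by rewrite (le_trans h)// lee_fin (_ : 1 - (4 * u - 3) = 4 * (1 - u))%R//; ring.
  rewrite muleAC -EFinM muleCA -EFinM muleC; apply: lee_wpmul2l => //.
  rewrite lee_fin powRM ?(ltW u2)// powRD ?(gt_eqF u2) ?implybT//.
  by rewrite le_eqVlt; apply/orP; left; apply/eqP; ring.
apply: (@le_trans _ _ (\int[mu]_t \int[leb]_u Phi (t, u))).
  rewrite integral_mkcond; apply: le_integral_nonneg => t _; rewrite patchE; case: ifPn => //.
  - by rewrite inE /= in_itv/=; exact: k0.
  - by rewrite inE /= in_itv/=; exact: step1.
  - by move=> _; apply: integral_ge0.
rewrite (@fubini_tonelli _ _ mR mR R mu leb Phi mPhi Phi0) [in leRHS]integral_mkcond.
rewrite -ge0_integralZl//.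
- by apply: le_integral_nonneg => u _; [exact: integral_ge0|exact: step2].
- apply/(measurable_restrictT (fun u : mR => K u * ((1 - u) `^ (s - 1))%:E)); first exact: measurable_itv.
  apply: measurable_funTS; apply: emeasurable_funM => //; apply/measurable_EFinP.
  by apply: (measurableT_comp (measurable_powR _)); exact: measurable_funB.
- by move=> u _; rewrite patchE; case: ifP => // _; rewrite mule_ge0// lee_fin powR_ge0.
- by rewrite lee_fin !mulr_ge0 ?powR_ge0// ltW.
Qed.

End Smoothing.

(** * Tonelli's theorem on products with the plane *)

Section PlaneMeasure.
Context {R : realType}.
Local Notation mR := (measurableTypeR R).
Local Notation leb := (@lebesgue_measure R).
Local Open Scope ereal_scope.

(** A name for the product measure, to which the sigma-finite structure required by Tonelli on
    products with the plane is attached. *)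
Definition plane : set (mR * mR) -> \bar R := (leb \x leb)%E.

HB.instance Definition _ := Measure.on plane.

Let plane_sigma_finite : sigma_finite setT plane.
Proof.
pose I (n : nat) : set mR := `[(- n%:R)%R, n%:R%R]%classic.
have mI n : measurable (I n) by exact: measurable_itv.
exists (fun n => I n `*` I n) => [|n].
  apply/seteqP; split => // -[x y] _; exists (Num.truncn (Num.max `|x| `|y|)%R).+1 => //.
  have := truncnS_gt (Num.max `|x| `|y|)%R; rewrite gt_max => /andP[/ltW hx /ltW hy].
  by split; rewrite /I /= in_itv/= -ler_norml.
split; first exact: measurableX.
have -> : plane (I n `*` I n) = leb (I n) * leb (I n) by exact: product_measure1E.
have lI : leb (I n) < +oo by rewrite /I lebesgue_measure_itv/=; case: ifP => _; rewrite -?EFinD ltry.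
by rewrite lte_mul_pinfty// ge0_fin_numE.
Qed.

HB.instance Definition _ := Measure_isSigmaFinite.Build _ _ _ plane plane_sigma_finite.

Lemma plane_tonelli (h : (mR * mR) * mR -> \bar R) :
  measurable_fun setT h -> (forall x, 0 <= h x) ->
  \int[(leb \x leb)%E]_w \int[leb]_u h (w, u) = \int[leb]_u \int[(leb \x leb)%E]_w h (w, u).
Proof. by move=> mh h0; exact: (@fubini_tonelli _ _ _ _ R plane leb h mh h0). Qed.

Lemma measurable_plane_slice (h : (mR * mR) * mR -> \bar R) :
  measurable_fun setT h -> (forall x, 0 <= h x) ->
  measurable_fun setT (fun u => \int[(leb \x leb)%E]_w h (w, u)).
Proof. by move=> mh h0; exact: (@measurable_fun_fubini_tonelli_G _ _ _ _ R plane h mh h0). Qed.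

Lemma plane_tonelli2 (h : (mR * mR) * (mR * mR) -> \bar R) :
  measurable_fun setT h -> (forall x, 0 <= h x) ->
  \int[(leb \x leb)%E]_w \int[(leb \x leb)%E]_v h (w, v) =
  \int[(leb \x leb)%E]_v \int[(leb \x leb)%E]_w h (w, v).
Proof. by move=> mh h0; exact: (@fubini_tonelli _ _ _ _ R plane plane h mh h0). Qed.

Lemma measurable_plane_slice2 (h : (mR * mR) * (mR * mR) -> \bar R) :
  measurable_fun setT h -> (forall x, 0 <= h x) ->
  measurable_fun setT (fun w => \int[(leb \x leb)%E]_v h (w, v)).
Proof. by move=> mh h0; exact: (@measurable_fun_fubini_tonelli_F _ _ _ _ R plane h mh h0). Qed.

End PlaneMeasure.

(** * Averages over dilations *)

Section PlaneAverages.
Context {R : realType}.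
Local Notation mR := (measurableTypeR R).
Local Notation leb := (@lebesgue_measure R).
Local Notation pl := (leb \x leb)%E.
Implicit Types (f g : R[i] -> R[i]) (p alpha : R) (v w : mR * mR).
Local Open Scope ereal_scope.

Lemma ge0_integralZ d (T : measurableType d) (mu : {measure set T -> \bar R}) (h : T -> \bar R) (c : R) :
  (0 <= c)%R -> measurable_fun setT h -> (forall x, 0 <= h x) ->
  \int[mu]_x (c%:E * h x) = c%:E * \int[mu]_x h x.
Proof. by move=> c0 mh h0; apply: ge0_integralZl => //; rewrite lee_fin. Qed.

Definition smul (u : R) w : mR * mR := ((u * w.1)%R, (u * w.2)%R).

Lemma cpt_smul u w : cpt (smul u w) = (u%:C * cpt w)%R.
Proof. by rewrite /cpt /smul /=; apply/eqP; rewrite eq_complex/= !mul0r subr0 addr0 !eqxx. Qed.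

Lemma normc_smul u w : normc (cpt (smul u w)) = (`|u| * normc (cpt w))%R.
Proof. by rewrite cpt_smul normcMr. Qed.

Lemma measurable_smul : measurable_fun setT (fun x : (mR * mR) * mR => smul x.2 x.1).
Proof.
apply/measurable_fun_pairP; split; apply: measurable_funM => //;
  by apply: measurableT_comp => //; exact: measurable_fst.
Qed.

Lemma plane_scale u (h : mR * mR -> \bar R) : (0 < u)%R -> measurable_fun setT h ->
  (forall w, 0 <= h w) -> \int[pl]_w h (smul u w) = (u^-1 ^+ 2)%:E * \int[pl]_w h w.
Proof.
move=> u0 mh h0; have un : u != 0%R by rewrite gt_eqF.
have ms : measurable_fun setT (smul u : mR * mR -> mR * mR).
  by apply/measurable_fun_pairP; split; apply: measurable_funM.
have mhs : measurable_fun setT (fun w => h (smul u w)) by exact: measurableT_comp.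
have hs0 w : 0 <= h (smul u w) by [].
rewrite (@fubini_tonelli1 _ _ mR mR R leb leb _ mhs hs0).
rewrite (@fubini_tonelli1 _ _ mR mR R leb leb _ mh h0) /fubini_F.
have mF := @measurable_fun_fubini_tonelli_F _ _ mR mR R leb _ mh h0.
have F0 x : 0 <= fubini_F leb h x by exact: integral_ge0.
have inner (x : mR) : \int[leb]_y h (smul u (x, y)) = (u^-1)%:E * fubini_F leb h (u * x)%R.
  have mhx : measurable_fun setT (fun y : mR => h ((u * x)%R, y)).
    by apply: (measurableT_comp mh); exact: pair1_measurable.
  have := integral_affine 0 un mhx (fun y => h0 _); rewrite (gtr0_norm u0) /fubini_F => <-.
  by apply: eq_integral => y _; rewrite add0r.
under eq_integral do rewrite inner.
have mFu : measurable_fun setT (fun x : mR => fubini_F leb h (u * x)%R).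
  by apply: (measurableT_comp mF); exact: measurable_funM.
have u0' : (0 <= u^-1)%R by rewrite invr_ge0 ltW.
rewrite (ge0_integralZ leb u0' mFu (fun x => F0 _)).
have -> : \int[leb]_x fubini_F leb h (u * x)%R = (u^-1)%:E * \int[leb]_x fubini_F leb h x.
  have := integral_affine 0 un mF F0; rewrite (gtr0_norm u0) => <-.
  by apply: eq_integral => y _; rewrite add0r.
by rewrite muleA -EFinM expr2.
Qed.

(** For fixed [u] the dilation moves [u] from the argument of [g] into the weight, at the cost of
    [u ^ (- 2) <= 4]. Exchanging the integrals leaves, for each point, a beta integral in [u] worth
    [delta w ^ (kappa + s)]. *)
Lemma radial_average kappa s : (-1 < kappa)%R -> (0 < s)%R -> exists C : R, (0 < C)%R /\
  forall g : mR * mR -> \bar R, measurable_fun setT g -> (forall w, 0 <= g w) ->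
  \int[pl]_w \int[leb]_u (if (0 < delta w)%R && ((1 / 2 <= u)%R && (u < 1)%R)
      then (delta w `^ kappa * (1 - u) `^ (s - 1))%:E * g (smul u w) else 0) <=
  C%:E * \int[pl]_w ((delta w `^ (kappa + s))%:E * g w).
Proof.
move=> k1 s0; have [C [C0 HC]] := beta_integral_le k1 s0.
pose B := (2 `^ `|kappa|)%R; have B0 : (0 < B)%R by rewrite powR_gt0.
exists (4 * (B * C))%R; split; first by rewrite !mulr_gt0.
move=> g mg g0.
pose Phi (x : (mR * mR) * mR) : \bar R := if (0 < delta x.1)%R && ((1 / 2 <= x.2)%R && (x.2 < 1)%R)
  then (delta x.1 `^ kappa * (1 - x.2) `^ (s - 1))%:E * g (smul x.2 x.1) else 0.
have md1 : measurable_fun setT (fun x : (mR * mR) * mR => delta x.1).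
  by apply: (measurableT_comp measurable_delta); exact: measurable_fst.
have m1 : measurable_fun setT (fun x : (mR * mR) * mR => ((1 - x.2) `^ (s - 1))%R).
  by apply: (measurableT_comp (measurable_powR _)); exact: measurable_funB.
have mPhi : measurable_fun setT Phi.
  apply: measurable_fun_ifT => //.
    apply: measurable_and; first exact: measurable_fun_ltr.
    by apply: measurable_and; [exact: measurable_fun_ler|exact: measurable_fun_ltr].
  apply: emeasurable_funM.
    apply/measurable_EFinP; apply: measurable_funM => //.
    exact: (measurableT_comp (measurable_powR _)).
  apply: (measurableT_comp mg).
  exact: measurable_smul.
have Phi0 x : 0 <= Phi x.
  by rewrite /Phi; case: ifP => // _; rewrite mule_ge0// lee_fin mulr_ge0 ?powR_ge0.
(* [Phi] in the variable [smul u w]. As [u * delta w = u - (1 - delta (smul u w))], the factor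
   [delta w] turns, up to a factor between [1 / 2] and 1, into [u] minus the modulus of the new
   point. *)
pose Theta (x : (mR * mR) * mR) : \bar R := if (1 - delta x.1 < x.2)%R && (x.2 < 1)%R
  then ((x.2 - (1 - delta x.1)) `^ kappa * (1 - x.2) `^ (s - 1))%:E * g x.1 else 0.
have mTheta : measurable_fun setT Theta.
  apply: measurable_fun_ifT => //.
    by apply: measurable_and; apply: measurable_fun_ltr => //; exact: measurable_funB.
  apply: emeasurable_funM; last by apply: (measurableT_comp mg); exact: measurable_fst.
  apply/measurable_EFinP; apply: measurable_funM => //.
  apply: (measurableT_comp (measurable_powR _)).
  by apply: measurable_funB => //; exact: measurable_funB.
have Theta0 x : 0 <= Theta x.
  by rewrite /Theta; case: ifP => // _; rewrite mule_ge0// lee_fin mulr_ge0 ?powR_ge0.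
have mThetau (u : mR) : measurable_fun setT (fun w => Theta (w, u)).
  by apply: (measurableT_comp mTheta); exact: pair2_measurable.
have slice (u : mR) : \int[pl]_w Phi (w, u) <= (4 * B)%:E * \int[pl]_w Theta (w, u).
  have [u12|u12] := boolP ((1 / 2 <= u)%R && (u < 1)%R); last first.
    rewrite integral0_eq ?mule_ge0 ?lee_fin ?mulr_ge0 ?(ltW B0)//; first exact: integral_ge0.
    by move=> w _; rewrite /Phi/= (negbTE u12) andbF.
  have /andP[u1 u2] := u12; have u0 : (0 < u)%R by lra.
  have mTs : measurable_fun setT (fun w => Theta (smul u w, u)).
    apply: (measurableT_comp (mThetau u)).
    by apply/measurable_fun_pairP; split; apply: measurable_funM.
  apply: (@le_trans _ _ (B%:E * \int[pl]_w Theta (smul u w, u))).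
    rewrite -ge0_integralZl//; last by rewrite lee_fin ltW.
    apply: le_integral_nonneg => w _ //; rewrite /Phi/= u12 andbT; case: ifP => dw; last first.
      by rewrite mule_ge0// lee_fin ltW.
    have dE : (u - (1 - delta (smul u w)) = u * delta w)%R.
      by rewrite /delta normc_smul gtr0_norm//; ring.
    have ud : (0 < u * delta w)%R by rewrite mulr_gt0.
    rewrite /Theta/= -[(_ < u)%R]subr_gt0 dE ud u2 /= muleA -EFinM; apply: lee_wpmul2r => //.
    rewrite lee_fin mulrA; apply: ler_wpM2r; first exact: powR_ge0.
    have ud1 : (u * delta w <= delta w)%R by rewrite ler_piMl// ltW.
    have ud2 : (1 / 2 * delta w <= u * delta w)%R by rewrite ler_pM2r.
    by apply: powR_comparable => //; move: (u * delta w)%R ud ud1 ud2 => t; clear; lra.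
  rewrite [X in _ * X](plane_scale u0 (mThetau u) (fun w => Theta0 _)) muleA -EFinM; apply: lee_wpmul2r; first exact: integral_ge0.
  rewrite lee_fin mulrC; apply: ler_wpM2r; first exact: ltW.
  rewrite exprVn -[leRHS]invrK lef_pV2 ?posrE ?exprn_gt0//.
  by rewrite (_ : 4^-1 = (1 / 2) ^+ 2)%R; [apply: lerXn2r; rewrite ?nnegrE//; lra|field].
have radial w : \int[leb]_u Theta (w, u) <= C%:E * ((delta w `^ (kappa + s))%:E * g w).
  have dl : (delta w <= 1)%R by rewrite /delta gerBl normc_ge0.
  have [dw|dw] := ltP 0%R (delta w); last first.
    rewrite integral0_eq ?mule_ge0 ?lee_fin ?powR_ge0 ?(ltW C0)//.
    move=> u _; rewrite /Theta /=; case: ifP => // /andP[a1 a2]; exfalso; lra.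
  apply: (@le_trans _ _ (\int[leb]_(u in `](1 - delta w)%R, 1%R[)
     (g w * ((u - (1 - delta w)) `^ kappa * (1 - u) `^ (s - 1))%:E))).
    rewrite [leRHS]integral_mkcond; apply: le_integral_nonneg => u _ //.
    rewrite patchE /Theta/=; case: ifPn => [h|_]; last first.
      by case: ifP => // _; rewrite mule_ge0// lee_fin mulr_ge0 ?powR_ge0.
    by rewrite ifT 1?muleC// inE /= in_itv.
  have mi : measurable_fun (`](1 - delta w)%R, 1%R[%classic : set mR)
      (fun u : mR => ((u - (1 - delta w)) `^ kappa * (1 - u) `^ (s - 1))%:E).
    apply: measurable_funTS; apply/measurable_EFinP; apply: measurable_funM;
      by apply: (measurableT_comp (measurable_powR _)); exact: measurable_funB.
  rewrite ge0_integralZl//; last by move=> u _; rewrite lee_fin mulr_ge0 ?powR_ge0.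
  rewrite muleC muleA -EFinM; apply: lee_wpmul2r => //.
  have d1 : (1 - delta w < 1)%R by lra.
  by rewrite (le_trans (HC _ d1))// lee_fin (_ : 1 - (1 - delta w) = delta w)%R//; ring.
have EPhi : \int[pl]_w \int[leb]_u Phi (w, u) = \int[leb]_u \int[pl]_w Phi (w, u).
  exact: plane_tonelli.
have ETheta : \int[pl]_w \int[leb]_u Theta (w, u) = \int[leb]_u \int[pl]_w Theta (w, u).
  exact: plane_tonelli.
have mG : measurable_fun setT (fun u => \int[pl]_w Theta (w, u)).
  exact: measurable_plane_slice.
rewrite [leLHS]EPhi.
apply: (@le_trans _ _ (\int[leb]_u ((4 * B)%:E * \int[pl]_w Theta (w, u)))).
  by apply: le_integral_nonneg => u _; [exact: integral_ge0|exact: slice].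
rewrite (ge0_integralZ leb _ mG)//; last 2 first.
- by rewrite mulr_ge0// ltW.
- by move=> u; exact: integral_ge0.
rewrite -ETheta.
rewrite mulrA [X in _ <= X * _]EFinM -muleA; apply: lee_wpmul2l; first by rewrite lee_fin mulr_ge0// ltW.
rewrite -(ge0_integralZ pl (ltW C0)); last 2 first.
- apply: emeasurable_funM => //; apply/measurable_EFinP.
  exact: (measurableT_comp (measurable_powR _) measurable_delta).
- by move=> w; rewrite mule_ge0// lee_fin powR_ge0.
by apply: le_integral_nonneg => w _; [exact: integral_ge0|exact: radial].
Qed.

End PlaneAverages.

(** * Means that dominate a whole family of dilates *)

Section HullAverage.
Context {R : realType}.
Local Notation mR := (measurableTypeR R).
Local Notation leb := (@lebesgue_measure R).
Local Notation pl := (leb \x leb)%E.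
Implicit Types (f g : R[i] -> R[i]) (p alpha : R) (v w zeta : mR * mR).
Local Open Scope ereal_scope.

(* For zeta = u w with u in J_t (see [carleson_smoothing]), the hull of zeta
   contains the square about t w on which [submean_pow] is applied. *)
Definition hull zeta v : bool :=
  [&& (0 < delta zeta)%R, in_square zeta (5 * delta zeta) v,
      (delta zeta <= 2 * delta v)%R & (delta v <= 6 * delta zeta)%R].

Definition hull_kernel p f (x : (mR * mR) * (mR * mR)) : R :=
  if hull x.1 x.2 then on_disc (fun v => normc (f (cpt v)) `^ p)%R x.2 else 0%R.

Definition hull_mean p f zeta : \bar R :=
  (delta zeta `^ (- 2))%:E * \int[pl]_v (hull_kernel p f (zeta, v))%:E.

Lemma hull_kernel_ge0 p f x : (0 <= hull_kernel p f x)%R.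
Proof.
by rewrite /hull_kernel; case: ifP => // _; apply: on_disc_ge0 => w _; exact: powR_ge0.
Qed.

Lemma hull_mean_ge0 p f zeta : 0 <= hull_mean p f zeta.
Proof.
rewrite /hull_mean mule_ge0 ?lee_fin ?powR_ge0//.
by apply: integral_ge0 => v _; rewrite lee_fin hull_kernel_ge0.
Qed.

Lemma hull_mean_out p f zeta : (delta zeta <= 0)%R -> hull_mean p f zeta = 0.
Proof.
move=> dz; rewrite /hull_mean; have -> : \int[pl]_v (hull_kernel p f (zeta, v))%:E = 0.
  by apply: integral0_eq => v _; rewrite /hull_kernel /hull /= ltNge dz.
by rewrite mule0.
Qed.

Lemma measurable_hull_kernel p f : analytic_on_disc f ->
  measurable_fun setT (hull_kernel p f).
Proof.
move=> af.
have d1 : measurable_fun setT (fun x : (mR * mR) * (mR * mR) => delta x.1).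
  by apply: (measurableT_comp measurable_delta); exact: measurable_fst.
have d2 : measurable_fun setT (fun x : (mR * mR) * (mR * mR) => delta x.2).
  by apply: (measurableT_comp measurable_delta); exact: measurable_snd.
have c (i j : mR * mR -> mR) : measurable_fun setT i -> measurable_fun setT j ->
    measurable_fun setT (fun x : (mR * mR) * (mR * mR) => `|i x.2 - j x.1|%R <= 5 * delta x.1)%R.
  move=> mi mj; apply: measurable_fun_ler; last exact: measurable_funM.
  apply: measurableT_comp => //; apply: measurable_funB.
    by apply: (measurableT_comp mi); exact: measurable_snd.
  by apply: (measurableT_comp mj); exact: measurable_fst.
apply: measurable_fun_ifT => //.
  apply: measurable_and; first exact: measurable_fun_ltr.
  apply: measurable_and.
    by apply: measurable_and; apply: c; [exact: measurable_fst|exact: measurable_fst|exact: measurable_snd|exact: measurable_snd].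
  by apply: measurable_and; apply: measurable_fun_ler => //; exact: measurable_funM.
have mo : measurable_fun setT (on_disc (fun v => normc (f (cpt v)) `^ p)%R).
  by apply: measurable_on_disc; exact: measurable_normc_powR.
by apply: (measurableT_comp mo); exact: measurable_snd.
Qed.

Lemma measurable_hull_mean p f : analytic_on_disc f -> measurable_fun setT (hull_mean p f).
Proof.
move=> af; apply: emeasurable_funM.
  by apply/measurable_EFinP; exact: measurable_delta_powR.
apply: (@measurable_plane_slice2 R (EFin \o hull_kernel p f)) => [|x].
  by apply/measurable_EFinP; exact: measurable_hull_kernel.
by rewrite lee_fin hull_kernel_ge0.
Qed.

(** The condition on [u] says that [1 - u] lies between [(1 - t) / 4] and [(1 - t) / 2], and this
    comparison passes to the points [t w] and [u w]. They lie on one radius, so their distance is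
    the difference of their [delta], at most [(4 - 1) * delta (smul u w)]. *)
Lemma dilation_delta (t u : R) w : pdisc w -> (0 <= t < 1)%R -> ((1 + t) / 2 <= u <= (3 + t) / 4)%R ->
  [/\ (0 < delta (smul u w))%R, (delta (smul u w) <= delta (smul t w))%R,
      (delta (smul t w) <= 4 * delta (smul u w))%R &
      (normc (cpt (smul t w) - cpt (smul u w)) <= 3 * delta (smul u w))%R].
Proof.
move=> /pdiscP w1 /andP[t0 t1] /andP[u1 u2]; have n0 := normc_ge0 (cpt w).
have u0 : (0 <= u)%R by lra.
rewrite /delta !normc_smul (ger0_norm t0) (ger0_norm u0) !cpt_smul -mulrBl -rmorphB normcMr.
have tu : (t - u <= 0)%R by lra.
rewrite (ler0_norm tu); move: (normc _) w1 n0 => n w1 n0.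
have h1 : (0 <= (1 - n) * u)%R by rewrite mulr_ge0//; lra.
have h2 : (0 <= n * (u - t))%R by rewrite mulr_ge0//; lra.
have h3 : (0 <= (1 - n) * (3 + t - 4 * u))%R by rewrite mulr_ge0//; lra.
have h4 : (0 <= (1 - n) * (1 - u))%R by rewrite mulr_ge0//; lra.
have h5 : (0 <= (1 - n) * t)%R by rewrite mulr_ge0//; lra.
by split; nra.
Qed.

(** Provides a majorant of the dilate at [t] that depends on [u w] alone, as [carleson_smoothing]
    demands. The constants of [hull] come from here: with [D = delta (smul u w)], a point of the
    square about [t w] is within [2 D + 3 D] of [u w], and its own [delta] lies between [D / 2] and
    [3 / 2 * 4 * D]. *)
Lemma hull_mean_submean p : (1 <= p)%R -> exists K : R, (0 < K)%R /\ forall f w (t u : R),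
  analytic_on_disc f -> pdisc w -> (0 <= t < 1)%R -> ((1 + t) / 2 <= u <= (3 + t) / 4)%R ->
  (normc (f (cpt (smul t w))) `^ p)%:E <= K%:E * hull_mean p f (smul u w).
Proof.
move=> p1; have [K [K0 H]] := @submean_pow R p p1.
exists K; split => // f w t u af dw t01 tu.
have [d0 d1 d2 d3] := dilation_delta dw t01 tu.
have dt : (0 < delta (smul t w))%R by exact: lt_le_trans d1.
rewrite (le_trans (H _ _ af dt))// /hull_mean muleA -EFinM; apply: lee_pmul.
- by rewrite lee_fin divr_ge0// ?(ltW K0)// exprn_ge0// ltW.
- apply: integral_ge0 => v _; rewrite lee_fin; case: ifP => // _.
  by apply: on_disc_ge0 => ? _; exact: powR_ge0.
- rewrite lee_fin; apply: ler_wpM2l; first exact: ltW.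
  rewrite powRN powR_mulrn ?(ltW d0)// lef_pV2 ?posrE ?exprn_gt0//.
  by apply: lerXn2r; rewrite ?nnegrE ?(ltW d0) ?(ltW dt).
apply: le_integral_nonneg => v _.
  by rewrite lee_fin; case: ifP => // _; apply: on_disc_ge0 => ? _; exact: powR_ge0.
rewrite lee_fin /hull_kernel; case: ifPn => [sq|_]; last exact: hull_kernel_ge0.
have [n1 n2 n3] := in_square_near dt sq.
rewrite ifT//= /hull d0 /=.
have n4 : (normc (cpt v - cpt (smul u w)) <= 5 * delta (smul u w))%R.
  have := ler_normcD (cpt v - cpt (smul t w))%R (cpt (smul t w) - cpt (smul u w))%R.
  by rewrite addrA subrK; lra.
apply/and3P; split; [|lra|lra].
apply/andP; split.
- by have := ler_Re_normc (cpt v - cpt (smul u w))%R; rewrite ReB' => h; exact: le_trans n4.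
- by have := ler_Im_normc (cpt v - cpt (smul u w))%R; rewrite ImB' => h; exact: le_trans n4.
Qed.

(** Exchange the integrals: a point [v] belongs only to hulls of points in the square of half-side
    [10 * delta v] about it (5 times a factor 2), where [delta] is comparable to [delta v]. The area
    [(20 * delta v) ^ 2] cancels the normalization [delta ^ (- 2)]. *)
Lemma integral_hull_mean_le p alpha : (1 <= p)%R -> exists C : R, (0 < C)%R /\ forall f,
  analytic_on_disc f ->
  \int[pl]_w ((delta w `^ alpha)%:E * hull_mean p f w) <= C%:E * bint p alpha f.
Proof.
move=> p1; pose B := (6 `^ `|alpha - 2|)%R; have B0 : (0 < B)%R by rewrite powR_gt0.
have C0 : (0 < B * 20 ^+ 2)%R by rewrite mulr_gt0 ?exprn_gt0 ?ltr0n.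
exists (B * 20 ^+ 2)%R; split => //.
move=> f af.
pose Psi (x : (mR * mR) * (mR * mR)) : \bar R := ((delta x.1 `^ (alpha - 2)) * hull_kernel p f x)%:E.
have mk := measurable_hull_kernel p af.
have mPsi : measurable_fun setT Psi.
  apply/measurable_EFinP; apply: measurable_funM => //.
  apply: (measurableT_comp (measurable_powR _)).
  by apply: (measurableT_comp measurable_delta); exact: measurable_fst.
have Psi0 x : 0 <= Psi x by rewrite lee_fin mulr_ge0 ?powR_ge0 ?hull_kernel_ge0.
have mks w : measurable_fun setT (fun v => (hull_kernel p f (w, v))%:E).
  by apply/measurable_EFinP; apply: (measurableT_comp mk); exact: pair1_measurable.
apply: (@le_trans _ _ (\int[pl]_w \int[pl]_v Psi (w, v))).
  apply: le_integral_nonneg => w _; first by rewrite mule_ge0 ?hull_mean_ge0// lee_fin powR_ge0.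
  have -> : \int[pl]_v Psi (w, v) = (delta w `^ (alpha - 2))%:E * \int[pl]_v (hull_kernel p f (w, v))%:E.
    rewrite -(ge0_integralZ pl (powR_ge0 _ _) (mks w)) => [|v]; last by rewrite lee_fin hull_kernel_ge0.
    by apply: eq_integral => v _; rewrite -EFinM.
  have [dw|dw] := ltP 0%R (delta w); last by rewrite hull_mean_out// mule0 mule_ge0 ?lee_fin ?powR_ge0//;
    apply: integral_ge0 => v _; rewrite lee_fin hull_kernel_ge0.
  by rewrite /hull_mean muleA -EFinM -powRD ?(gt_eqF dw) ?implybT.
rewrite plane_tonelli2//.
have slice v : \int[pl]_w Psi (w, v) <=
    (B * 20 ^+ 2)%:E * (on_disc (fun v => normc (f (cpt v)) `^ p * delta v `^ alpha)%R v)%:E.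
  have [dv|dv] := ltP 0%R (delta v); last first.
    rewrite integral0_eq; last first.
      by move=> w _; rewrite /Psi /hull_kernel /on_disc/= ltNge dv /=; case: ifP; rewrite mulr0.
    by rewrite -EFinM lee_fin mulr_ge0 ?on_disc_bint_ge0// (ltW C0).
  pose c : R := (normc (f (cpt v)) `^ p * (B * delta v `^ (alpha - 2)))%R.
  have c0 : (0 <= c)%R by rewrite !mulr_ge0 ?powR_ge0.
  apply: (@le_trans _ _ (c%:E * \int[pl]_w ((in_square v (10 * delta v) w)%:R : R)%:E)).
    rewrite -(ge0_integralZ pl c0); last 2 first.
    - apply/measurable_EFinP.
      rewrite (_ : (fun w => _) = (fun w => if in_square v (10 * delta v)%R w then 1%R else 0%R : R)).
        by apply: measurable_fun_ifT => //; exact: measurable_in_square.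
      by apply/funext => w; case: ifP.
    - by move=> w; rewrite lee_fin ler0n.
    apply: le_integral_nonneg => w _ //; rewrite -EFinM lee_fin /hull_kernel/=.
    case: ifP => [/and4P[dw /andP[s1 s2] e1 e2]|_]; last by rewrite mulr0 mulr_ge0.
    have -> : in_square v (10 * delta v)%R w.
      apply/andP; split; rewrite distrC.
        by rewrite (le_trans s1)//; lra.
      by rewrite (le_trans s2)//; lra.
    rewrite mulr1 /on_disc dv /c mulrC; apply: ler_wpM2l; first exact: powR_ge0.
    by apply: powR_comparable => //; lra.
  rewrite integral_in_square ?mulr_gt0// -!EFinM lee_fin /on_disc dv /c.
  have -> : (delta v `^ (alpha - 2) = delta v `^ alpha / delta v ^+ 2)%R.
    by rewrite powRD ?(gt_eqF dv) ?implybT// powRN powR_mulrn// ltW.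
  by rewrite le_eqVlt; apply/orP; left; apply/eqP; field; rewrite gt_eqF.
apply: (@le_trans _ _ (\int[pl]_v ((B * 20 ^+ 2)%:E *
    (on_disc (fun v => normc (f (cpt v)) `^ p * delta v `^ alpha)%R v)%:E))).
  by apply: le_integral_nonneg => v _; [exact: integral_ge0|exact: slice].
rewrite (ge0_integralZ pl (ltW C0)) => [//||v].
- by apply/measurable_EFinP; exact: measurable_bint.
- by rewrite lee_fin on_disc_bint_ge0.
Qed.

End HullAverage.

(** * Integrals of dilates of an analytic function *)

Section DilationOperator.
Context {R : realType}.
Local Notation mR := (measurableTypeR R).
Implicit Types (f : R[i] -> R[i]) (c : R -> R) (b t : R) (z : R[i]).

Lemma analytic_bounded f (r : R) : analytic_on_disc f -> r < 1 ->
  exists M : R, forall z, normc z <= r -> normc (f z) <= M.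
Proof.
move=> af r1.
have [|N HN] := @inbox_compact R (fun n z => normc z <= r -> normc (f z) <= n%:R); last first.
  exists N%:R => z zr; apply: HN => //; apply: normc_inbox; lra.
move=> z0 _; have [z0r|z0r] := leP (normc z0) r; last first.
  exists (normc z0 - r), 0%N; split; first by rewrite subr_gt0.
  move=> n z _ zz0 zr; have := lerB_normc z0 z; rewrite normc_distC; lra.
have [d [M [d0 M0 HM]]] := ccont_bounded (analytic_ccont af (le_lt_trans z0r r1)).
exists d, (Num.truncn M).+1; split => // n z Nn /HM h _.
by rewrite (le_trans h)// (le_trans (ltW (truncnS_gt M)))// ler_nat.
Qed.

(** The weight [c] lets one definition cover two integrals: [c = 1] gives the integrand of the
    operator, while [c t = (1 - t) ^ tau] with [f = 1] gives the test kernels. *)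
Definition dilate c f b t z : R[i] := (c t)%:C * (f (t%:C * z) / cpowR (1 - t%:C * z) b).

Lemma normc_realM_lt1 t z : `|t| <= 1 -> normc z < 1 -> normc (t%:C * z) < 1.
Proof.
by move=> t1; apply: le_lt_trans; rewrite normcMr ler_piMl ?normc_ge0.
Qed.

Lemma dilate_analytic c f b t : analytic_on_disc f -> 0 <= t < 1 -> analytic_on_disc (dilate c f b t).
Proof.
move=> /analytic_cderiv[f' df] /andP[t0 t1].
have -> : dilate c f b t = (fun z => (c t)%:C * (f (0 + t%:C * z) * (cpowR (1 - (0 + t%:C * z)) b)^-1)).
  by apply/funext => z; rewrite /dilate add0r.
have tz z : normc z < 1 -> normc (0 + t%:C * z) < 1.
  by move=> z1; rewrite add0r; apply: normc_realM_lt1 => //; rewrite ger0_norm// ltW.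
eapply cderiv_analytic => z z1; apply: cderivM; first exact: cderiv_cst.
apply: cderivM; first by apply: cderiv_comp_affine; apply: df; exact: tz.
apply: (@cderiv_comp_affine R (fun z => (cpowR (1 - z) b)^-1)).
by apply: cpowR_inv_cderiv; exact: tz.
Qed.

Lemma oneB_dilate t z : 0 <= t <= 1 -> normc z < 1 ->
  0 < 1 - t * normc z /\ 1 - t * normc z <= normc (1 - t%:C * z).
Proof.
move=> /andP[t0 t1] z1; have n0 := normc_ge0 z; split.
  by rewrite subr_gt0 (le_lt_trans _ z1)// ler_piMl.
have := ler_normcB 1 (t%:C * z); have := lerB_normc 1 (t%:C * z).
by rewrite normcMr (ger0_norm t0) normc1.
Qed.

Lemma normc_dilate_le c f b t z : 0 <= b -> 0 <= t <= 1 -> normc z < 1 ->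
  normc (dilate c f b t z) <= `|c t| * (normc (f (t%:C * z)) * (1 - t * normc z) `^ (- b)).
Proof.
move=> b0 t01 z1; have [h1 h2] := oneB_dilate t01 z1.
rewrite /dilate normcMr normcM normcV; apply: ler_wpM2l => //.
apply: ler_wpM2l; first exact: normc_ge0.
have n0 : 0 < normc (1 - t%:C * z) by exact: lt_le_trans h2.
rewrite normc_cpowR -?normc_gt0// powRN lef_pV2 ?posrE ?powR_gt0//.
by apply: ge0_ler_powR; rewrite ?nnegrE// ltW.
Qed.

Lemma dilate_bounded c f b (r : R) : 0 <= b -> analytic_on_disc f -> r < 1 ->
  (forall t, 0 <= t < 1 -> `|c t| <= 1) ->
  exists M : R, forall t z, 0 <= t < 1 -> normc z <= r -> normc (dilate c f b t z) <= M.
Proof.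
move=> b0 af r1 c1; have [M HM] := analytic_bounded af r1.
exists (M * (1 - r) `^ (- b)) => t z t01 zr; have /andP[t0 t1] := t01.
have z1 : normc z < 1 by exact: le_lt_trans r1.
have t01' : 0 <= t <= 1 by rewrite t0 ltW.
have n0 := normc_ge0 z.
have tz : t * normc z <= r by rewrite (le_trans _ zr)// ler_piMl// ltW.
rewrite (le_trans (normc_dilate_le _ _ b0 t01' z1))//.
have e0 : 0 <= normc (f (t%:C * z)) * (1 - t * normc z) `^ (- b).
  by rewrite mulr_ge0 ?normc_ge0 ?powR_ge0.
rewrite (le_trans (ler_wpM2r e0 (c1 _ t01)))// mul1r; apply: ler_pM; rewrite ?normc_ge0 ?powR_ge0//.
  by apply: HM; rewrite normcMr ger0_norm.
rewrite !powRN lef_pV2 ?posrE ?powR_gt0//; [|lra|lra].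
by apply: ge0_ler_powR; rewrite ?nnegrE//; lra.
Qed.

Lemma edge_cont_dilate f b z : analytic_on_disc f -> normc z < 1 ->
  edge_cont (fun x => f (x * z)) /\ edge_cont (fun x => f (x * z) / cpowR (1 - x * z) b).
Proof.
move=> af z1.
have tz (y : R) : -1 <= y <= 1 -> normc (y%:C * z) < 1.
  by move=> y1; apply: normc_realM_lt1 => //; rewrite ler_norml.
have cm y : ccont (fun x : R[i] => x * z) y%:C.
  by apply: ccontM; [exact: ccont_id|exact: ccont_cst].
have cf : edge_cont (fun x => f (x * z)).
  by move=> y y1; apply: (ccont_comp (cm y)); apply: analytic_ccont => //; exact: tz.
split=> // y y1; apply: ccontM; first exact: cf.
apply: (@ccont_comp R (fun x => (cpowR (1 - x) b)^-1) (fun x => x * z)) => //.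
by apply: cderiv_ccont (cpowR_inv_cderiv b (tz _ y1)).
Qed.

Lemma itv01_measurable_edge (F : R[i] -> R) (g : R[i] -> R[i]) :
  (forall z w, `|F z - F w| <= normc (z - w)) -> edge_cont g ->
  measurable_fun (`[0, 1[%classic : set mR) (fun y : mR => F (g y%:C)).
Proof.
move=> FL gc; have /measurable_int/measurable_EFinP := edge_cont_integrable FL gc.
apply: measurable_funS; first exact: measurable_itv.
by move=> y /=; rewrite !in_itv/= => /andP[y0 y1]; apply/andP; split; lra.
Qed.

Lemma dilate_cmeasurable c f b z : measurable_fun (`[0, 1[%classic : set mR) c ->
  analytic_on_disc f -> normc z < 1 -> cmeasurable `[0, 1[ (fun t => dilate c f b t z).
Proof.
move=> mc af z1; have [_ ec] := edge_cont_dilate b af z1; split.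
  rewrite (_ : (fun x => _) = (fun t => c t * complex.Re (f (t%:C * z) / cpowR (1 - t%:C * z) b))).
    by apply: measurable_funM => //; exact: (itv01_measurable_edge (@Re_lipschitz R) ec).
  by apply/funext => t; rewrite /dilate ReMr.
rewrite (_ : (fun x => _) = (fun t => c t * complex.Im (f (t%:C * z) / cpowR (1 - t%:C * z) b))).
  by apply: measurable_funM => //; exact: (itv01_measurable_edge (@Im_lipschitz R) ec).
by apply/funext => t; rewrite /dilate ImMr.
Qed.

Section Measure.
Variable nu : {measure set mR -> \bar R}.
Hypothesis nu_fin : (nu (`[0%R, 1%R[%classic : set mR) < +oo)%E.

Lemma dilate_cintegrable c f b z : 0 <= b -> measurable_fun (`[0, 1[%classic : set mR) c ->
  (forall t, 0 <= t < 1 -> `|c t| <= 1) -> analytic_on_disc f -> normc z < 1 ->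
  cintegrable nu `[0, 1[ (fun t => dilate c f b t z).
Proof.
move=> b0 mc c1 af z1; have [M HM] := dilate_bounded b0 af z1 c1.
apply: (@bounded_cintegrable _ _ _ _ _ M) => //.
- exact: dilate_cmeasurable.
- by move=> t /=; rewrite in_itv/= => t01; exact: HM.
Qed.

Lemma dilate_cintegral_analytic c f b : 0 <= b -> measurable_fun (`[0, 1[%classic : set mR) c ->
  (forall t, 0 <= t < 1 -> `|c t| <= 1) -> analytic_on_disc f ->
  analytic_on_disc (fun z => cintegral nu `[0, 1[ (fun t => dilate c f b t z)).
Proof.
move=> b0 mc c1 af; apply: (@analytic_cintegral R nu `[0, 1[%classic (dilate c f b) (measurable_itv _) nu_fin).
- by move=> t /=; rewrite in_itv/=; exact: dilate_analytic.
- by move=> z z1; exact: dilate_cmeasurable.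
- move=> r r1; have [M HM] := dilate_bounded b0 af r1 c1.
  by exists M => t z /=; rewrite in_itv/=; exact: HM.
Qed.

End Measure.

Lemma cesaro_opE (mu : {measure set mR -> \bar R}) b f z :
  cesaro_op mu b f z = cintegral mu `[0, 1[ (fun t => dilate (fun=> 1) f b t z).
Proof.
by rewrite /cesaro_op; congr (cintegral _ _ _); apply/funext => t; rewrite /dilate mul1r.
Qed.

End DilationOperator.

(** * Sufficiency *)

Section Sufficiency.
Context {R : realType} (mu : {finite_measure set (measurableTypeR R) -> \bar R}).
Local Notation mR := (measurableTypeR R).
Local Notation leb := (@lebesgue_measure R).
Local Notation pl := (leb \x leb)%E.
Implicit Types (f : R[i] -> R[i]) (w : mR * mR).
Local Open Scope ereal_scope.

Lemma mule_rearrange (a b c d l : R) (x : \bar R) : (c * l = a * d)%R ->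
  (a * b)%:E * (d%:E * x) = c%:E * (l%:E * x * b%:E).
Proof. by move=> cl; rewrite muleA -EFinM mulrAC -cl !EFinM [l%:E * x * _]muleAC !muleA. Qed.

(** For [r <= 0] the finite total mass suffices, because [(1 - r) ^ s >= 1]. Such [r] do occur: the
    smoothing evaluates tails at [4 * u - 3]. *)
Lemma carleson_tail s : (0 <= s)%R -> carleson mu s -> exists C : R, (0 < C)%R /\
  forall r : R, (r < 1)%R -> mu `[r, 1%R[%classic <= (C * (1 - r) `^ s)%:E.
Proof.
move=> s0 [C [C0 HC]].
have fin : mu setT \is a fin_num by exact: fin_num_measure.
pose T := fine (mu setT); have T0 : (0 <= T)%R by rewrite fine_ge0.
exists (C + T)%R; split; first by rewrite ltr_wpDr.
move=> r r1; have [r0|r0] := ltP 0%R r.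
  have r01 : (0 < r < 1)%R by rewrite r0.
  rewrite (le_trans (HC r r01))// lee_fin; apply: ler_wpM2r; first exact: powR_ge0.
  by rewrite lerDl.
apply: (@le_trans _ _ (mu setT)).
  by apply: le_measure; rewrite ?inE//; exact: measurable_itv.
rewrite -(fineK fin) lee_fin -/T (@le_trans _ _ (C + T)%R)//; first by rewrite lerDr ltW.
rewrite ler_peMr ?addr_ge0 ?(ltW C0)//.
by rewrite -[leLHS](powRr0 (1 - r)%R); apply: ler_powR => //; lra.
Qed.

(** The kernel increases with [t], so smoothing may replace [t] by any larger [u]; the resulting
    integral against [(1 - u) ^ (s - 1)] has the form of [beta_type_integral_le] with [x = 1 - u]
    and [d = 1 - n]. *)
Lemma carleson_kernel_integral (C s a : R) : (0 < C)%R ->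
  (forall r : R, (r < 1)%R -> mu `[r, 1%R[%classic <= (C * (1 - r) `^ s)%:E) ->
  (0 < s < a)%R -> exists B : R, (0 < B)%R /\ forall n : R, (0 <= n < 1)%R ->
  \int[mu]_(t in `[0%R, 1%R[) ((1 - t * n) `^ (- a))%:E <= (B * (1 - n) `^ (s - a))%:E.
Proof.
move=> C0 HC sa; have [B [B0 HB]] := beta_type_integral_le sa.
have /andP[s0 s1] := sa; have a0 : (0 < a)%R by exact: lt_trans s1.
pose E := (2 * C * 4 `^ s)%R; have E0 : (0 < E)%R by rewrite !mulr_gt0 ?powR_gt0.
pose K := (2 `^ `|- a|)%R; have K0 : (0 < K)%R by rewrite powR_gt0.
exists (E * (K * B))%R; split; first by rewrite !mulr_gt0.
move=> n /andP[n0 n1]; pose d := (1 - n)%R; have d0 : (0 < d)%R by rewrite subr_gt0.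
have mp (c e : R) : measurable_fun setT (fun x : mR => ((1 - x * c) `^ e)%R).
  apply: (measurableT_comp (measurable_powR _)).
  by apply: measurable_funB => //; exact: measurable_funM.
have sm := @carleson_smoothing R mu C s (fun t => ((1 - t * n) `^ (- a))%:E)
  (fun u => ((1 - u * n) `^ (- a))%:E) C0 HC.
rewrite (le_trans (sm _ _ _ _))//.
- by apply/measurable_EFinP; exact: mp.
- by move=> u; rewrite lee_fin powR_ge0.
- by move=> t _; rewrite lee_fin powR_ge0.
- move=> t u /andP[t0 t1] /andP[u1 u2]; rewrite lee_fin !powRN.
  have h1 : (t * n <= u * n)%R by rewrite ler_wpM2r//; lra.
  have h2 : (u * n <= n)%R by rewrite ler_piMl//; lra.
  have tn0 : (0 < 1 - t * n)%R by lra.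
  have un0 : (0 < 1 - u * n)%R by lra.
  rewrite lef_pV2 ?posrE ?powR_gt0//.
  by apply: ge0_ler_powR; rewrite ?nnegrE ?(ltW a0) ?(ltW tn0) ?(ltW un0)//; lra.
have -> : (E * (K * B) * (1 - n) `^ (s - a))%:E = E%:E * (K * B * (1 - n) `^ (s - a))%:E :> \bar R.
  by rewrite -EFinM !mulrA.
apply: lee_wpmul2l; first by rewrite lee_fin ltW.
pose h (x : mR) : \bar R := ((fun x : mR => (K * (x `^ (s - 1) * (d + x) `^ (- a)))%:E) \_ `]0%R, +oo[) x.
have mi : measurable_fun setT (fun x : mR => (x `^ (s - 1) * (d + x) `^ (- a))%R).
  apply: measurable_funM; first exact: measurable_powR.
  by apply: (measurableT_comp (measurable_powR _)); exact: measurable_funD.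
have mh : measurable_fun setT h.
  apply/(measurable_restrictT (fun x : mR => (K * (x `^ (s - 1) * (d + x) `^ (- a)))%:E)).
    exact: measurable_itv.
  by apply: measurable_funTS; apply/measurable_EFinP; exact: measurable_funM.
have h0 x : 0 <= h x.
  by rewrite /h patchE; case: ifP => // _; rewrite lee_fin !mulr_ge0 ?powR_ge0// ltW.
have N1 : (-1)%R != 0%R :> R by rewrite oppr_eq0 oner_neq0.
apply: (@le_trans _ _ (\int[leb]_x h x)).
  have := integral_affine 1 N1 mh h0; rewrite normrN1 invr1 mul1e => <-.
  rewrite integral_mkcond; apply: le_integral_nonneg => u _; rewrite patchE; case: ifPn => //.
    by move=> _; rewrite mule_ge0// lee_fin powR_ge0.
  rewrite inE /= in_itv/= => /andP[u1 u2].
  rewrite /h mulN1r patchE mem_set/=; last by rewrite in_itv/= andbT subr_gt0.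
  rewrite -EFinM lee_fin [(_ `^ (s - 1) * _)%R]mulrC mulrA; apply: ler_wpM2r; first exact: powR_ge0.
  (* [d + (1 - u)] exceeds [1 - u * n] by [(1 - u) * (1 - n)], at most [u * (1 - n)] because
     [u >= 1 / 2]; hence the two differ by a factor at most 2. *)
  have u3 : (0 <= (1 - u) * (1 - n))%R by rewrite mulr_ge0 ?subr_ge0// ltW.
  have u4 : (0 <= u * (1 - n))%R by rewrite mulr_ge0 ?subr_ge0 ?(ltW n1)//; clear -u1; lra.
  have u5 : (1 / 2 * (1 - n) <= u * (1 - n))%R by rewrite ler_wpM2r//; lra.
  have un : (1 - u * n = (1 - u) + u * (1 - n))%R by ring.
  have un' : (d + (1 - u) = (1 - u) + u * (1 - n) + (1 - u) * (1 - n))%R by rewrite /d; ring.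
  have u6 : ((1 - u) * (1 - n) <= u * (1 - n))%R.
    by rewrite ler_wpM2r ?subr_ge0 ?(ltW n1)//; clear -u1; lra.
  have u7 : (0 < 1 - u)%R by rewrite subr_gt0.
  rewrite un un'; move: (u * (1 - n))%R ((1 - u) * (1 - n))%R u3 u4 u6 u7 => x y u3 u4 u6 u7.
  by apply: powR_comparable; clear -u3 u4 u6 u7; lra.
rewrite /h -integral_mkcond.
under eq_integral do rewrite EFinM.
rewrite ge0_integralZl//.
- by rewrite -mulrA EFinM; apply: lee_wpmul2l; [rewrite lee_fin ltW|exact: HB].
- by apply: measurable_funTS; exact/measurable_EFinP.
- by move=> x _; rewrite lee_fin mulr_ge0 ?powR_ge0.
- by rewrite lee_fin ltW.
Qed.

(* Jensen with the weight (1 - t|z|)^(-a): any a > s works as long as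
   kappa = alpha2 - (a - s)(p - 1) > -1, hence the choice of eta. *)
Lemma cesaro_bint_le (C p beta s alpha1 alpha2 : R) : (1 <= p)%R -> (0 < beta)%R ->
  (-1 < alpha2)%R -> (s = beta + (alpha1 - alpha2) / p)%R -> (0 < s)%R -> (0 < C)%R ->
  (forall r : R, (r < 1)%R -> mu `[r, 1%R[%classic <= (C * (1 - r) `^ s)%:E) ->
  exists B : R, (0 < B)%R /\ forall f, analytic_on_disc f ->
    bint p alpha2 (cesaro_op mu beta f) <= B%:E * bint p alpha1 f.
Proof.
move=> p1 b0 a2 sE s0 C0 HC; have p0 : (0 < p)%R by lra.
pose eta := ((alpha2 + 1) / (2 * p))%R.
have eta0 : (0 < eta)%R by rewrite divr_gt0//; lra.
pose a := (s + eta)%R; have sa : (0 < s < a)%R by rewrite s0 ltrDl.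
have sa_eta : (s - a = - eta)%R by rewrite /a; ring.
pose kappa := (alpha2 + (s - a) * (p - 1))%R.
have k1 : (-1 < kappa)%R.
  rewrite /kappa sa_eta.
  have -> : (alpha2 + - eta * (p - 1) = (alpha2 + 1) / 2 + eta - 1)%R.
    by rewrite /eta; field; rewrite gt_eqF.
  lra.
(* The integrand left by Jensen is the [p]-th power of [f] at [t w] times [delta (smul t w) ^ b];
   [bks] states that, with the [kappa + s] of the radial average, the exponents add up to
   [alpha1]. *)
pose b := ((a - beta) * p - a)%R.
have bks : (kappa + s + b = alpha1)%R.
  rewrite /kappa /b sa_eta /a sE /eta; field; exact/negbT/gt_eqF.
have [M [M0 HM]] := carleson_kernel_integral C0 HC sa.
have [S [S0 HS]] := radial_average k1 s0.
have [K [K0 HK]] := @hull_mean_submean R p p1.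
have [H [H0 HH]] := @integral_hull_mean_le R p alpha1 p1.
pose L := (K * 4 `^ `|b|)%R; have L0 : (0 < L)%R by rewrite mulr_gt0 ?powR_gt0.
pose E := (2 * C * 4 `^ s)%R; have E0 : (0 < E)%R by rewrite !mulr_gt0 ?powR_gt0.
(* In [2 * 2], one factor is that of [jensen_le] and the other that of the modulus of a complex
   integral. *)
pose D := ((2 * 2) `^ p * M `^ (p - 1) * E * L)%R.
have D0 : (0 < D)%R by rewrite !mulr_gt0 ?powR_gt0 ?mulr_gt0.
exists (S * (D * H))%R; split; first exact: (mulr_gt0 S0 (mulr_gt0 D0 H0)).
move=> f af; have mhm := measurable_hull_mean p af.
pose g w : \bar R := D%:E * ((delta w `^ b)%:E * hull_mean p f w).
have mdb (e : R) : measurable_fun setT (fun w => (delta w `^ e)%:E).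
  by apply/measurable_EFinP; exact: measurable_delta_powR.
have mg : measurable_fun setT g.
  by apply: measurable_funeM; apply: emeasurable_funM.
have g0 w : 0 <= g w.
  by rewrite /g mule_ge0 ?lee_fin ?(ltW D0)// mule_ge0 ?lee_fin ?powR_ge0 ?hull_mean_ge0.
have mitv : measurable (`[0%R, 1%R[%classic : set mR) by exact: measurable_itv.
have muitv : mu (`[0%R, 1%R[%classic : set mR) < +oo.
  by rewrite -ge0_fin_numE//; exact: fin_num_measure.
have ptw w : (on_disc (fun v => normc (cesaro_op mu beta f (cpt v)) `^ p * delta v `^ alpha2)%R w)%:E <=
    \int[leb]_u (if (0 < delta w)%R && ((1 / 2 <= u)%R && (u < 1)%R)
      then (delta w `^ kappa * (1 - u) `^ (s - 1))%:E * g (smul u w) else 0).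
  rewrite /on_disc; case: ifPn => [dw|_]; last by apply: integral_ge0 => u _.
  set z := cpt w; set n := normc z.
  have n0 : (0 <= n)%R by exact: normc_ge0.
  have n1 : (n < 1)%R by rewrite -subr_gt0.
  have dE : delta w = (1 - n)%R by [].
  have tn (t : R) : (0 <= t < 1)%R -> (0 < 1 - t * n)%R.
    by move=> /andP[t0 t1]; rewrite subr_gt0 (le_lt_trans _ n1)// ler_piMl// ltW.
  have [cf _] := edge_cont_dilate beta af n1.
  have mfz : measurable_fun (`[0%R, 1%R[%classic : set mR) (fun t => normc (f (t%:C * z)%R)).
    exact: (itv01_measurable_edge (@ler_dist_normc R) cf).
  have mp (e : R) : measurable_fun (`[0%R, 1%R[%classic : set mR) (fun t : mR => ((1 - t * n) `^ e)%R).
    apply: measurable_funTS; apply: (measurableT_comp (measurable_powR _)).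
    by apply: measurable_funB => //; exact: measurable_funM.
  pose k (t : mR) := ((1 - t * n) `^ (- a))%R.
  pose x (t : mR) := (normc (f (t%:C * z)) * (1 - t * n) `^ (a - beta))%R.
  have c1 (t : R) : (0 <= t < 1)%R -> (`|(fun=> 1) t : R| <= 1)%R by rewrite normr1.
  have step1 : (normc (cesaro_op mu beta f z))%:E <= 2%:E * \int[mu]_(t in `[0%R, 1%R[) (k t * x t)%:E.
    have mc1 : measurable_fun (`[0%R, 1%R[%classic : set mR) (fun=> 1%R : R) by exact: measurable_cst.
    have ci := dilate_cintegrable muitv (ltW b0) mc1 c1 af n1.
    rewrite cesaro_opE (le_trans (normc_cintegral_le_ge0 mitv ci))//.
    apply: lee_wpmul2l; first by rewrite lee_fin.
    apply: le_integral_nonneg => t; first by rewrite lee_fin normc_ge0.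
    rewrite /= in_itv/= => t01; rewrite lee_fin; have /andP[t0 t1] := t01.
    have t01' : (0 <= t <= 1)%R by rewrite t0 ltW.
    rewrite (le_trans (normc_dilate_le _ _ (ltW b0) t01' n1))// normr1 mul1r /k /x mulrCA -/n.
    by rewrite -powRD ?(gt_eqF (tn _ t01)) ?implybT// addrA addNr add0r.
  have m0 : (0 < M * (1 - n) `^ (s - a))%R by rewrite mulr_gt0 ?powR_gt0// subr_gt0.
  have n01 : (0 <= n < 1)%R by rewrite n0.
  have jen := @jensen_le _ _ _ mu `[0%R, 1%R[%classic mitv k x p (M * (1 - n) `^ (s - a))%R p1 m0
    (fun t _ => powR_ge0 _ _) (fun t _ => mulr_ge0 (normc_ge0 _) (powR_ge0 _ _)) (mp _)
    (measurable_funM mfz (mp _)) (HM n n01) _ 2%R (normc_ge0 _) (ltr0n R 2) step1.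
  have step2 : \int[mu]_(t in `[0%R, 1%R[) (k t * x t `^ p)%:E <=
      E%:E * \int[leb]_(u in `[(1 / 2)%R, 1%R[) ((L%:E * ((delta (smul u w) `^ b)%:E * hull_mean p f (smul u w))) * ((1 - u) `^ (s - 1))%:E).
    apply: (@carleson_smoothing R mu C s (fun t => (k t * x t `^ p)%:E)
      (fun u => L%:E * ((delta (smul u w) `^ b)%:E * hull_mean p f (smul u w))) C0 HC).
    - have ms : measurable_fun setT (fun u : mR => smul u w).
        by apply/measurable_fun_pairP; split; exact: measurable_funM.
      apply: measurable_funeM; apply: emeasurable_funM.
        exact: (measurableT_comp (mdb b) ms).
      exact: (measurableT_comp mhm ms).
    - by move=> u; rewrite mule_ge0 ?lee_fin ?(ltW L0)// mule_ge0 ?lee_fin ?powR_ge0 ?hull_mean_ge0.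
    - by move=> t _; rewrite lee_fin mulr_ge0 ?powR_ge0.
    move=> t u t01 tu; have t1 := tn _ t01; have /andP[t0 _] := t01.
    have -> : (k t * x t `^ p = normc (f (cpt (smul t w))) `^ p * delta (smul t w) `^ b)%R.
      rewrite /k /x powRM ?normc_ge0 ?powR_ge0// -powRrM mulrCA -powRD; last first.
        by rewrite (gt_eqF t1) implybT.
      rewrite /delta normc_smul (ger0_norm t0) cpt_smul -/z -/n; congr (_ * _ `^ _)%R.
      by rewrite /b addrC.
    have [d0 d1 d2 _] := dilation_delta dw t01 tu.
    have dt : (0 < delta (smul t w))%R by exact: lt_le_trans d1.
    apply: (@le_trans _ _ (K%:E * hull_mean p f (smul u w) * (4 `^ `|b| * delta (smul u w) `^ b)%:E)).
      rewrite EFinM; apply: lee_pmul; [by rewrite lee_fin powR_ge0|by rewrite lee_fin powR_ge0|exact: HK|].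
      by rewrite lee_fin; apply: powR_comparable => //; clear -d0 d1 d2 dt; lra.
    by rewrite /L muleAC -!EFinM [leRHS]muleA -EFinM mulrA.
  pose G (u : mR) : \bar R := (delta (smul u w) `^ b)%:E * hull_mean p f (smul u w).
  have G0 u : 0 <= G u by rewrite mule_ge0 ?hull_mean_ge0// lee_fin powR_ge0.
  have mG : measurable_fun setT G.
    have ms : measurable_fun setT (fun u : mR => smul u w).
      by apply/measurable_fun_pairP; split; exact: measurable_funM.
    apply: emeasurable_funM; first exact: (measurableT_comp (mdb b) ms).
    exact: (measurableT_comp mhm ms).
  pose c1' := ((2 * 2) `^ p * (M * (1 - n) `^ (s - a)) `^ (p - 1))%R.
  have c10 : (0 <= c1')%R by rewrite mulr_ge0 ?powR_ge0.
  pose c := (delta w `^ alpha2 * (c1' * E))%R.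
  have c0 : (0 <= c)%R by rewrite mulr_ge0 ?powR_ge0// mulr_ge0// ltW.
  have cL : (c * L = delta w `^ kappa * D)%R.
    rewrite /c /c1' /D (powRM _ (ltW M0) (powR_ge0 _ _)) -powRrM -dE.
    have -> : (delta w `^ kappa = delta w `^ alpha2 * delta w `^ ((s - a) * (p - 1)))%R.
      have d0 : (0 < delta w)%R by [].
      by rewrite -powRD// (gt_eqF d0) implybT.
    by ring.
  have mGs : measurable_fun (`[(1 / 2)%R, 1%R[%classic : set mR)
      (fun u : mR => L%:E * G u * ((1 - u) `^ (s - 1))%:E).
    apply: measurable_funTS; apply: emeasurable_funM; first exact: measurable_funeM.
    apply/measurable_EFinP; apply: (measurableT_comp (measurable_powR _)).
    exact: measurable_funB.
  apply: (@le_trans _ _ (c%:E * \int[leb]_(u in `[(1 / 2)%R, 1%R[) (L%:E * G u * ((1 - u) `^ (s - 1))%:E))).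
    rewrite mulrC EFinM /c EFinM -muleA; apply: lee_wpmul2l; first by rewrite lee_fin powR_ge0.
    by apply: (le_trans jen); rewrite [X in _ <= X * _]EFinM -muleA; apply: lee_wpmul2l; first rewrite lee_fin.
  rewrite -ge0_integralZl//; last first.
    by move=> u _; rewrite mule_ge0 ?lee_fin ?powR_ge0// mule_ge0// lee_fin ltW.
  rewrite integral_mkcond; apply: le_integral_nonneg => u _; rewrite patchE; case: ifPn => //.
    move=> _; rewrite mule_ge0 ?lee_fin// mule_ge0 ?lee_fin ?powR_ge0// mule_ge0// lee_fin; exact: ltW.
    rewrite inE /= in_itv/= => -> /=; rewrite /g -/(G u).
    have -> // : (delta w `^ kappa * (1 - u) `^ (s - 1))%:E * (D%:E * G u) =
        c%:E * (L%:E * G u * ((1 - u) `^ (s - 1))%:E).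
    exact: mule_rearrange.
  by move=> _; case: ifP => // _; rewrite mule_ge0 ?g0// lee_fin mulr_ge0 ?powR_ge0.
apply: (@le_trans _ _ (\int[pl]_w \int[leb]_u (if (0 < delta w)%R && ((1 / 2 <= u)%R && (u < 1)%R)
      then (delta w `^ kappa * (1 - u) `^ (s - 1))%:E * g (smul u w) else 0))).
  by apply: le_integral_nonneg => w _; [rewrite lee_fin on_disc_bint_ge0|exact: ptw].
rewrite (le_trans (HS _ mg g0))// [X in _ <= X * _]EFinM -muleA; apply: lee_wpmul2l; first by rewrite lee_fin ltW.
apply: (@le_trans _ _ (\int[pl]_w (D%:E * ((delta w `^ alpha1)%:E * hull_mean p f w)))).
  apply: le_integral_nonneg => w _; first by rewrite mule_ge0// lee_fin powR_ge0.
  have [dw|dw] := ltP 0%R (delta w); last first.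
    by rewrite /g hull_mean_out// !mule0.
  by rewrite /g muleCA [X in _ * X <= _]muleA -EFinM -powRD ?(gt_eqF dw) ?implybT// bks.
rewrite (ge0_integralZ pl (ltW D0)).
- by rewrite [X in _ <= X * _]EFinM -muleA; apply: lee_wpmul2l; [rewrite lee_fin ltW|exact: HH].
- by apply: emeasurable_funM.
- by move=> w; rewrite mule_ge0 ?hull_mean_ge0// lee_fin powR_ge0.
Qed.

End Sufficiency.

Section SufficiencyTheorem.
Context {R : realType} (mu : {finite_measure set (measurableTypeR R) -> \bar R}).
Implicit Types (f : R[i] -> R[i]) (p q alpha : R).

(** Write the [q]-th power as the [p]-th power times the power [q - p], and apply the growth bound
    to the latter; the new exponent of the weight is the one that compensates the power of [delta]
    so produced. *)
Lemma bergman_embedding p q alpha f : 1 <= p -> p <= q -> bergman p alpha f ->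
  bergman q ((alpha + 2) * q / p - 2) f.
Proof.
move=> p1 pq fp; have p0 : 0 < p by lra.
have q0 : 0 < q by lra.
have [C [C0 HC]] := bergman_growth p1 fp; move: fp => /bergman_bint[af fin].
apply/bergman_bint; split; first exact: af.
set alpha' := _ - 2.
pose e := (alpha + 2) / p; pose K := C `^ (q - p).
have K0 : 0 < K by rewrite powR_gt0.
apply: (@le_lt_trans _ _ (K%:E * bint p alpha f)%E); last first.
  by apply: lte_mul_pinfty => //; rewrite lee_fin ltW.
rewrite /bint -(ge0_integralZ _ (ltW K0)); last 2 first.
- by apply/measurable_EFinP; exact: measurable_bint.
- by move=> v; rewrite lee_fin on_disc_bint_ge0.
apply: le_integral_nonneg => v _; first by rewrite lee_fin on_disc_bint_ge0.
rewrite -EFinM lee_fin /on_disc; case: ifP => dv; last by rewrite mulr0.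
have nv : normc (cpt v) < 1 by rewrite -subr_gt0.
have := HC _ nv; rewrite -/(delta v) -/e => h.
set x := normc (f (cpt v)) in h *; have x0 : 0 <= x by exact: normc_ge0.
have qE : q = p + (q - p) by ring.
have xq : x `^ q = x `^ p * x `^ (q - p).
  have [->|xn] := eqVneq x 0; first by rewrite (@powR0 _ q) ?(gt_eqF q0)// (@powR0 _ p) ?(gt_eqF p0)// mul0r.
  by rewrite {1}qE powRD// (negbTE xn) implybT.
have h' : x `^ (q - p) <= K * delta v `^ (- e * (q - p)).
  rewrite powRrM -powRM ?powR_ge0// ?(ltW C0)//.
  by apply: ge0_ler_powR; rewrite ?nnegrE ?subr_ge0// mulr_ge0 ?powR_ge0// ltW.
rewrite xq -mulrA [leRHS]mulrCA; apply: ler_wpM2l; first exact: powR_ge0.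
have -> : delta v `^ alpha = delta v `^ (- e * (q - p)) * delta v `^ alpha'.
  rewrite -powRD; last by rewrite (gt_eqF dv) implybT.
  by congr (_ `^ _); rewrite /e /alpha'; field; rewrite gt_eqF.
by rewrite mulrA; apply: ler_wpM2r => //; exact: powR_ge0.
Qed.

Lemma cesaro_bergman p q beta s alpha1 alpha2 f : 1 <= p -> p <= q -> 0 < beta ->
  -1 < alpha2 -> s = beta + (alpha1 + 2) / p - (alpha2 + 2) / q -> 0 < s ->
  carleson mu s -> bergman p alpha1 f -> bergman q alpha2 (cesaro_op mu beta f).
Proof.
move=> p1 pq b0 a2 sE s0 cs fp; have p0 : 0 < p by lra.
have q0 : 0 < q by lra.
have [C [C0 HC]] := carleson_tail (ltW s0) cs.
have /bergman_bint[af fin] := bergman_embedding p1 pq fp.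
have q1 : 1 <= q by exact: le_trans pq.
have sE' : s = beta + (((alpha1 + 2) * q / p - 2) - alpha2) / q.
  by rewrite sE; field; rewrite (gt_eqF p0) (gt_eqF q0).
have [B [B0 HB]] := cesaro_bint_le q1 b0 a2 sE' s0 C0 HC.
apply/bergman_bint; split.
  rewrite (_ : cesaro_op mu beta f = (fun z => cintegral mu `[0, 1[ (fun t => dilate (fun=> 1) f beta t z))); last first.
    by apply/funext => z; rewrite cesaro_opE.
  apply: dilate_cintegral_analytic => //; last 2 first.
  - exact: ltW.
  - by move=> t _; rewrite normr1.
  by rewrite -ge0_fin_numE//; exact: fin_num_measure.
apply: (le_lt_trans (HB _ af)); apply: lte_mul_pinfty => //; rewrite lee_fin; exact: ltW.
Qed.

End SufficiencyTheorem.

(** * Necessity *)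

Section TestFunction.
Context {R : realType}.
Local Notation mR := (measurableTypeR R).
Local Notation leb := (@lebesgue_measure R).
Local Notation pl := (leb \x leb)%E.
Local Open Scope ereal_scope.

(** Handles the symmetry in [x]: the distance [X - |x|] to the end of the chord covers each value
    once on either side of 0. *)
Lemma integral_reflect_le (h : mR -> \bar R) (k : R -> \bar R) (X : R) :
  measurable_fun setT h -> (forall t, 0 <= h t) -> (forall x, 0 <= k x) ->
  (forall x, k x <= h (X - `|x|)%R) ->
  \int[leb]_x k x <= 2%:E * \int[leb]_t h t.
Proof.
move=> mh h0 k0 kh.
have aff (b : R) : `|b|%R = 1%R -> measurable_fun setT (fun x : mR => h (X + b * x)%R) /\
    \int[leb]_x h (X + b * x)%R = \int[leb]_t h t.
  move=> b1; have b0 : b != 0%R by rewrite -normr_gt0 b1.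
  split; last by rewrite (integral_affine X b0 mh h0) b1 invr1 mul1e.
  by apply: (measurableT_comp mh); apply: measurable_funD => //; exact: measurable_funM.
have [m1 i1] := aff 1%R (normr1 _); have [m2 i2] := aff (-1)%R (normrN1 _).
apply: (@le_trans _ _ (\int[leb]_x (h (X + 1 * x)%R + h (X + -1 * x)%R))).
  apply: le_integral_nonneg => x _ //; rewrite (le_trans (kh x))//.
  have [x0|x0] := leP 0%R x.
    by rewrite ger0_norm// mulN1r leeDr.
  by rewrite ltr0_norm// opprK mul1r leeDl.
rewrite ge0_integralD// i1 i2 (_ : 2%:E = 1%:E + 1%:E)%E; last by rewrite -EFinD.
by rewrite ge0_muleDl ?lee_fin// !mul1e.
Qed.

(** Split at [t = 1 / 2], where only one factor can be large on each side. The part near [t = 1] is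
    bounded by a constant, which [e ^ (1 - m) >= 1] absorbs. *)
Lemma vertical_integral_le (m sigma : R) : (1 < m)%R -> (-1 < sigma <= 0)%R ->
  exists C : R, (0 < C)%R /\ forall e : R, (0 < e <= 1)%R ->
  \int[leb]_(t in `[0%R, 1%R[) ((e + t) `^ (- m) * (1 - t) `^ sigma)%:E <= (C * e `^ (1 - m))%:E.
Proof.
move=> m1 /andP[s1 s0]; pose A := (2 `^ `|sigma|)%R; pose B := (2 `^ m)%R.
have A0 : (0 < A)%R by rewrite powR_gt0. have B0 : (0 < B)%R by rewrite powR_gt0.
have m10 : (0 < m - 1)%R by rewrite subr_gt0. have s10 : (0 < sigma + 1)%R by lra.
exists (A / (m - 1) + B / (sigma + 1))%R; split; first by rewrite addr_gt0// divr_gt0.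
move=> e /andP[e0 e1].
have anti (x y c : R) : (0 <= c)%R -> (0 < x)%R -> (x <= y)%R -> (y `^ (- c) <= x `^ (- c))%R.
  move=> c0 x0 xy; have y0 : (0 < y)%R by exact: lt_le_trans xy.
  by rewrite !powRN lef_pV2 ?posrE ?powR_gt0//; apply: ge0_ler_powR; rewrite ?nnegrE// ltW.
have mf (a b c : R) (D : set mR) : measurable_fun D (fun u : mR => ((a + b * u) `^ c)%:E).
  apply: measurable_funTS; apply/measurable_EFinP; apply: (measurableT_comp (measurable_powR _)).
  by apply: measurable_funD => //; exact: measurable_funM.
apply: (@le_trans _ _ (\int[leb]_(t in `[0%R, 1%R[)
   (A%:E * ((e + 1 * t) `^ (- m))%:E + B%:E * ((1 + -1 * t) `^ sigma)%:E))).
  apply: le_integral_nonneg => t; first by rewrite lee_fin mulr_ge0 ?powR_ge0.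
  rewrite /= in_itv/= mul1r mulN1r -!EFinM -EFinD lee_fin => /andP[t0 t1].
  have [th|th] := leP t (1 / 2)%R.
    rewrite -[leLHS]addr0 mulrC; apply: lerD; last by rewrite mulr_ge0 ?powR_ge0.
    apply: ler_wpM2r; first exact: powR_ge0.
    have -> : (A = A * 1 `^ sigma)%R by rewrite powR1 mulr1.
    by apply: powR_comparable => //; lra.
  rewrite -[leLHS]add0r; apply: lerD; first by rewrite mulr_ge0 ?powR_ge0.
  apply: ler_wpM2r; first exact: powR_ge0.
  have -> : (B = (1 / 2) `^ (- m))%R by rewrite div1r -[(2^-1)%R]powR_inv1// -powRrM mulN1r opprK.
  by apply: anti; lra.
rewrite ge0_integralD//; last 4 first.
- by move=> u _; rewrite -EFinM lee_fin mulr_ge0 ?powR_ge0 ?(ltW A0).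
- exact: measurable_funeM.
- by move=> u _; rewrite -EFinM lee_fin mulr_ge0 ?powR_ge0 ?(ltW B0).
- exact: measurable_funeM.
rewrite !ge0_integralZl//; last 4 first.
- by move=> u _; rewrite lee_fin powR_ge0.
- by rewrite lee_fin ltW.
- by move=> u _; rewrite lee_fin powR_ge0.
- by rewrite lee_fin ltW.
have I2 : \int[leb]_(t in `[0%R, 1%R[) ((1 + -1 * t) `^ sigma)%:E <= (1 / (sigma + 1))%:E.
  have -> : (1 / (sigma + 1) = 1 `^ (sigma + 1) / (sigma + 1))%R by rewrite powR1.
  apply: integral_powR_affine_le => //; first by rewrite normrN1.
  by move=> u /=; rewrite in_itv/= => /andP[? ?]; apply/andP; split; lra.
have I1 : \int[leb]_(t in `[0%R, 1%R[) ((e + 1 * t) `^ (- m))%:E <= (e `^ (1 - m) / (m - 1))%:E.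
  have mm : (- m < -1)%R by lra.
  have := integral_powRoo_le mm e0.
  have -> : (e `^ (- m + 1) / - (- m + 1) = e `^ (1 - m) / (m - 1))%R.
    by rewrite opprD opprK [(- m + 1)%R]addrC.
  apply: le_trans; rewrite [leRHS]integral_mkcond.
  set h := (h in \int[leb]_x h x).
  have mh : measurable_fun setT h.
    apply/(measurable_restrictT (fun x : mR => (x `^ (- m))%:E)); first exact: measurable_itv.
    by apply/measurable_EFinP; exact: measurable_powRx.
  have h0 x : 0 <= h x by rewrite /h patchE; case: ifP => // _; rewrite lee_fin powR_ge0.
  have n10 : (1 : R)%R != 0%R by exact: oner_neq0.
  have := integral_affine e n10 mh h0; rewrite normr1 invr1 mul1e => <-.
  rewrite [leLHS]integral_mkcond; apply: le_integral_nonneg => u _; rewrite patchE; case: ifPn => //.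
    by rewrite lee_fin powR_ge0.
  rewrite inE /= in_itv/= => /andP[u0 _]; rewrite /h patchE mem_set//= in_itv/= andbT; lra.
apply: (@le_trans _ _ (A%:E * (e `^ (1 - m) / (m - 1))%:E + B%:E * (1 / (sigma + 1))%:E)).
  by apply: leeD; apply: lee_wpmul2l => //; rewrite lee_fin ltW.
rewrite -!EFinM -EFinD lee_fin mulrDl; apply: lerD; first by rewrite mulrA mulrAC.
have e2 : (1 <= e `^ (1 - m))%R.
  by have := anti e 1%R (m - 1)%R (ltW m10) e0 e1; rewrite powR1 opprB.
by rewrite mul1r ler_peMr// divr_ge0// ltW.
Qed.

(* In Cartesian coordinates 1 - |z| is comparable to X (X - |x|), where [-X, X]
   is the horizontal chord of the disc through z. *)
Lemma test_kernel_lower (a : R) (w : mR * mR) : (1 / 2 <= a < 1)%R ->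
  pdisc w ->
  let X := (Num.sqrt (1 - w.2 ^+ 2))%R in
  [/\ (`|w.2| < 1)%R, (0 < X - `|w.1|)%R, (1 - `|w.2| <= X <= 1)%R &
    [/\ (delta w <= 2 * (X * (X - `|w.1|)))%R, (X * (X - `|w.1|) <= 2 * delta w)%R,
    ((1 - a) + `|w.2| <= 4 * normc (1 - a%:C * cpt w)%R)%R &
    ((1 - a) + (X - `|w.1|) <= 2 * normc (1 - a%:C * cpt w)%R)%R]].
Proof.
move=> /andP[a1 a2] dw X.
have nw : (normc (cpt w) < 1)%R by apply/pdiscP.
have n0 := normc_ge0 (cpt w).
have nE : (normc (cpt w) ^+ 2 = w.1 ^+ 2 + w.2 ^+ 2)%R by rewrite normc_sqr.
have x0 := normr_ge0 w.1; have y0 := normr_ge0 w.2.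
have xx : (`|w.1| ^+ 2 = w.1 ^+ 2)%R by rewrite real_normK ?num_real.
have yy : (`|w.2| ^+ 2 = w.2 ^+ 2)%R by rewrite real_normK ?num_real.
have yn := ler_Im_normc (cpt w); have xn := ler_Re_normc (cpt w); rewrite /= in xn yn.
have y1 : (`|w.2| < 1)%R by exact: le_lt_trans nw.
have Y0 : (0 < 1 - w.2 ^+ 2)%R by rewrite -yy; nra.
have X0 : (0 < X)%R by rewrite /X sqrtr_gt0.
have XX : (X ^+ 2 = 1 - w.2 ^+ 2)%R by rewrite /X sqr_sqrtr// ltW.
have Xn : (X ^+ 2 - `|w.1| ^+ 2 = (1 - normc (cpt w)) * (1 + normc (cpt w)))%R.
  by rewrite XX xx -[RHS]/(_ * _)%R; have -> : ((1 - normc (cpt w)) * (1 + normc (cpt w)) = 1 - normc (cpt w) ^+ 2)%R by [ring]; rewrite nE; ring.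
have Xx : (`|w.1| < X)%R.
  by rewrite -(@ltr_pXn2r _ 2) ?nnegrE ?(ltW X0)// -subr_gt0 Xn mulr_gt0//; lra.
have X1 : (X <= 1)%R.
  by rewrite -(@ler_pXn2r _ 2) ?nnegrE ?(ltW X0)// XX expr1n; have := sqr_ge0 w.2; lra.
have yX : (1 - `|w.2| <= X)%R.
  by rewrite -(@ler_pXn2r _ 2) ?nnegrE ?(ltW X0)// ?XX -?yy; [nra|lra].
have Re1 : (1 - a * w.1 <= normc (1 - a%:C * cpt w)%R)%R.
  apply: le_trans (ler_Re_normc _); rewrite ReB' ReMr /=; exact: ler_norm.
have Im1 : (a * `|w.2| <= normc (1 - a%:C * cpt w)%R)%R.
  apply: le_trans (ler_Im_normc _); rewrite ImB' ImMr /= sub0r normrN normrM.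
  by rewrite (ger0_norm (_ : 0 <= a)%R)//; lra.
have xa := ler_norm w.1.
have ax : (a * w.1 <= a * `|w.1|)%R by apply: ler_wpM2l => //; lra.
have ax2 : (a * `|w.1| <= `|w.1|)%R by rewrite ler_piMl//; lra.
have ay : (1 / 2 * `|w.2| <= a * `|w.2|)%R by rewrite ler_wpM2r.
have ax3 : (1 / 2 * (1 - `|w.1|) <= a * (1 - `|w.1|))%R by rewrite ler_wpM2r//; lra.
move: Re1 Im1; move: (normc (1 - _)%R) => N Re1 Im1.
have PX : ((X - `|w.1|) * (X + `|w.1|) = delta w * (1 + normc (cpt w)))%R.
  by rewrite /delta -Xn; ring.
have p1 : (0 <= (X - `|w.1|) * (X - `|w.1|))%R by rewrite -expr2 sqr_ge0.
have p2 : (0 <= (X - `|w.1|) * `|w.1|)%R by rewrite mulr_ge0// subr_ge0 ltW.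
have p3 : (0 <= delta w * normc (cpt w))%R by rewrite mulr_ge0// ltW.
have p4 : (delta w * normc (cpt w) <= delta w)%R by rewrite ler_piMr// ltW.
have e1 : ((X - `|w.1|) * (X + `|w.1|) = X * (X - `|w.1|) + (X - `|w.1|) * `|w.1|)%R by ring.
have e2 : (X * (X - `|w.1|) = (X - `|w.1|) * (X - `|w.1|) + (X - `|w.1|) * `|w.1|)%R by ring.
have PX' : (X * (X - `|w.1|) + (X - `|w.1|) * `|w.1| = delta w + delta w * normc (cpt w))%R.
  by rewrite -e1 PX; ring.
split; [by []|by rewrite subr_gt0|by rewrite yX|split; last 2 first].
- by clear -a1 a2 Re1 Im1 ax ax2 ay ax3 x0 y0 y1 Xx X1 xa; lra.
- by clear -a1 a2 Re1 Im1 ax ax2 ay ax3 x0 y0 y1 Xx X1 xa; lra.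
- by move: (X * (X - `|w.1|))%R ((X - `|w.1|) * `|w.1|)%R (delta w * _)%R PX' p2 p3 p4 p1 e2;
    move: ((X - `|w.1|) * (X - `|w.1|))%R => P0 P1 P2 P3; clear; lra.
- by move: (X * (X - `|w.1|))%R ((X - `|w.1|) * `|w.1|)%R (delta w * _)%R PX' p2 p3 p4 => P1 P2 P3; clear; lra.
Qed.

Lemma powRN_le (u v c m : R) : (0 <= m)%R -> (0 < u)%R -> (0 < c)%R -> (u <= c * v)%R ->
  (v `^ (- m) <= c `^ m * u `^ (- m))%R.
Proof.
move=> m0 u0 c0 uv; have v0 : (0 < v)%R by rewrite -(pmulr_rgt0 _ c0) (lt_le_trans u0).
rewrite !powRN ler_pdivlMr ?powR_gt0// mulrC ler_pdivrMr ?powR_gt0//.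
by rewrite -(powRM _ (ltW c0) (ltW v0)); apply: ge0_ler_powR; rewrite ?nnegrE ?mulr_ge0 ?(ltW u0) ?(ltW c0) ?(ltW v0).
Qed.

(** With [N = 2 * m], one power [m] of the kernel is spent on the vertical and one on the horizontal
    distance, which separates the variables. The horizontal integral gives
    [(1 - a) ^ (alpha + 1 - m)] and needs [alpha + 1 < m]; the vertical one gives
    [(1 - a) ^ (1 - m)] and needs [m > 1]. *)
Lemma test_integral_le (N alpha : R) : (-1 < alpha)%R -> (2 * (alpha + 1) < N)%R -> (2 < N)%R ->
  exists C : R, (0 < C)%R /\ forall a : R, (1 / 2 <= a < 1)%R ->
  \int[pl]_w (on_disc (fun w => normc (1 - a%:C * cpt w) `^ (- N) * delta w `^ alpha)%R w)%:E <=
  (C * (1 - a) `^ (alpha + 2 - N))%:E.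
Proof.
move=> a1 aN N2; pose m := (N / 2)%R.
have m1 : (1 < m)%R by rewrite /m; lra.
have m0 : (0 <= m)%R by lra.
have ma : (0 < alpha + 1 < m)%R by rewrite /m; apply/andP; split; lra.
(* The factor [X ^ alpha] is at most [(1 - |y|) ^ alpha] when [alpha < 0], since [1 - |y| <= X], and
   at most 1 otherwise, since [X <= 1]. *)
pose sigma := Num.min alpha 0%R.
have sg : (-1 < sigma <= 0)%R by rewrite /sigma lt_min a1 ge_min lexx orbT /= andbT; lra.
have [Cx [Cx0 HCx]] := beta_type_integral_le ma.
have [Cy [Cy0 HCy]] := vertical_integral_le m1 sg.
pose B := (4 `^ m * 2 `^ m * 2 `^ `|alpha|)%R.
have B0 : (0 < B)%R by rewrite !mulr_gt0 ?powR_gt0.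
exists (2 * (B * Cx) * (2 * Cy))%R; split; first by rewrite !mulr_gt0.
move=> a a12; have /andP[ah a2] := a12; pose e := (1 - a)%R.
have e0 : (0 < e)%R by rewrite subr_gt0.
have e1 : (0 < e <= 1)%R by rewrite e0 /e; lra.
pose h (t : R) : R := if (0 < t)%R then (t `^ alpha * (e + t) `^ (- m))%R else 0%R.
pose q (t : R) : R := if (0 <= t < 1)%R then ((e + t) `^ (- m) * (1 - t) `^ sigma)%R else 0%R.
have h0 t : (0 <= h t)%R by rewrite /h; case: ifP => // _; rewrite mulr_ge0 ?powR_ge0.
have q0 t : (0 <= q t)%R by rewrite /q; case: ifP => // _; rewrite mulr_ge0 ?powR_ge0.
have mh : measurable_fun setT (h : mR -> R).
  apply: measurable_fun_ifT => //; first exact: measurable_fun_ltr.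
  apply: measurable_funM; first exact: measurable_powR.
  by apply: (measurableT_comp (measurable_powR _)); exact: measurable_funD.
have mq : measurable_fun setT (q : mR -> R).
  apply: measurable_fun_ifT => //.
    by apply: measurable_and; [exact: measurable_fun_ler|exact: measurable_fun_ltr].
  apply: measurable_funM; apply: (measurableT_comp (measurable_powR _)).
    exact: measurable_funD.
  exact: measurable_funB.
have Ih : \int[leb]_t (h t)%:E <= (Cx * e `^ (alpha + 1 - m))%:E.
  rewrite (le_trans _ (HCx e e0))// [leRHS]integral_mkcond.
  apply: le_integral_nonneg => t _; first by rewrite lee_fin.
  rewrite patchE /h; case: ifPn => [t0|_].
    by rewrite mem_set/= ?in_itv/= ?t0// addrK.
  by case: ifP => // _; rewrite lee_fin mulr_ge0 ?powR_ge0.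
have Iq : \int[leb]_t (q (1 - t)%R)%:E <= (Cy * e `^ (1 - m))%:E.
  have N1 : (-1)%R != 0%R :> R by rewrite oppr_eq0 oner_neq0.
  have mqE : measurable_fun setT (fun t : mR => (q t)%:E) by exact/measurable_EFinP.
  have := integral_affine 1 N1 mqE (fun t => q0 t); rewrite normrN1 invr1 mul1e.
  under eq_integral do rewrite mulN1r.
  move=> ->; rewrite (le_trans _ (HCy e e1))// [leRHS]integral_mkcond.
  apply: le_integral_nonneg => t _; first by rewrite lee_fin.
  rewrite patchE /q; case: ifPn => [t0|_]; first by rewrite mem_set//= in_itv.
  by case: ifP => // _; rewrite lee_fin mulr_ge0 ?powR_ge0.
pose k w := on_disc (fun w => normc (1 - a%:C * cpt w) `^ (- N) * delta w `^ alpha)%R w.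
have k0 w : (0 <= k w)%R by apply: on_disc_ge0 => v _; rewrite mulr_ge0 ?powR_ge0.
have mk : measurable_fun setT (fun w => (k w)%:E).
  apply/measurable_EFinP; apply: measurable_on_disc; apply: measurable_funM; last first.
    exact: measurable_delta_powR.
  apply: (measurableT_comp (measurable_powR _)).
  apply: (@plane_measurable_fun R (@normc R) (fun z => 1 - a%:C * z)%R pdisc).
  - exact: ler_dist_normc.
  - exact: pdisc_open.
  - move=> w _; apply: ccontD; first exact: ccont_cst.
    by apply: ccontN; apply: ccontM; [exact: ccont_cst|exact: ccont_id].
have k0E w : 0 <= (k w)%:E by rewrite lee_fin.
have ptw w : (k w <= B * q `|w.2| * h (Num.sqrt (1 - w.2 ^+ 2) - `|w.1|))%R.
  rewrite /k /on_disc; case: ifPn => [dw|_]; last by rewrite !mulr_ge0// ltW.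
  have := test_kernel_lower a12 dw; set X := Num.sqrt _.
  move=> [y1 Xx /andP[X1 X2] [d1 d2 n1 n2]].
  set x := (X - `|w.1|)%R in Xx d1 d2 n2 *; set n := normc _ in n1 n2 *.
  have X0 : (0 < X)%R by apply: lt_le_trans X1; rewrite subr_gt0.
  have y0 := normr_ge0 w.2.
  rewrite /h Xx /q y0 y1 /=.
  have nN : (n `^ (- N) <= (4 `^ m * (e + `|w.2|) `^ (- m)) * (2 `^ m * (e + x) `^ (- m)))%R.
    have -> : (n `^ (- N) = n `^ (- m) * n `^ (- m))%R.
      have n0 : (0 < n)%R by rewrite -(pmulr_rgt0 _ (ltr0n R 2)); apply: lt_le_trans n2; exact: addr_gt0.
      rewrite -powRD ?(gt_eqF n0) ?implybT//; congr (_ `^ _)%R; by rewrite /m; field.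
    by apply: ler_pM; rewrite ?powR_ge0//; apply: powRN_le => //; [exact: ltr_wpDr|exact: addr_gt0].
  have dl : (delta w `^ alpha <= 2 `^ `|alpha| * ((1 - `|w.2|) `^ sigma * x `^ alpha))%R.
    apply: (@le_trans _ _ (2 `^ `|alpha| * (X * x) `^ alpha)%R).
      by apply: powR_comparable => //; [exact: mulr_gt0|clear; lra].
    apply: ler_wpM2l; first exact: powR_ge0.
    rewrite (powRM _ (ltW X0) (ltW Xx)); apply: ler_wpM2r; first exact: powR_ge0.
    rewrite /sigma; have [al|al] := ltP alpha 0%R; last first.
      rewrite powRr0 -[leRHS](powRr0 X); apply: ger_powR => //.
      by rewrite X0.
    have := @powRN_le (1 - `|w.2|)%R X 1%R (- alpha)%R.
    by rewrite powR1 !mul1r opprK; apply => //; clear -X1 y1 al; lra.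
  rewrite (le_trans (ler_pM (powR_ge0 _ _) (powR_ge0 _ _) nN dl))//.
  rewrite /B le_eqVlt; apply/orP; left; apply/eqP; ring.
rewrite (@fubini_tonelli2 _ _ mR mR R leb leb _ mk k0E) /fubini_G.
have cxe : (0 <= Cx * e `^ (alpha + 1 - m))%R by rewrite mulr_ge0 ?powR_ge0 ?(ltW Cx0).
have inner (y : mR) : \int[leb]_x (k (x, y))%:E <=
    (2 * (B * (Cx * e `^ (alpha + 1 - m))) * q `|y|)%:E.
  have Bq : (0 <= B * q `|y|)%R by rewrite mulr_ge0// ltW.
  have mhE : measurable_fun setT (fun t : mR => (h t)%:E) by exact/measurable_EFinP.
  apply: (@le_trans _ _ (2%:E * \int[leb]_t ((B * q `|y|)%:E * (h t)%:E))).
    apply: (@integral_reflect_le (fun t => (B * q `|y|)%:E * (h t)%:E) _ (Num.sqrt (1 - y ^+ 2))).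
    - exact: measurable_funeM.
    - by move=> t; rewrite mule_ge0 ?lee_fin.
    - by move=> x; rewrite lee_fin.
    - by move=> x; rewrite -EFinM lee_fin; exact: ptw.
  rewrite (ge0_integralZ leb Bq mhE) => [|t]; last by rewrite lee_fin.
  apply: (@le_trans _ _ (2%:E * ((B * q `|y|)%:E * (Cx * e `^ (alpha + 1 - m))%:E))).
    by apply: lee_wpmul2l; [rewrite lee_fin|apply: lee_wpmul2l; [rewrite lee_fin|]].
  by rewrite -!EFinM lee_fin le_eqVlt; apply/orP; left; apply/eqP; ring.
pose D := (2 * (B * (Cx * e `^ (alpha + 1 - m))))%R.
have D0 : (0 <= D)%R by rewrite /D (mulr_ge0 (ler0n R 2) (mulr_ge0 (ltW B0) cxe)).
apply: (@le_trans _ _ (2%:E * \int[leb]_t (D%:E * (q (1 - t)%R)%:E))).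
  apply: (@integral_reflect_le (fun t => D%:E * (q (1 - t)%R)%:E) _ 1%R).
  - apply: measurable_funeM; apply/measurable_EFinP; apply: (measurableT_comp mq).
    exact: measurable_funB.
  - by move=> t; rewrite mule_ge0 ?lee_fin.
  - by move=> y; apply: integral_ge0 => x _; rewrite lee_fin.
  - by move=> y; rewrite -EFinM subKr; exact: inner.
rewrite (ge0_integralZ leb D0); last 2 first.
- by apply/measurable_EFinP; apply: (measurableT_comp mq); exact: measurable_funB.
- by move=> t; rewrite lee_fin.
apply: (@le_trans _ _ (2%:E * (D%:E * (Cy * e `^ (1 - m))%:E))).
  by apply: lee_wpmul2l; [rewrite lee_fin|apply: lee_wpmul2l; [rewrite lee_fin|]].
rewrite -!EFinM lee_fin -/e.
have -> : (e `^ (alpha + 2 - N) = e `^ (alpha + 1 - m) * e `^ (1 - m))%R.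
  rewrite -powRD ?(gt_eqF e0) ?implybT//; congr (_ `^ _)%R; by rewrite /m; field.
by rewrite /D le_eqVlt; apply/orP; left; apply/eqP; ring.
Qed.

End TestFunction.

(** * A discrete measure carrying a weighted series *)

Section AtomicMeasure.
Context {R : realType} (a : nat -> R).
Hypothesis a01 : forall k, (0 <= a k < 1)%R.
Local Notation mR := (measurableTypeR R).
Local Notation leb := (@lebesgue_measure R).
Local Notation pl := (leb \x leb)%E.
Local Notation A := (`[0%R, 1%R[%classic : set mR).
Local Open Scope ereal_scope.

Definition half_weight (k : nat) : R := (1 / (2 ^ k.+1)%:R)%R.

Lemma half_weight_ge0 k : (0 <= half_weight k)%R.
Proof. by rewrite divr_ge0. Qed.

Lemma half_weight_series (r : R) : \sum_(k <oo) (half_weight k * r)%:E = r%:E.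
Proof.
have := @cvg_geometric_eseries_half R r 0; rewrite expr0 divr1 => /cvg_lim <-//.
congr (lim (_ @ \oo)); apply/funext => n; apply: eq_bigr => k _.
by rewrite /half_weight addn1 div1r mulrC.
Qed.

(** Turns the series with weights [2 ^ (- k - 1)] into an integral, so that analyticity of integrals
    of dilates and Jensen's inequality apply to it. *)
Definition atoms : {measure set mR -> \bar R} :=
  mseries (fun k => mscale (NngNum (half_weight_ge0 k)) (\d_(a k : mR)) : {measure set mR -> \bar R}) 0.

Lemma integral_atoms (h : mR -> \bar R) : measurable_fun A h -> (forall t, A t -> 0 <= h t) ->
  \int[atoms]_(t in A) h t = \sum_(k <oo) ((half_weight k)%:E * h (a k)).
Proof.
move=> mh h0; have mA : measurable A by exact: measurable_itv.
rewrite ge0_integral_measure_series//; apply: eq_eseriesr => k _.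
rewrite ge0_integral_mscale// integral_dirac// diracE mem_set ?mul1e//.
by rewrite /= in_itv/=; exact: a01.
Qed.

Lemma atoms_le1 : atoms A <= 1.
Proof.
have mA : measurable A by exact: measurable_itv.
rewrite -(mul1e (atoms A)) -integral_cst// integral_atoms//.
under eq_eseriesr do rewrite -EFinM.
by rewrite half_weight_series.
Qed.

End AtomicMeasure.

Section Necessity.
Context {R : realType}.
Local Notation mR := (measurableTypeR R).
Local Notation leb := (@lebesgue_measure R).
Local Notation pl := (leb \x leb)%E.
Local Notation A := (`[0%R, 1%R[%classic : set mR).
Implicit Types (f : R[i] -> R[i]).
Local Open Scope ereal_scope.

Lemma Re_cintegral (nu : {measure set mR -> \bar R}) (D : set mR) (g : R -> R[i]) :
  measurable D -> cintegrable nu D g ->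
  (complex.Re (cintegral nu D g))%:E = \int[nu]_(t in D) (complex.Re (g t))%:E.
Proof. by move=> mD [g1 _]; rewrite /= fineK//; exact: integrable_fin_num. Qed.

Lemma analytic_cst (c : R[i]) : analytic_on_disc (fun=> c).
Proof. by eapply cderiv_analytic => z z1; exact: cderiv_cst. Qed.

Lemma measurable_oneB_powR (tau : R) (D : set mR) : measurable_fun D (fun t : mR => ((1 - t) `^ tau)%R).
Proof.
apply: measurable_funTS; apply: (measurableT_comp (measurable_powR _)).
exact: measurable_funB.
Qed.

Lemma oneB_powR_le1 (tau t : R) : (0 <= tau)%R -> (0 <= t < 1)%R -> (`|(1 - t) `^ tau| <= 1)%R.
Proof.
move=> tau0 /andP[t0 t1]; rewrite ger0_norm ?powR_ge0//.
have t2 : (0 < 1 - t <= 1)%R by apply/andP; split; lra.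
by rewrite -[leRHS](powRr0 (1 - t)%R); apply: ger_powR.
Qed.

Section Gliding.
Variables (p alpha : R) (a : nat -> R).
Hypotheses (p1 : (1 <= p)%R) (alpha1 : (-1 < alpha)%R).
Hypothesis a12 : forall k, (1 / 2 <= a k < 1)%R.

Let a01 k : (0 <= a k < 1)%R.
Proof. by have /andP[h ->] := a12 k; rewrite andbT; lra. Qed.

(** Chosen large enough for [test_integral_le]: as [p >= 1], the exponent [N = alpha + 2 + tau * p]
    is at least [2 * alpha + 5], which exceeds both [2] and [2 * (alpha + 1)]. *)
Definition tau : R := (alpha + 3)%R.
(** The order for which [(1 - a) ^ (tau * p)] cancels the factor [(1 - a) ^ (alpha + 2 - N)] of
    [test_integral_le], so that the norms of the kernels are bounded independently of the pole. *)
Definition pole_order : R := ((alpha + 2) / p + tau)%R.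

(* The sum over k of 2^(-k-1) (1 - a_k)^tau (1 - a_k z)^(- pole_order). *)
Definition gliding_sum (z : R[i]) : R[i] := cintegral (atoms a) A
  (fun t => dilate (fun t => ((1 - t) `^ tau)%R) (fun=> 1%R) pole_order t z).

Let tau0 : (0 < tau)%R.
Proof. by move: alpha1; rewrite /tau; lra. Qed.

Lemma pole_order_ge0 : (0 <= pole_order)%R.
Proof. by rewrite addr_ge0 ?(ltW tau0)// divr_ge0//; move: p1 alpha1; lra. Qed.

Lemma atoms_fin : atoms a A < +oo.
Proof. exact: le_lt_trans (atoms_le1 a01) (ltry _). Qed.

Lemma gliding_sum_analytic : analytic_on_disc gliding_sum.
Proof.
apply: dilate_cintegral_analytic.
- exact: atoms_fin.
- exact: pole_order_ge0.
- exact: measurable_oneB_powR.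
- by move=> t; apply: oneB_powR_le1; exact: ltW.
- exact: analytic_cst.
Qed.

Lemma gliding_cintegrable z : (normc z < 1)%R -> cintegrable (atoms a) A
  (fun t => dilate (fun t => ((1 - t) `^ tau)%R) (fun=> 1%R) pole_order t z).
Proof.
move=> z1; apply: dilate_cintegrable => //.
- exact: atoms_fin.
- exact: pole_order_ge0.
- exact: measurable_oneB_powR.
- by move=> t; apply: oneB_powR_le1; exact: ltW.
- exact: analytic_cst.
Qed.

(** The weights have total mass at most 1, so Jensen's inequality moves the [p]-th power inside the
    sum. Each kernel then contributes at most its weight times one constant, and the weights are
    summable. *)
Lemma gliding_sum_bergman : bergman p alpha gliding_sum.
Proof.
apply/bergman_bint; split; first exact: gliding_sum_analytic.
have p0 : (0 < p)%R by move: p1; lra.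
have mA : measurable A by exact: measurable_itv.
pose N := (pole_order * p)%R.
have NE : (N = alpha + 2 + tau * p)%R by rewrite /N /pole_order; field; rewrite gt_eqF.
have tp : (tau <= tau * p)%R by rewrite ler_peMr// ltW.
have N1 : (2 * (alpha + 1) < N)%R by rewrite NE; move: alpha1 tp; rewrite /tau; move: (_ * p)%R => y; lra.
have N2 : (2 < N)%R by rewrite NE; move: alpha1 tp; rewrite /tau; move: (_ * p)%R => y; lra.
have [C [C0 HC]] := test_integral_le alpha1 N1 N2.
pose B := ((2 * 2) `^ p)%R; have B0 : (0 < B)%R by rewrite powR_gt0.
pose T k w := (on_disc (fun w => normc (1 - (a k)%:C * cpt w) `^ (- N) * delta w `^ alpha)%R w).
pose b k := (half_weight k * (B * (1 - a k) `^ (tau * p)))%R.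
have T0 k w : (0 <= T k w)%R by apply: on_disc_ge0 => v _; rewrite mulr_ge0 ?powR_ge0.
have b0 k : (0 <= b k)%R by rewrite !mulr_ge0 ?powR_ge0 ?half_weight_ge0.
have mT k : measurable_fun setT (fun w => (T k w)%:E).
  apply/measurable_EFinP; apply: measurable_on_disc; apply: measurable_funM; last first.
    exact: measurable_delta_powR.
  apply: (measurableT_comp (measurable_powR _)).
  apply: (@plane_measurable_fun R (@normc R) (fun z => 1 - (a k)%:C * z)%R pdisc).
  - exact: ler_dist_normc.
  - exact: pdisc_open.
  - move=> w _; apply: ccontD; first exact: ccont_cst.
    by apply: ccontN; apply: ccontM; [exact: ccont_cst|exact: ccont_id].
have ptw w : (on_disc (fun w => normc (gliding_sum (cpt w)) `^ p * delta w `^ alpha)%R w)%:E <=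
    \sum_(k <oo) ((b k)%:E * (T k w)%:E).
  rewrite /on_disc; case: ifPn => [dw|_]; last first.
    by apply: nneseries_ge0 => k _ _; rewrite mule_ge0 ?lee_fin.
  have z1 : (normc (cpt w) < 1)%R by apply/pdiscP.
  set z := cpt w in z1 *.
  pose x (t : mR) := normc (dilate (fun t => ((1 - t) `^ tau)%R) (fun=> 1%R) pole_order t z).
  have mx : measurable_fun A x.
    exact: cmeasurable_normc (cintegrable_cmeasurable (gliding_cintegrable z1)).
  have s1 : (normc (gliding_sum z))%:E <= 2%:E * \int[atoms a]_(t in A) (1 * x t)%:E.
    rewrite (_ : (fun t : mR => (1 * x t)%:E) = (fun t => (x t)%:E)); last first.
      by apply/funext => t; rewrite mul1r.
    have gi := gliding_cintegrable z1.
    exact: (normc_cintegral_le_ge0 mA gi).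
  have km : \int[atoms a]_(t in A) ((fun=> 1%R : R) t)%:E <= 1%:E.
    by rewrite integral_cst// mul1e; exact: atoms_le1.
  have jen := @jensen_le _ _ _ (atoms a) A mA (fun=> 1%R) x p 1%R p1 ltr01
    (fun t _ => ler01) (fun t _ => normc_ge0 _) (measurable_cst _) mx km _ 2%R (normc_ge0 _) (ltr0n R 2) s1.
  have {}jen : (normc (gliding_sum z) `^ p)%:E <= B%:E * \int[atoms a]_(t in A) (x t `^ p)%:E.
    have := jen; rewrite powR1 mulr1.
    rewrite (_ : (fun t : mR => (1 * x t `^ p)%:E) = (fun t => (x t `^ p)%:E))//.
    by apply/funext => t; rewrite mul1r.
  have mxp : measurable_fun A (fun t => (x t `^ p)%:E).
    by apply/measurable_EFinP; exact: (measurableT_comp (measurable_powR _)).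
  rewrite (integral_atoms a01 mxp) in jen; last by move=> t _; rewrite lee_fin powR_ge0.
  apply: (@le_trans _ _ ((delta w `^ alpha)%:E * (B%:E * \sum_(k <oo) ((half_weight k)%:E * (x (a k) `^ p)%:E)))).
    by rewrite mulrC EFinM; apply: lee_wpmul2l; [rewrite lee_fin powR_ge0|].
  have hx k : 0 <= (half_weight k)%:E * (x (a k) `^ p)%:E.
    by rewrite mule_ge0 ?lee_fin ?powR_ge0 ?half_weight_ge0.
  rewrite -(nneseriesZl B) // -(nneseriesZl (delta w `^ alpha)%R); last first.
    by move=> k _; rewrite mule_ge0// lee_fin ltW.
  apply: lee_nneseries => [k _ _|k _].
    apply: mule_ge0; first by rewrite lee_fin powR_ge0.
    by apply: mule_ge0 => //; rewrite lee_fin ltW.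
  rewrite -!EFinM lee_fin /T /on_disc dw /b /x /dilate.
  have /andP[a0 a1] := a01 k.
  have [_] := @oneB_dilate R (a k) z (introT andP (conj a0 (ltW a1))) z1.
  have t0 : (0 < 1 - a k * normc z)%R.
    by rewrite subr_gt0 (le_lt_trans _ z1)// ler_piMl ?normc_ge0// ltW.
  move=> /(lt_le_trans t0) n0.
  rewrite normcMr normcM normc1 mul1r normcV normc_cpowR -?normc_gt0//.
  rewrite ger0_norm ?powR_ge0// powRM ?powR_ge0 ?invr_ge0 ?powR_ge0//.
  rewrite -powRN -!powRrM mulNr -/N le_eqVlt; apply/orP; left; apply/eqP; ring.
apply: (@le_lt_trans _ _ (\int[pl]_w \sum_(k <oo) ((b k)%:E * (T k w)%:E))).
  apply: le_integral_nonneg => w _; last exact: ptw.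
  by rewrite lee_fin on_disc_bint_ge0.
rewrite integral_nneseries//; last 2 first.
- by move=> k; exact: measurable_funeM.
- by move=> k w _; rewrite mule_ge0 ?lee_fin.
apply: (@le_lt_trans _ _ (\sum_(k <oo) (half_weight k * (B * C))%:E)); last first.
  by rewrite half_weight_series ltry.
apply: lee_nneseries => [k _ _|k _].
  by apply: integral_ge0 => w _; rewrite mule_ge0 ?lee_fin.
rewrite (ge0_integralZ pl (b0 k) (mT k)) => [|w]; last by rewrite lee_fin.
rewrite (le_trans (lee_wpmul2l _ (HC (a k) (a12 k))))//; first by rewrite lee_fin.
have a2 : (0 < 1 - a k)%R by have /andP[_ h] := a01 k; rewrite subr_gt0.
rewrite -EFinM lee_fin /b -(mulrA (half_weight k)); apply: (ler_wpM2l (half_weight_ge0 k)).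
rewrite -(mulrA B); apply: (ler_wpM2l (ltW B0)).
rewrite mulrCA -powRD ?(gt_eqF a2) ?implybT//.
by rewrite (_ : tau * p + (alpha + 2 - N) = 0)%R ?powRr0 ?mulr1// NE; ring.
Qed.

End Gliding.

End Necessity.

(** * The test function at real points *)

Section LowerBound.
Context {R : realType}.
Local Notation mR := (measurableTypeR R).
Local Notation A := (`[0%R, 1%R[%classic : set mR).
Variables (p alpha : R) (a : nat -> R).
Hypotheses (p1 : (1 <= p)%R) (alpha1 : (-1 < alpha)%R).
Hypothesis a12 : forall k, (1 / 2 <= a k < 1)%R.
Local Notation M := (pole_order p alpha).
Local Notation tau := (tau alpha).
Local Open Scope ereal_scope.

Let a01 k : (0 <= a k < 1)%R.
Proof. by have /andP[h ->] := a12 k; rewrite andbT; lra. Qed.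

Lemma dilate_cst1_real (c : R -> R) (b t y : R) : (0 < 1 - t * y)%R ->
  dilate c (fun=> 1%R) b t y%:C = (c t * (1 - t * y) `^ (- b))%:C.
Proof.
move=> ty; rewrite /dilate -rmorphM/= -(rmorph1 (@real_complex R)) -rmorphB/= cpowR_real//.
by rewrite -fmorphV/= -!rmorphM/= mul1r powRN.
Qed.

(** At a real point all kernels are positive reals, so the sum is real and at least any one of its
    terms. *)
Lemma gliding_sum_ge (y : R) (k : nat) : (0 <= y < 1)%R -> exists F : R,
  gliding_sum p alpha a y%:C = F%:C /\
  (half_weight k * ((1 - a k) `^ tau * (1 - a k * y) `^ (- M)) <= F)%R.
Proof.
move=> /andP[y0 y1]; have mA : measurable A by exact: measurable_itv.
have ty (t : R) : A t -> (0 < 1 - t * y)%R.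
  rewrite /= in_itv/= => /andP[t0 t1].
  by rewrite subr_gt0 (le_lt_trans _ y1)// ler_piMl// ltW.
have ny : (normc (y%:C : R[i]) < 1)%R by rewrite normc_real ger0_norm.
have gi := gliding_cintegrable p1 alpha1 a12 ny.
exists (complex.Re (gliding_sum p alpha a y%:C)); split.
  rewrite /gliding_sum /cintegral [complex.Re _]/=; congr (_ +i* _)%C.
  rewrite /Rintegral integral0_eq// => t At.
  by rewrite dilate_cst1_real//; exact: ty.
rewrite -lee_fin /gliding_sum Re_cintegral//.
pose h (t : mR) : \bar R := ((1 - t) `^ tau * (1 - t * y) `^ (- M))%:E.
rewrite (_ : \int[_]_(t in _) _ = \int[atoms a]_(t in A) h t); last first.
  by apply: eq_integral => t /[!inE] At; rewrite dilate_cst1_real//; exact: ty.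
have h0 t : 0 <= h t by rewrite lee_fin mulr_ge0 ?powR_ge0.
have mh : measurable_fun A h.
  apply: measurable_funTS; apply/measurable_EFinP; apply: measurable_funM.
    exact: measurable_oneB_powR.
  apply: (measurableT_comp (measurable_powR _)); apply: measurable_funB => //.
  exact: measurable_funM.
have hx j : 0 <= (half_weight j)%:E * h (a j).
  by apply: mule_ge0 => //; rewrite lee_fin; exact: half_weight_ge0.
rewrite (integral_atoms a01 mh)// (nneseriesD1 (n := k))// EFinM leeDl//.
by apply: nneseries_ge0 => j _ _.
Qed.

End LowerBound.

Section NecessityTheorem.
Context {R : realType} (mu : {finite_measure set (measurableTypeR R) -> \bar R}).
Local Notation mR := (measurableTypeR R).
Local Notation A := (`[0%R, 1%R[%classic : set mR).
Local Open Scope ereal_scope.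

(** Below [1 / 2] the condition holds for every finite measure with the constant [T * 2 ^ s], so a
    failure must occur at some [r >= 1 / 2], the range where the kernel estimates apply. *)
Lemma not_carleson_point (s C : R) : (0 < s)%R -> (0 < C)%R -> ~ carleson mu s ->
  exists r : R, (1 / 2 <= r < 1)%R /\ (C * (1 - r) `^ s)%:E < mu `[r, 1%R[%classic.
Proof.
move=> s0 C0 nc; apply: contrapT => H; apply: nc.
have fin : mu setT \is a fin_num by exact: fin_num_measure.
pose T := fine (mu setT); have T0 : (0 <= T)%R by rewrite fine_ge0.
exists (C + T * 2 `^ s)%R; split; first by rewrite ltr_wpDr// mulr_ge0 ?powR_ge0.
move=> r /andP[r0 r1]; have r2 : (0 < 1 - r)%R by rewrite subr_gt0.
have [r12|r12] := leP (1 / 2)%R r.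
  rewrite leNgt; apply/negP => h; apply: H; exists r; split; first by rewrite r12.
  apply: le_lt_trans h; rewrite lee_fin; apply: ler_wpM2r; first exact: powR_ge0.
  by rewrite lerDl mulr_ge0 ?powR_ge0.
apply: (@le_trans _ _ (mu setT)).
  by apply: le_measure; rewrite ?inE//; exact: measurable_itv.
rewrite -(fineK fin) lee_fin -/T mulrDl -[leLHS]add0r; apply: lerD.
  by rewrite mulr_ge0 ?powR_ge0// ltW.
rewrite -mulrA ler_peMr// -powRM ?(ltW r2)//.
have e1 : (1 <= 2 * (1 - r))%R by lra.
by rewrite -[leLHS](powRr0 (2 * (1 - r))%R); apply: ler_powR => //; exact: ltW.
Qed.

(** The k-th term of the test function is evaluated near its own pole, on the part [[a k, 1)] of the
    measure that violates the condition. All powers of [1 - a k] cancel against the growth bound,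
    leaving [2 ^+ k * (c / 2) <= K] for every [k]. *)
Lemma carleson_necessary (p q beta s alpha1 alpha2 : R) : (1 <= p)%R -> (1 <= q)%R -> (0 < beta)%R ->
  (-1 < alpha1)%R -> (s = beta + (alpha1 + 2) / p - (alpha2 + 2) / q)%R -> (0 < s)%R ->
  (forall f, bergman p alpha1 f -> bergman q alpha2 (cesaro_op mu beta f)) -> carleson mu s.
Proof.
move=> p1 q1 b0 a1 sE s0 H; apply: contrapT => nc.
have pt k : exists r : R, (1 / 2 <= r < 1)%R /\ ((4 ^+ k) * (1 - r) `^ s)%:E < mu `[r, 1%R[%classic.
  by apply: not_carleson_point => //; exact: exprn_gt0.
have [a Ha] := boolp.choice pt.
have a12 k : (1 / 2 <= a k < 1)%R by have [] := Ha k.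
have ber := gliding_sum_bergman p1 a1 a12.
have [K [K0 HK]] := bergman_growth q1 (H _ ber).
have af := gliding_sum_analytic p1 a1 a12.
set f := gliding_sum p alpha1 a in ber HK af.
pose M := pole_order p alpha1; have M0 : (0 <= M)%R := pole_order_ge0 p1 a1.
pose c := (3 `^ (- M) * 2 `^ (- beta))%R; have c0 : (0 < c)%R by rewrite mulr_gt0 ?powR_gt0.
have mA : measurable A by exact: measurable_itv.
have muA : mu A < +oo by rewrite -ge0_fin_numE//; exact: fin_num_measure.
have key k : (2 ^+ k * (c / 2) <= K)%R.
  have [/andP[ah a2] Hk] := Ha k; pose d := (1 - a k)%R.
  have d0 : (0 < d)%R by rewrite subr_gt0.
  have ak0 : (0 <= a k)%R by lra.
  have nz : (normc ((a k)%:C : R[i]) = a k)%R by rewrite normc_real ger0_norm.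
  have nz1 : (normc ((a k)%:C : R[i]) < 1)%R by rewrite nz.
  have mc1 : measurable_fun A (fun=> 1%R : R) by exact: measurable_cst.
  have c1 (t : R) : (0 <= t < 1)%R -> (`|(fun=> 1) t : R| <= 1)%R by rewrite normr1.
  have ci := dilate_cintegrable muA (ltW b0) mc1 c1 af nz1.
  (* With [d = 1 - a k] and [a k <= t], the bases [1 - t * a k] and [1 - a k * (t * a k)] are
     largest at [t = a k], where they are [1 - a k ^ 2 <= 2 * d] and [1 - a k ^ 3 <= 3 * d]; their
     exponents are nonpositive. *)
  pose l := (half_weight k * (d `^ tau alpha1 * (3 * d) `^ (- M)) * (2 * d) `^ (- beta))%R.
  have l0 : (0 <= l)%R by rewrite !mulr_ge0 ?powR_ge0 ?half_weight_ge0.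
  have anti (x y e : R) : (0 <= e)%R -> (0 < x)%R -> (x <= y)%R -> (y `^ (- e) <= x `^ (- e))%R.
    move=> e0 x0 xy; have y0 : (0 < y)%R by exact: lt_le_trans xy.
    by rewrite !powRN lef_pV2 ?posrE ?powR_gt0//; apply: ge0_ler_powR; rewrite ?nnegrE// ltW.
  have ptw (t : R) : A t -> exists G : R, dilate (fun=> 1%R) f beta t (a k)%:C = G%:C /\ (0 <= G)%R /\
      ((a k <= t)%R -> (l <= G)%R).
    rewrite /= in_itv/= => /andP[t0 t1].
    have tak : (t * a k <= a k)%R by rewrite ler_piMl// ltW.
    have tak0 : (0 <= t * a k)%R by rewrite mulr_ge0.
    have yk : (0 <= t * a k < 1)%R by rewrite tak0 (le_lt_trans tak).
    have [F [FE Fk]] := gliding_sum_ge p1 a1 a12 k yk.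
    have pos : (0 < 1 - t * a k)%R by rewrite subr_gt0 (le_lt_trans tak).
    exists (F * (1 - t * a k) `^ (- beta))%R; split.
      rewrite /dilate -rmorphM/= /f FE -(rmorph1 (@real_complex R)) -rmorphB/= cpowR_real//.
      by rewrite -fmorphV/= -!rmorphM/= mul1r powRN.
    have F0 : (0 <= F)%R by apply: le_trans Fk; rewrite !mulr_ge0 ?powR_ge0 ?half_weight_ge0.
    split; first by rewrite mulr_ge0 ?powR_ge0.
    move=> tk.
    have aa : (a k * a k <= t * a k)%R by rewrite ler_wpM2r.
    have aaa : (a k * (a k * a k) <= a k * (t * a k))%R by rewrite ler_wpM2l.
    have aka : (a k * (t * a k) <= a k)%R by rewrite ler_piMr//; clear -tak a2; lra.
    have da : (0 <= d * a k)%R by rewrite mulr_ge0// ltW.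
    have da' : (d * a k <= d)%R by rewrite ler_piMr// ltW.
    have daa : (d * a k * a k <= d)%R by rewrite (le_trans _ da')// ler_piMr// ltW.
    have e1 : (1 - a k * a k = d + d * a k)%R by rewrite /d; ring.
    have e2 : (1 - a k * (a k * a k) = d + d * a k + d * a k * a k)%R by rewrite /d; ring.
    rewrite /l; apply: ler_pM; rewrite ?powR_ge0//.
    - by rewrite !mulr_ge0 ?powR_ge0 ?half_weight_ge0.
    - apply: le_trans Fk; apply: (ler_wpM2l (half_weight_ge0 k)).
      apply: ler_wpM2l; first exact: powR_ge0.
      by apply: anti => //; [rewrite subr_gt0 (le_lt_trans aka)|clear -aaa e2 da' daa; lra].
    - by apply: anti => //; [exact: ltW|clear -aa e1 da'; lra].
  have Reg : (l%:E * mu `[a k, 1%R[%classic) <= (complex.Re (cesaro_op mu beta f (a k)%:C))%:E.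
    rewrite cesaro_opE Re_cintegral// -integral_cst; last exact: measurable_itv.
    rewrite integral_mkcond [leRHS]integral_mkcond; apply: le_integral_nonneg => t _.
      by rewrite patchE; case: ifP => //; rewrite lee_fin.
    rewrite !patchE; case: ifPn => [/[!inE] tI|_].
      have /andP[tk t1] : (a k <= t < 1)%R by move: tI; rewrite /= in_itv.
      have At : A t by rewrite /= in_itv/= t1 andbT (le_trans ak0).
      by rewrite mem_set//; have [G [-> [_ hG]]] := ptw t At; rewrite lee_fin; exact: hG.
    by case: ifPn => // /[!inE] At; have [G [-> [hG _]]] := ptw t At; rewrite lee_fin.
  have gk := HK _ nz1; rewrite nz -/d in gk.
  have up : (complex.Re (cesaro_op mu beta f (a k)%:C) <= K * d `^ (- ((alpha2 + 2) / q)))%R.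
    by apply: le_trans gk; apply: le_trans (ler_Re_normc _); exact: ler_norm.
  have low : (l * (4 ^+ k * d `^ s) <= K * d `^ (- ((alpha2 + 2) / q)))%R.
    rewrite -lee_fin; apply: (@le_trans _ _ (complex.Re (cesaro_op mu beta f (a k)%:C))%:E).
      apply: le_trans Reg; rewrite EFinM; apply: lee_wpmul2l; first by rewrite lee_fin.
      exact: ltW.
    by rewrite lee_fin.
  have dq : (0 < d `^ (- ((alpha2 + 2) / q)))%R by rewrite powR_gt0.
  rewrite -(ler_pM2r dq); apply: le_trans low; rewrite le_eqVlt; apply/orP; left; apply/eqP.
  (* This balance of exponents is where the value of [s] is forced. *)
  have -> : (d `^ (- ((alpha2 + 2) / q)) = d `^ tau alpha1 * d `^ (- M) * d `^ (- beta) * d `^ s)%R.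
    rewrite -!powRD ?(gt_eqF d0) ?implybT//; congr (_ `^ _)%R.
    by rewrite sE /M /pole_order; ring.
  (* The weight costs [2 ^ (k + 1)] out of the gain [4 ^ k]; what remains is unbounded in [k]. *)
  have h4 : (half_weight k * 4 ^+ k = 2 ^+ k / 2 :> R)%R.
    rewrite /half_weight natrX exprS (_ : 4 = 2 * 2)%R; last by ring.
    by rewrite exprMn; field; rewrite expf_neq0.
  have -> : (2 ^+ k * (c / 2) = half_weight k * 4 ^+ k * c)%R by rewrite h4; field.
  rewrite /l /c !powRM ?(ltW d0)//; move: (half_weight k) => w; ring.
pose n := (Num.truncn (K / (c / 2))).+1.
have c2 : (0 < c / 2)%R by rewrite divr_gt0.
have := key n; rewrite -ler_pdivlMr// leNgt => /negP; apply.
apply: lt_le_trans (truncnS_gt _) _.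
by rewrite -natrX ler_nat ltnW// ltn_expl.
Qed.

End NecessityTheorem.

Unset Implicit Arguments.

(* A measure on [0, 1) is a measure on the line carried by [0, 1). *)
Theorem corollary6p13 (R : realType)
    (mu : {finite_measure set (measurableTypeR R) -> \bar R})
    (mu01 : mu (~` `[0, 1[) = 0%E)
    (p q beta alpha1 alpha2 : R)
    (p_ge1 : 1 <= p) (p_le_q : p <= q) (beta_gt0 : 0 < beta)
    (alpha1_gtN1 : -1 < alpha1) (alpha2_gtN1 : -1 < alpha2)
    (s_gt0 : 0 < (alpha1 + 2) / p - (alpha2 + 2) / q + beta) :
  (forall f : R[i] -> R[i],
     bergman p alpha1 f -> bergman q alpha2 (cesaro_op mu beta f)) <->
  carleson mu (beta + (alpha1 + 2) / p - (alpha2 + 2) / q).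
Proof.
have q_ge1 : 1 <= q by exact: le_trans p_le_q.
have s0 : 0 < beta + (alpha1 + 2) / p - (alpha2 + 2) / q.
  by rewrite [X in _ < X](_ : _ = (alpha1 + 2) / p - (alpha2 + 2) / q + beta)//; ring.
split; first exact: carleson_necessary.
by move=> cmu f; apply: cesaro_bergman.
Qed.
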